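(* Let $\Sigma$ be a bounded smooth $k$-manifold without boundary in $\mathbb{R}^d$ with $2 \le k < d$. Let $\tau = \triangle vv'v''$ be a triangle whose vertices lie on $\Sigma$. Let $u$ be a point in $\Sigma \cap N_\tau$. Let $s = |vu| = |v'u| = |v''u|$ and suppose that $s \leq \epsilon\,\mathrm{lfs}(u)$ for some $\epsilon \leq 1/3$. Let $x$ be any point on $\tau$, and let $\tilde{x}$ be the point nearest $x$ on $\Sigma$. Then for any angle $\phi \in (0^\circ, 60^\circ]$ for which both expressions in the maximum are defined, $$\angle(N_\tau, N_{\tilde{x}}\Sigma) \leq \max\left\{ \eta\left( \frac{\epsilon}{1-\epsilon} \right) + \arcsin\left( \frac{\epsilon}{1-\epsilon}\cot\frac{\phi}{2} \right),\; 2\eta(\epsilon) + \arcsin\left( \frac{\epsilon}{1-\epsilon}\cot\left( 45^\circ - \frac{\phi}{4} \right) \right) \right\},$$ where $\eta(\delta) = \eta_1(\delta) = \arccos\left( 1 - \frac{\delta^2}{2\sqrt{1-\delta^2}} \right)$ if $d - k = 1$, and $\eta(\delta) = \eta_2(\delta) = \arccos\sqrt{1 - \frac{\delta^2}{\sqrt{1-\delta^2}}}$ if $d - k \geq 2$.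
   Context: A bounded smooth manifold without boundary in $\mathbb{R}^d$ means a compact smoothly embedded submanifold without boundary. For $p \in \Sigma$, $T_p\Sigma$ is the tangent $k$-flat at $p$ and $N_p\Sigma$ is the $(d-k)$-flat through $p$ orthogonal to $T_p\Sigma$. The medial axis $M$ of $\Sigma$ is the closure of the set of points of $\mathbb{R}^d$ having more than one nearest point on $\Sigma$; the local feature size is $\mathrm{lfs}(p) = \min_{m \in M}|pm|$. For a triangle $\tau$, $N_\tau$ is the $(d-2)$-flat of points of $\mathbb{R}^d$ equidistant to the three vertices of $\tau$ (orthogonal to its affine hull). For flats $F, G$ with $\dim F \le \dim G$, $\angle(F,G) = \angle(G,F) = \max_{\ell_F \subset F}\min_{\ell_G \subset G}\angle(\ell_F,\ell_G) \in [0^\circ,90^\circ]$, where $\ell_F,\ell_G$ range over lines and $\angle(\ell_F,\ell_G)$ is the nonobtuse angle between their directions. *)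

(* Defs.v *)
From HB Require Import structures.
From mathcomp Require Import all_boot all_order all_algebra.
From mathcomp Require Import all_classical all_reals all_analysis.

Set Implicit Arguments.
Unset Strict Implicit.
Unset Printing Implicit Defensive.
Import Order.TTheory GRing.Theory Num.Theory.
Import numFieldNormedType.Exports.
Local Open Scope classical_set_scope.
Local Open Scope ring_scope.

(* The library norm on 'rV[R]_d is the sup norm; it is used below only through
   the topology (continuity, derivatives, closure, compactness).  Lengths and
   angles are Euclidean. *)
Definition dotp (R : realType) (d : nat) (a b : 'rV[R]_d) : R :=
  \sum_(i < d) a ord0 i * b ord0 i.

Definition eucl_norm (R : realType) (d : nat) (a : 'rV[R]_d) : R :=
  Num.sqrt (dotp a a).

Definition eucl_dist (R : realType) (d : nat) (p q : 'rV[R]_d) : R :=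
  eucl_norm (p - q).

(* For U open: f has all iterated directional derivatives up to order n, at
   every point of U, and they are continuous on U.  In finite dimension this
   is the usual class C^n. *)
Fixpoint Ck_on (R : realType) (V W : normedModType R) (n : nat)
    (U : set V) (f : V -> W) : Prop :=
  (forall x, U x -> {for x, continuous f}) /\
  match n with
  | 0%N => True
  | m.+1 => forall w : V,
      (forall x, U x -> derivable f x w) /\
      Ck_on m U (fun x => 'D_w f x)
  end.

Definition smooth_on (R : realType) (V W : normedModType R)
    (U : set V) (f : V -> W) : Prop :=
  forall n : nat, Ck_on n U f.

(* Each point of S has a relatively open neighbourhood S `&` W that is
   diffeomorphic to an open subset U of R^k: phi : U -> S `&` W is smooth and
   its inverse is the restriction of a smooth map psi on W.  Since
   psi \o phi = id on U, phi is a homeomorphism onto S `&` W and an immersion;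
   charts are modelled on open subsets of R^k, so S has no boundary. *)
Definition smooth_submanifold (R : realType) (d k : nat)
    (S : set 'rV[R]_d) : Prop :=
  forall p, S p ->
    exists (U : set 'rV[R]_k) (W : set 'rV[R]_d)
           (phi : 'rV[R]_k -> 'rV[R]_d) (psi : 'rV[R]_d -> 'rV[R]_k),
      [/\ open U /\ open W,
          W p,
          smooth_on U phi /\ smooth_on W psi,
          phi @` U = S `&` W
        & forall y, U y -> psi (phi y) = y].

Definition tangent_vector (R : realType) (d : nat) (S : set 'rV[R]_d)
    (p w : 'rV[R]_d) : Prop :=
  exists (e : R) (g : R -> 'rV[R]_d),
    [/\ 0 < e,
        smooth_on (ball (0 : R) e) g,
        forall t, ball (0 : R) e t -> S (g t),
        g 0 = p
      & 'D_1 g 0 = w].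

Definition tangent_flat (R : realType) (d : nat) (S : set 'rV[R]_d)
    (p : 'rV[R]_d) : set 'rV[R]_d :=
  [set q | tangent_vector S p (q - p)].

Definition normal_flat (R : realType) (d : nat) (S : set 'rV[R]_d)
    (p : 'rV[R]_d) : set 'rV[R]_d :=
  [set q | forall t, tangent_flat S p t -> dotp (q - p) (t - p) = 0].

Definition nearest (R : realType) (d : nat) (S : set 'rV[R]_d)
    (x q : 'rV[R]_d) : Prop :=
  S q /\ forall q', S q' -> eucl_dist x q <= eucl_dist x q'.

Definition medial_axis (R : realType) (d : nat) (S : set 'rV[R]_d) :
    set 'rV[R]_d :=
  closure [set x | exists q q', [/\ q != q', nearest S x q & nearest S x q']].

(* The medial axis is closed, and nonempty when S is a nonempty compact
   submanifold without boundary with 0 < k < d, so the infimum is a minimum. *)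
Definition lfs (R : realType) (d : nat) (S : set 'rV[R]_d) (p : 'rV[R]_d) : R :=
  inf [set eucl_dist p m | m in medial_axis S].

(* The triangle abc is nondegenerate. *)
Definition is_triangle (R : realType) (d : nat) (a b c : 'rV[R]_d) : bool :=
  free [:: b - a; c - a].

Definition triangle (R : realType) (d : nat) (a b c : 'rV[R]_d) :
    set 'rV[R]_d :=
  [set x | exists l m n : R,
     [/\ 0 <= l, 0 <= m, 0 <= n, l + m + n = 1
       & x = l *: a + m *: b + n *: c]].

Definition triangle_normal (R : realType) (d : nat) (a b c : 'rV[R]_d) :
    set 'rV[R]_d :=
  [set q | eucl_dist q a = eucl_dist q b /\ eucl_dist q b = eucl_dist q c].

Definition is_flat (R : realType) (d : nat) (F : set 'rV[R]_d) (n : nat) :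
    Prop :=
  exists (p : 'rV[R]_d) (V : {vspace 'rV[R]_d}),
    \dim V = n /\ F = [set q | q - p \in V].

(* The dimension of a flat, which is unique; 0 if F is not a flat. *)
Definition flat_dim (R : realType) (d : nat) (F : set 'rV[R]_d) : nat :=
  xget 0%N [set n | is_flat F n].

(* A line {p + t a : t in R} is represented by a pair (p, a) with a != 0. *)
Definition lines_in (R : realType) (d : nat) (F : set 'rV[R]_d) :
    set ('rV[R]_d * 'rV[R]_d) :=
  [set l | l.2 != 0 /\ forall t : R, F (l.1 + t *: l.2)].

Definition line_angle (R : realType) (d : nat)
    (l m : 'rV[R]_d * 'rV[R]_d) : R :=
  acos (`|dotp l.2 m.2| / (eucl_norm l.2 * eucl_norm m.2)).

(* On flats of positive dimension the sup and the inf are attained. *)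
Definition maxmin_angle (R : realType) (d : nat) (F G : set 'rV[R]_d) : R :=
  sup [set inf [set line_angle l m | m in lines_in G] | l in lines_in F].

Definition flat_angle (R : realType) (d : nat) (F G : set 'rV[R]_d) : R :=
  if (flat_dim F <= flat_dim G)%N then maxmin_angle F G else maxmin_angle G F.

Definition cot (R : realType) (x : R) : R := cos x / sin x.

Definition eta1 (R : realType) (delta : R) : R :=
  acos (1 - delta ^+ 2 / (2 * Num.sqrt (1 - delta ^+ 2))).

Definition eta2 (R : realType) (delta : R) : R :=
  acos (Num.sqrt (1 - delta ^+ 2 / Num.sqrt (1 - delta ^+ 2))).

(* c is the codimension d - k. *)
Definition eta (R : realType) (c : nat) (delta : R) : R :=
  if c == 1%N then eta1 delta else eta2 delta.

(* Main.v *)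
From HB Require Import structures.
Require Import Defs.
From mathcomp Require Import all_boot all_order all_algebra.
From mathcomp Require Import all_classical all_reals all_analysis.
From mathcomp Require Import ring lra.
Import Order.TTheory GRing.Theory Num.Theory.
Import numFieldNormedType.Exports.
Local Open Scope classical_set_scope.
Local Open Scope ring_scope.
Set Implicit Arguments.
Unset Strict Implicit.
Unset Printing Implicit Defensive.

(* Put L = s / eps, so that no point of the medial axis is nearer to u than L.
   A ball that touches the surface at y can be blown up along a normal of y as
   long as its center stays within L of u, since the distance function has slope
   1 there.  Hence both sides of the surface at y have empty tangent balls of
   radius (L^2 - |yu|^2) / L, at least rho = L (1 - eps^2) when |yu| <= s.
   These balls force the vertices and the nearest point x~ of x to be within s of
   u, and x~ to be within s of some vertex.

   The empty balls at two infinitely near points p, q bound the angle between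
   their normal spaces by |pq| / rho.  Integrating along the projection of the
   segment pq to the surface, which is Lipschitz, gives a bound for all p, q at
   distance at most s, only slightly larger than |pq| / rho.  No topological
   argument is needed.  At a vertex a of tau with angle alpha, the chords of the
   empty balls bound the angle between N_a and N_tau by
   arcsin (s / rho * max (cot (alpha / 2), 1)).

   If the angle at the vertex near x~ is at least phi, go from x~ to this vertex;
   this gives the first term of the maximum.  Otherwise another vertex has angle
   at least 90 - phi/2 degrees, and going there through u, in two legs of length
   at most s, gives the second term.  Of the function eta only eta delta >= delta
   is used. *)

(* Sealed copies: unification would otherwise unfold these down to big sums. *)
HB.lock Definition dot (R : realType) (d : nat) (a b : 'rV[R]_d) : R := dotp a b.
HB.lock Definition enorm (R : realType) (d : nat) (a : 'rV[R]_d) : R := eucl_norm a.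
HB.lock Definition edist (R : realType) (d : nat) (p q : 'rV[R]_d) : R :=
  eucl_dist p q.
Arguments dot {R d} a b.
Arguments enorm {R d} a.
Arguments edist {R d} p q.

Section Euclid.
Variables (R : realType) (d : nat).
Implicit Types (a b c x y z : 'rV[R]_d) (t : R).

Lemma dotp_dot a b : dotp a b = dot a b.
Proof. by rewrite dot.unlock. Qed.

Lemma dotC a b : dot a b = dot b a.
Proof. by rewrite dot.unlock; apply: eq_bigr => i _; rewrite mulrC. Qed.

Lemma dotDl a b c : dot (a + b) c = dot a c + dot b c.
Proof. by rewrite dot.unlock /dotp -big_split; apply: eq_bigr => i _; rewrite mxE mulrDl. Qed.

Lemma dotZl t a c : dot (t *: a) c = t * dot a c.
Proof. by rewrite dot.unlock /dotp mulr_sumr; apply: eq_bigr => i _; rewrite mxE mulrA. Qed.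

Lemma dotDr a b c : dot c (a + b) = dot c a + dot c b.
Proof. by rewrite dotC dotDl !(dotC c). Qed.

Lemma dotZr t a c : dot c (t *: a) = t * dot c a.
Proof. by rewrite dotC dotZl !(dotC c). Qed.

Lemma dotNl a c : dot (- a) c = - dot a c.
Proof. by rewrite -scaleN1r dotZl mulN1r. Qed.

Lemma dotNr a c : dot c (- a) = - dot c a.
Proof. by rewrite dotC dotNl dotC. Qed.

Lemma dot0l a : dot 0 a = 0.
Proof. by rewrite -(scale0r 0) dotZl mul0r. Qed.

Lemma dot0r a : dot a 0 = 0.
Proof. by rewrite dotC dot0l. Qed.

Definition dotE := (dotDl, dotDr, dotZl, dotZr, dotNl, dotNr, dot0l, dot0r).

Lemma dot_ge0 a : 0 <= dot a a.
Proof. by rewrite dot.unlock; apply: sumr_ge0 => i _; rewrite -expr2 sqr_ge0. Qed.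

Lemma dot_eq0 a : dot a a = 0 -> a = 0.
Proof.
rewrite dot.unlock => /eqP; rewrite psumr_eq0 => [/allP h|i _]; last by rewrite -expr2 sqr_ge0.
apply/rowP => i; rewrite mxE; have := h i; rewrite mem_index_enum /= => /(_ isT).
by rewrite -expr2 sqrf_eq0 => /eqP.
Qed.

Lemma enormE a : enorm a = Num.sqrt (dot a a).
Proof. by rewrite enorm.unlock dot.unlock. Qed.

Lemma norm_ge0 a : 0 <= enorm a.
Proof. by rewrite enormE sqrtr_ge0. Qed.

Lemma sqr_norm a : enorm a ^+ 2 = dot a a.
Proof. by rewrite enormE sqr_sqrtr // dot_ge0. Qed.

Lemma norm_eq1 a : dot a a = 1 -> enorm a = 1.
Proof. by rewrite enormE => ->; rewrite sqrtr1. Qed.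

Lemma norm_eq0 a : enorm a = 0 -> a = 0.
Proof. by move=> h; apply: dot_eq0; rewrite -sqr_norm h expr0n. Qed.

Lemma norm0 : enorm (0 : 'rV[R]_d) = 0.
Proof. by rewrite enormE dot0l sqrtr0. Qed.

Lemma norm_gt0 a : a != 0 -> 0 < enorm a.
Proof.
move=> h; rewrite lt_def norm_ge0 andbT; apply: contra h => /eqP h.
by apply/eqP/norm_eq0.
Qed.

Lemma normZ t a : enorm (t *: a) = `|t| * enorm a.
Proof. by rewrite !enormE !dotE mulrA -expr2 sqrtrM ?sqr_ge0 // sqrtr_sqr. Qed.

Lemma normN a : enorm (- a) = enorm a.
Proof. by rewrite !enormE !dotE opprK. Qed.

Lemma cauchy_schwarz a b : dot a b <= enorm a * enorm b.
Proof.
have [->|a0] := eqVneq a 0; first by rewrite dot0l norm0 mul0r.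
have [->|b0] := eqVneq b 0; first by rewrite dot0r norm0 mulr0.
have ha := norm_gt0 a0; have hb := norm_gt0 b0.
have := dot_ge0 (enorm b *: a - enorm a *: b).
rewrite !dotE -!sqr_norm (dotC b a).
move: (enorm a) (enorm b) (dot a b) ha hb => A B D ha hb h.
have : 0 <= 2 * A * B * (A * B - D) by nra.
by rewrite pmulr_rge0 ?subr_ge0 // !mulr_gt0.
Qed.

Lemma cauchy_schwarzN a b : - (enorm a * enorm b) <= dot a b.
Proof. by have := cauchy_schwarz (- a) b; rewrite dotNl normN lerNl. Qed.

Lemma normD a b : enorm (a + b) <= enorm a + enorm b.
Proof.
rewrite -(@ler_pXn2r _ 2) ?nnegrE ?norm_ge0 ?addr_ge0 ?norm_ge0 //.
rewrite sqr_norm !dotE (dotC b a) sqrrD !sqr_norm.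
have := cauchy_schwarz a b; lra.
Qed.

Lemma norm_le a t : 0 <= t -> (enorm a <= t) = (dot a a <= t ^+ 2).
Proof. by move=> t0; rewrite -sqr_norm ler_pXn2r // nnegrE norm_ge0. Qed.

Lemma norm_lt a t : 0 <= t -> (enorm a < t) = (dot a a < t ^+ 2).
Proof. by move=> t0; rewrite -sqr_norm ltr_pXn2r // nnegrE norm_ge0. Qed.

Lemma edistE x y : edist x y = enorm (x - y).
Proof. by rewrite edist.unlock enorm.unlock. Qed.

Lemma distC x y : edist x y = edist y x.
Proof. by rewrite !edistE -opprB normN. Qed.

Lemma dist_ge0 x y : 0 <= edist x y.
Proof. by rewrite edistE norm_ge0. Qed.

Lemma distxx x : edist x x = 0.
Proof. by rewrite !edistE subrr norm0. Qed.

Lemma dist_eq0 x y : edist x y = 0 -> x = y.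
Proof. by rewrite edistE => /norm_eq0/eqP; rewrite subr_eq0 => /eqP. Qed.

Lemma dist_triangle y x z : edist x z <= edist x y + edist y z.
Proof. by rewrite !edistE; apply: le_trans (normD _ _); rewrite addrA subrK. Qed.

Lemma sqr_dist x y : edist x y ^+ 2 = dot (x - y) (x - y).
Proof. by rewrite edistE sqr_norm. Qed.

Lemma norm_mx_norm a : enorm a <= d%:R * `|a|.
Proof.
have h i : `|a ord0 i| <= `|a|.
  by rewrite [leRHS]/Num.norm /= mx_normrE; exact: (le_bigmax _ _ (ord0, i)).
rewrite norm_le ?mulr_ge0 // dot.unlock.
apply: (@le_trans _ _ (\sum_(i < d) `|a| ^+ 2)).
  apply: ler_sum => i _; rewrite -expr2 -(real_normK (num_real (a ord0 i))).
  by rewrite lerXn2r ?nnegrE ?h.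
rewrite sumr_const card_ord -[leLHS]mulr_natl exprMn ler_wpM2r ?sqr_ge0 //.
by rewrite expr2 -natrM ler_nat; case: (d) => // n; rewrite leq_pmulr.
Qed.

Lemma mx_norm_norm a : `|a| <= enorm a.
Proof.
rewrite [leLHS]/Num.norm /= mx_normrE; apply: bigmax_le; first exact: norm_ge0.
move=> [i j] _ /=; rewrite (ord1 i) -(@ler_pXn2r _ 2) ?nnegrE ?norm_ge0 //.
rewrite sqr_norm real_normK ?num_real // dot.unlock /dotp (bigD1 j) //= -expr2 lerDl.
by apply: sumr_ge0 => k _; rewrite -expr2 sqr_ge0.
Qed.

Lemma lipschitz_continuous (f : 'rV[R]_d -> R) (K : R) : 0 <= K ->
  (forall z w, f z <= f w + K * edist z w) -> continuous f.
Proof.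
move=> K0 hf z; apply/(@cvgrPdist_lt R R^o 'rV[R]_d (nbhs z)) => e e0.
have Kd : 0 < K * d%:R + 1 by rewrite ltr_wpDl // mulr_ge0.
apply/nbhs_ballP; exists (e / (K * d%:R + 1)) => /=; first by rewrite divr_gt0.
move=> y; rewrite -ball_normE /= => hy.
have h1 : K * edist z y < e.
  apply: (@le_lt_trans _ _ (K * (d%:R * `|z - y|))).
    by rewrite ler_wpM2l // edistE norm_mx_norm.
  rewrite ltr_pdivlMr // in hy; apply: le_lt_trans hy.
  by rewrite mulrA mulrC ler_wpM2l // lerDl.
have := hf z y; have := hf y z; rewrite (distC y z) ltr_norml.
by move: (K * _) (f z) (f y) h1 => *; apply/andP; split; lra.
Qed.

Lemma dist_continuous (w : 'rV[R]_d) : continuous (fun z => edist z w).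
Proof.
apply: (@lipschitz_continuous _ 1) => // z y.
by rewrite mul1r addrC; exact: dist_triangle.
Qed.

End Euclid.

Section NearestPoints.
Variables (R : realType) (d : nat).
Implicit Types (S : set 'rV[R]_d) (y z w q n : 'rV[R]_d) (t c e : R).

Definition closest S z q := S q /\ forall q', S q' -> edist z q <= edist z q'.

Lemma closestE S z q : closest S z q = nearest S z q.
Proof. by rewrite /closest edist.unlock. Qed.

Definition proj S z : 'rV[R]_d := xget z (closest S z).

Definition setdist S z : R := edist z (proj S z).

Lemma compact_max (A : set 'rV[R]_d) (f : 'rV[R]_d -> R) :
  compact A -> A !=set0 -> continuous f ->
  exists2 z, A z & forall q, A q -> f q <= f z.
Proof.
move=> cA A0 cf; have [|z] := EVT_max_rV A0 cA (f := f).
  exact: continuous_subspaceT.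
by rewrite inE => Az h; exists z => // q Aq; apply: h; rewrite inE.
Qed.

Lemma compact_min (A : set 'rV[R]_d) (f : 'rV[R]_d -> R) :
  compact A -> A !=set0 -> continuous f ->
  exists2 z, A z & forall q, A q -> f z <= f q.
Proof.
move=> cA A0 cf; have [|z] := EVT_min_rV A0 cA (f := f).
  exact: continuous_subspaceT.
by rewrite inE => Az h; exists z => // q Aq; apply: h; rewrite inE.
Qed.

Lemma closed_ball_compact z e : compact [set w | edist w z <= e].
Proof.
apply: bounded_closed_compact.
  exists (`|z| + e); split; first exact: num_real.
  move=> x hx w /= hw; apply: ltW; apply: le_lt_trans hx.
  rewrite -[w](subrK z) (le_trans (ler_normD _ _)) // addrC lerD2l.
  by apply: le_trans (mx_norm_norm _) _; rewrite -edistE.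
have := @closed_comp _ R (fun w => edist w z) [set x | x <= e].
by apply; [move=> w _; exact: dist_continuous|exact: closed_le].
Qed.

Section Compact.
Variable S : set 'rV[R]_d.
Hypotheses (cS : compact S) (S0 : S !=set0).

Lemma proj_nearest z : closest S z (proj S z).
Proof.
have [y Sy hy] := compact_min cS S0 (@dist_continuous R d z).
rewrite /proj; apply: xgetPex; exists y; split=> // q Sq.
by rewrite distC (distC z q) hy.
Qed.

Lemma setdist_le z q : S q -> setdist S z <= edist z q.
Proof. exact: (proj_nearest z).2. Qed.

Lemma nearest_setdist z y : closest S z y -> setdist S z = edist z y.
Proof.
move=> [Sy hy]; apply/le_anti; rewrite setdist_le //=.
by apply: hy; case: (proj_nearest z).
Qed.

Lemma setdist_lip z w : setdist S z <= setdist S w + edist z w.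
Proof.
apply: (le_trans (setdist_le z (proj_nearest w).1)).
by rewrite addrC; exact: dist_triangle.
Qed.

Lemma setdist_continuous : continuous (setdist S).
Proof.
by apply: (@lipschitz_continuous _ _ _ 1) => // z w; rewrite mul1r setdist_lip.
Qed.

Lemma nearest_near z y : (forall q, closest S z q -> q = y) ->
  forall e, 0 < e -> exists2 dl, 0 < dl &
    forall z' w, edist z' z < dl -> closest S z' w -> edist w y < e.
Proof.
move=> hy e e0.
have ny : closest S z y by rewrite -(hy _ (proj_nearest z)); exact: proj_nearest.
pose A := S `&` [set w | e <= edist w y].
have cA : compact A.
  apply: compact_closedI cS _.
  have := @closed_comp _ R (fun w => edist w y) [set x | e <= x].
  by apply; [move=> w _; exact: dist_continuous|exact: closed_ge].
have [A0|A0] := pselect (A !=set0); last first.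
  exists 1 => // z' w _ [Sw _]; rewrite ltNge; apply/negP => h.
  by apply: A0; exists w.
have [q [Sq hq] qmin] := compact_min cA A0 (@dist_continuous R d z).
have lt : edist z y < edist z q.
  rewrite lt_neqAle ny.2 // andbT; apply/eqP => E.
  have : q = y by apply: hy; split=> // q' /ny.2; rewrite -E.
  by move=> qy; move: hq; rewrite /= qy distxx; lra.
exists ((edist z q - edist z y) / 2); first lra.
move=> z' w hz [Sw hw]; rewrite ltNge; apply/negP => h.
have := qmin w (conj Sw h); have := hw _ ny.1.
have := dist_triangle z z' y; have := dist_triangle z' z w.
rewrite (distC z z') (distC q z) (distC w z); lra.
Qed.

Lemma setdist_slope z y c : (forall q, closest S z q -> q = y) -> z != y ->
  0 <= c < 1 -> exists2 dl, 0 < dl & forall t, 0 < t < dl ->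
   setdist S z + c * t < setdist S (z + t *: ((edist z y)^-1 *: (z - y))).
Proof.
move=> hy zy /andP[c0 c1]; set f := edist z y; set n := f^-1 *: _.
have ny : closest S z y by rewrite -(hy _ (proj_nearest z)); exact: proj_nearest.
have f0 : 0 < f by rewrite /f edistE norm_gt0 // subr_eq0.
have n1 : dot n n = 1.
  rewrite /n dotZl dotZr -sqr_norm -edistE -/f.
  by rewrite mulrA -expr2 -exprMn mulVf ?expr1n ?gt_eqF.
have nf : dot n (z - y) = f.
  rewrite /n dotZl -sqr_norm -edistE -/f expr2 mulrA mulVf ?mul1r //.
  by rewrite gt_eqF.
have [|dl dl0 hdl] := nearest_near hy (e := (1 - c) * f).
  by rewrite mulr_gt0 // subr_gt0.
clearbody n; exists dl => // t /andP[t0 tdl].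
have nn : enorm n = 1 by apply: norm_eq1.
have nw := proj_nearest (z + t *: n); set w := proj S _ in nw.
have := hdl _ _ _ nw; rewrite edistE addrAC subrr add0r normZ nn mulr1.
rewrite gtr0_norm // => /(_ tdl) hwy.
rewrite (nearest_setdist ny) (nearest_setdist nw) -/f.
have h1 : f <= edist z w by apply: ny.2; case: nw.
have h2 : c * f < dot n (z - w).
  have -> : z - w = (z - y) + (y - w) by rewrite addrA subrK.
  rewrite dotDr nf; have := cauchy_schwarzN n (y - w).
  by rewrite nn mul1r -opprB normN -edistE; lra.
clear hdl; have h3 : edist (z + t *: n) w ^+ 2
    = edist z w ^+ 2 + 2 * t * dot n (z - w) + t ^+ 2.
  rewrite !sqr_dist addrAC !dotE n1 !(dotC _ n); ring.
have := dist_ge0 (z + t *: n) w; have := dist_ge0 z w.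
move: (edist (z + t *: n) w) (edist z w) (dot n (z - w)) h1 h2 h3.
move=> X Y D h1 h2 h3 Y0 X0.
rewrite -(@ltr_pXn2r _ 2) ?nnegrE ?addr_ge0 ?mulr_ge0 ?(ltW f0) ?(ltW t0) // h3.
have : c ^+ 2 * t ^+ 2 < t ^+ 2.
  by rewrite gtr_pMl ?exprn_gt0 // expr_lt1.
nra.
Qed.

End Compact.
End NearestPoints.

Section UniqueNearest.
Variables (R : realType) (d : nat) (S : set 'rV[R]_d) (u : 'rV[R]_d) (L : R).
Hypotheses (cS : compact S) (Su : S u).
Hypothesis uniq_nearest : forall z q q',
  edist z u < L -> closest S z q -> closest S z q' -> q = q'.
Implicit Types (y z w q n : 'rV[R]_d) (t c e : R).

Let S0 : S !=set0. Proof. by exists u. Qed.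

(* Otherwise the maximizer of setdist z - c |z - z0| over the ball would be
   interior for some c < 1, against setdist_slope. *)
Lemma setdist_ascent z0 e : 0 < e -> 0 < setdist S z0 ->
  (forall z, edist z z0 <= e -> edist z u < L) ->
  exists2 z, edist z z0 <= e & setdist S z0 + e <= setdist S z.
Proof.
move=> e0 f0 inL.
have B0 : [set w | edist w z0 <= e] !=set0.
  by exists z0 => /=; rewrite (distxx z0) ltW.
have cB := @closed_ball_compact R d z0 e.
have [z /= zB zmax] := compact_max cB B0 (setdist_continuous cS S0).
exists z; first exact: zB.
suff key c : 0 <= c < 1 -> setdist S z0 + c * e <= setdist S z.
  rewrite leNgt; apply/negP => lt.
  have h0 : setdist S z0 <= setdist S z by apply: zmax; rewrite /= distxx ltW.
  move: (setdist S z0) (setdist S z) f0 h0 lt key; clear -e0 => X Y X0 h0 lt key.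
  have c0 : 0 < (X + e - Y) / (2 * e) by apply: divr_gt0; lra.
  have c1 : (X + e - Y) / (2 * e) <= 1 by rewrite ler_pdivrMr; lra.
  have := key (1 - (X + e - Y) / (2 * e)).
  have -> : (1 - (X + e - Y) / (2 * e)) * e = (e - X + Y) / 2.
    by field; rewrite gt_eqF.
  have -> : (0 <= 1 - (X + e - Y) / (2 * e) < 1) by apply/andP; split; lra.
  by move=> /(_ isT); lra.
move=> /andP[c0 c1].
have [|z1 /= zB1 z1max] := compact_max cB B0
    (f := fun w => setdist S w - c * edist w z0).
  apply: (@lipschitz_continuous _ _ _ 2) => // y w.
  have := setdist_lip cS S0 y w; have := ler_wpM2l c0 (dist_triangle y w z0).
  have : c * edist y w <= edist y w by rewrite ler_piMl ?dist_ge0 // ltW.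
  rewrite mulrDr (distC w y); move: (setdist S y) (setdist S w) (edist y w).
  by move: (c * _) (c * _) => *; lra.
have [lt|ge] := ltP (edist z1 z0) e; last first.
  have E : edist z1 z0 = e by apply/le_anti; rewrite zB1 ge.
  have := z1max z0; rewrite (distxx z0) E mulr0 subr0 => /(_ (ltW e0)) h1.
  by have := zmax z1 zB1; move: h1; move: (setdist S z1) (setdist S z0) (setdist S z) => *; lra.
have f1 : 0 < setdist S z1.
  have := z1max z0; rewrite (distxx z0) mulr0 subr0 => /(_ (ltW e0)).
  have := mulr_ge0 c0 (dist_ge0 z1 z0).
  by move: f0; move: (c * _) (setdist S z1) (setdist S z0) => *; lra.
have n1 := proj_nearest cS S0 z1; move: (proj S z1) n1 => y n1.
have y0 : 0 < edist z1 y by rewrite -(nearest_setdist cS S0 n1).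
have [|||dl dl0 hdl] := @setdist_slope R d S cS S0 z1 y c.
- move=> q hq; apply: uniq_nearest hq n1; apply: inL; exact: zB1.
- by apply/eqP => E; move: y0; rewrite E distxx ltxx.
- by rewrite c0 c1.
pose t := Num.min (dl / 2) (e - edist z1 z0).
have t0 : 0 < t by rewrite lt_min subr_gt0 lt divr_gt0.
have te : t <= e - edist z1 z0 by rewrite ge_min lexx orbT.
have tdl : t < dl by rewrite gt_min; apply/orP; left; lra.
have := hdl t; rewrite t0 tdl => /(_ isT).
set n := _ *: (z1 - y) => h1.
have n_1 : enorm n = 1.
  rewrite /n normZ -edistE ger0_norm ?invr_ge0 ?dist_ge0 // mulVf //.
  exact: lt0r_neq0.
have h2 : edist (z1 + t *: n) z0 <= edist z1 z0 + t.
  rewrite edistE addrAC (le_trans (normD _ _)) // normZ n_1 mulr1.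
  by rewrite edistE gtr0_norm.
have h3 : edist (z1 + t *: n) z0 <= e.
  by move: h2 te; move: (edist z1 z0) => *; lra.
have h4 : c * edist (z1 + t *: n) z0 <= c * edist z1 z0 + c * t.
  by rewrite -mulrDr ler_wpM2l.
have := z1max _ h3; move: h1 h4; clear.
move: (c * t) (c * _) (c * _) (setdist S z1) (setdist S _) => *; lra.
Qed.

Lemma nearest_ray_step y n t e : enorm n = 1 -> 0 < t -> 0 < e ->
  (forall z, edist z (y + t *: n) <= e -> edist z u < L) ->
  closest S (y + t *: n) y -> closest S (y + (t + e) *: n) y.
Proof.
move=> n1 t0 e0 inL ny.
have ray s : 0 <= s -> edist (y + s *: n) y = s.
  by move=> s0; rewrite edistE addrAC subrr add0r normZ n1 mulr1 ger0_norm.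
have ft : setdist S (y + t *: n) = t.
  by rewrite (nearest_setdist cS S0 ny) ray // ltW.
have [||z hz] := @setdist_ascent (y + t *: n) e e0.
- by rewrite ft.
- exact: inL.
rewrite ft => fz.
have zy : z = y + (t + e) *: n.
  have hy : t + e <= edist z y := le_trans fz (setdist_le cS S0 z ny.1).
  pose h := z - (y + t *: n).
  have Eh : z - y = h + t *: n by rewrite /h opprD addrA subrK.
  have hh : dot h h <= e ^+ 2 by rewrite -norm_le -?edistE // ltW.
  clearbody h.
  have hy2 : (t + e) ^+ 2 <= dot h h + 2 * t * dot n h + t ^+ 2.
    have -> : dot h h + 2 * t * dot n h + t ^+ 2 = edist z y ^+ 2.
      rewrite sqr_dist Eh !dotE -(sqr_norm n) n1 (dotC h n); ring.
    by rewrite lerXn2r ?nnegrE ?dist_ge0 // addr_ge0 // ltW.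
  have nh : e <= dot n h.
    rewrite -(@ler_pM2l _ (2 * t)) ?mulr_gt0 //.
    by move: hh hy2; move: (dot n h) (dot h h) => *; lra.
  have : h - e *: n = 0.
    apply: dot_eq0; apply/le_anti; rewrite dot_ge0 andbT.
    rewrite !dotE -(sqr_norm n) n1 (dotC h n).
    move: hh nh; move: (dot n h) (dot h h) => X Y hh nh; nra.
  move/eqP; rewrite subr_eq0 => /eqP hE.
  by rewrite -[z](subrK y) Eh hE -scalerDl addrC (addrC e).
split=> [|q Sq]; first by case: ny.
rewrite ray; last by rewrite addr_ge0 ?(ltW t0) ?(ltW e0).
by rewrite -zy; apply: le_trans fz (setdist_le cS S0 z Sq).
Qed.

Lemma nearest_ray_extend y n t r : enorm n = 1 -> 0 < t -> t <= r ->
  edist (y + t *: n) u < L -> edist (y + r *: n) u < L ->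
  closest S (y + t *: n) y -> closest S (y + r *: n) y.
Proof.
move=> n1 t0; rewrite le_eqVlt => /predU1P[->//|tr] ht hr ny.
pose sg := L - Num.max (edist (y + t *: n) u) (edist (y + r *: n) u).
have sg0 : 0 < sg by rewrite subr_gt0 gt_max ht hr.
have conv s : 0 <= s <= 1 -> edist (y + (t + s * (r - t)) *: n) u <= L - sg.
  move=> /andP[s0 s1]; rewrite /sg subKr edistE.
  have -> : y + (t + s * (r - t)) *: n - u
      = (1 - s) *: (y + t *: n - u) + s *: (y + r *: n - u).
    by apply/rowP => i; rewrite !mxE; ring.
  apply: (le_trans (normD _ _)); rewrite !normZ !ger0_norm ?subr_ge0 //.
  rewrite -!edistE.
  set M := Num.max _ _.
  have : edist (y + t *: n) u <= M by rewrite le_max lexx.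
  have : edist (y + r *: n) u <= M by rewrite le_max lexx orbT.
  move: (edist _ _) (edist _ _) M => X Y M h1 h2; nra.
have [N hN] : exists N : nat, (r - t) / (sg / 2) < N.+1%:R.
  exists (Num.truncn ((r - t) / (sg / 2))); exact: truncnS_gt.
pose e := (r - t) / N.+1%:R.
have e0 : 0 < e by rewrite divr_gt0 // subr_gt0.
have esg : e < sg.
  rewrite /e ltr_pdivrMr ?ltr0Sn //; rewrite ltr_pdivrMr in hN; last lra.
  apply: lt_trans hN _; rewrite mulrC ltr_pM2r ?ltr0Sn //; lra.
suff key i : (i <= N.+1)%N -> closest S (y + (t + i%:R * e) *: n) y.
  have := key _ (leqnn _); rewrite /e mulrC divfK ?pnatr_eq0 //.
  by rewrite (addrC t) subrK.
elim: i => [|i IH] lei; first by rewrite mul0r addr0.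
rewrite -natr1 mulrDl mul1r addrA; apply: nearest_ray_step => //.
- by rewrite ltr_wpDr // mulr_ge0 // ltW.
- move=> z hz; have := dist_triangle (y + (t + i%:R * e) *: n) z u.
  have -> : i%:R * e = (i%:R / N.+1%:R) * (r - t) by rewrite /e; ring.
  have := conv (i%:R / N.+1%:R); rewrite divr_ge0 //=.
  rewrite ler_pdivrMr ?ltr0Sn // mul1r ler_nat (ltnW lei) => /(_ isT).
  move: hz; rewrite /e mulrA mulrAC.
  move: (edist _ u) (edist z _) (edist z u) esg; rewrite /e; clear.
  by move: (_ / _) => ? ? ? ? ?; lra.
- exact/IH/ltnW.
Qed.

End UniqueNearest.

Section TangentBall.
Variables (R : realType) (d : nat) (S : set 'rV[R]_d).
Implicit Types (y z w q n : 'rV[R]_d) (t c e : R).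

(* Proximal normals: the inequality says that the ball of radius t |n| centered
   at y + t n has no point of S in its interior. *)
Definition pnormal y n :=
  exists2 t, 0 < t & forall z, S z -> 2 * t * dot (z - y) n <= dot (z - y) (z - y).

Lemma closest_rayP y n t : S y -> 0 <= t ->
  closest S (y + t *: n) y <->
  forall z, S z -> 2 * t * dot (z - y) n <= dot (z - y) (z - y).
Proof.
move=> Sy t0.
have key z : (edist (y + t *: n) y <= edist (y + t *: n) z) =
    (2 * t * dot (z - y) n <= dot (z - y) (z - y)).
  rewrite -(@ler_pXn2r _ 2) ?nnegrE ?dist_ge0 // !sqr_dist addrAC subrr add0r.
  have -> : y + t *: n - z = t *: n - (z - y) by rewrite opprB addrA (addrC (t *: n)).
  move: (z - y) => w; rewrite !dotE (dotC w n).
  by apply/idP/idP; move: (dot n n) (dot w w) (dot n w) => *; lra.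
split=> [[_ h] z Sz|h]; first by rewrite -key h.
by split=> // z Sz; rewrite key h.
Qed.

Lemma pnormal_scale y n c : 0 < c -> pnormal y n -> pnormal y (c *: n).
Proof.
move=> c0 [t t0 h]; exists (t / c); first by rewrite divr_gt0.
by move=> z Sz; rewrite dotZr !mulrA mulrVK ?unitfE ?gt_eqF // h.
Qed.

Lemma closest_pnormal x y : closest S x y -> pnormal y (x - y).
Proof.
move=> h; exists 1; first by [].
apply/closest_rayP => //; first by case: h.
by rewrite scale1r addrC subrK.
Qed.

Variables (u : 'rV[R]_d) (L : R).
Hypotheses (cS : compact S) (Su : S u).
Hypothesis uniq_nearest : forall z q q',
  edist z u < L -> closest S z q -> closest S z q' -> q = q'.
Hypothesis pnormalN : forall y n, S y -> pnormal y n -> pnormal y (- n).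

Lemma pnormal_ray y n r : S y -> enorm n = 1 -> pnormal y n ->
  edist y u < L -> 0 < r -> edist (y + r *: n) u < L -> closest S (y + r *: n) y.
Proof.
move=> Sy n1 [t t0 ht] yu r0 hr.
pose t1 := Num.min (Num.min t r) ((L - edist y u) / 2).
have t10 : 0 < t1 by rewrite !lt_min t0 r0 divr_gt0 // subr_gt0.
have t1r : t1 <= r by rewrite !ge_min lexx orbT.
have t1t : t1 <= t by rewrite !ge_min lexx.
have t1L : t1 <= (L - edist y u) / 2 by rewrite ge_min lexx orbT.
clearbody t1.
apply: (nearest_ray_extend cS Su uniq_nearest n1 t10 t1r _ hr).
  rewrite edistE addrAC; apply: le_lt_trans (normD _ _) _.
  rewrite normZ n1 mulr1 gtr0_norm // -edistE.
  by move: t1L yu; move: (edist y u) => *; lra.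
apply/closest_rayP => //; first exact: ltW.
move=> z Sz; have := ht _ Sz; have := dot_ge0 (z - y).
move: (dot (z - y) n) (dot (z - y) (z - y)) => X Z Z0 h.
have [X0|X0] := leP X 0.
  by apply: le_trans Z0; rewrite mulr_ge0_le0 // mulr_ge0 // ltW.
by apply: le_trans h; rewrite ler_pM2r // ler_pM2l.
Qed.

(* If y + t n left the ball of radius L about u for some t < r, then y - L n
   would be inside it and have y as a nearest point, although u is nearer. *)
Lemma unit_tangent_ball y n r : S y -> enorm n = 1 -> pnormal y n ->
  edist y u < L -> L * r = L ^+ 2 - edist y u ^+ 2 ->
  forall z, S z -> 2 * r * dot (z - y) n <= dot (z - y) (z - y).
Proof.
move=> Sy n1 pn yu hr z Sz.
have L0 : 0 < L := le_lt_trans (dist_ge0 y u) yu.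
have D0 := dist_ge0 y u.
have r0 : 0 < r by rewrite -(pmulr_rgt0 _ L0) hr subr_gt0 ltrXn2r // ?nnegrE ltW.
have rL : r <= L by rewrite -(ler_pM2l L0) hr -expr2 gerBl sqr_ge0.
have key t : 0 < t < r -> 2 * t * dot (z - y) n <= dot (z - y) (z - y).
  move=> /andP[t0 tr].
  have [lt|ge] := ltP (edist (y + t *: n) u) L.
    exact: (closest_rayP n Sy (ltW t0)).1 (pnormal_ray Sy n1 pn yu t0 lt) z Sz.
  exfalso.
  have ray : edist (y + L *: (- n)) u < L.
    rewrite edistE norm_lt ?(ltW L0) //.
    have : L ^+ 2 <= dot (y + t *: n - u) (y + t *: n - u).
      by rewrite -sqr_dist lerXn2r ?nnegrE ?dist_ge0 // ltW.
    have : edist y u ^+ 2 = dot (y - u) (y - u) by exact: sqr_dist.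
    rewrite addrAC (addrAC y (L *: - n)); move: (y - u) (edist y u) D0 yu hr => w D D0 yu hr hD.
    rewrite !dotE -(sqr_norm n) n1 -hD (dotC n w); move: (dot w n) => b.
    move=> h.
    have h1 : L * r - t ^+ 2 <= 2 * t * b by rewrite hr; lra.
    have h2 : D ^+ 2 = L ^+ 2 - L * r by rewrite hr; ring.
    have h3 : t * (L * (L - r)) < t * (2 * b * L).
      have : L * (L * r - t ^+ 2) <= L * (2 * t * b) by rewrite ler_pM2l.
      have : 0 < L * (r - t) by rewrite mulr_gt0 // subr_gt0.
      have : 0 <= L * t * (r - t) by rewrite !mulr_ge0 // ?subr_ge0 ltW.
      have : 0 <= (L - t) * (L * (r - t)) .
        by rewrite !mulr_ge0 // ?subr_ge0 ?(ltW tr) ?(ltW L0) // (le_trans (ltW tr)).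
      have : 0 < (L - t) * (L * (r - t)).
        by rewrite !mulr_gt0 // ?subr_gt0 // (lt_le_trans tr).
      lra.
    by rewrite ltr_pM2l // in h3; lra.
  have n1' : enorm (- n) = 1 by rewrite normN.
  have := (pnormal_ray Sy n1' (pnormalN Sy pn) yu L0 ray).2 u Su.
  rewrite edistE addrAC subrr add0r normZ n1' mulr1 gtr0_norm // leNgt.
  by rewrite ray.
have := dot_ge0 (z - y); move: (dot (z - y) n) (dot (z - y) (z - y)) key => X Z key Z0.
rewrite leNgt; apply/negP => lt.
have X0 : 0 < X.
  have r2 : 0 < 2 * r by rewrite mulr_gt0.
  by have := le_lt_trans Z0 lt; rewrite pmulr_rgt0.
have hZ : Z / (2 * X) < r by rewrite ltr_pdivrMr ?mulr_gt0 // mulrCA mulrA.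
have Z1 : 0 <= Z / (2 * X) by rewrite divr_ge0 // mulr_ge0 // ltW.
have := key ((Z / (2 * X) + r) / 2).
have -> : 0 < (Z / (2 * X) + r) / 2 < r by apply/andP; split; lra.
have -> : 2 * ((Z / (2 * X) + r) / 2) * X = Z / 2 + r * X by field; rewrite gt_eqF.
by move=> /(_ isT); lra.
Qed.

Lemma tangent_ball y n : S y -> pnormal y n -> edist y u < L ->
  forall z, S z -> 2 * (L ^+ 2 - edist y u ^+ 2) * dot (z - y) n
    <= L * enorm n * dot (z - y) (z - y).
Proof.
move=> Sy pn yu z Sz.
have L0 : 0 < L := le_lt_trans (dist_ge0 y u) yu.
have [->|n0] := eqVneq n 0; first by rewrite dot0r norm0 !mulr0 mul0r.
have N0 := norm_gt0 n0.
have := @unit_tangent_ball y ((enorm n)^-1 *: n) ((L ^+ 2 - edist y u ^+ 2) / L) Sy.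
rewrite normZ gtr0_norm ?invr_gt0 // mulVf ?gt_eqF // => /(_ erefl).
have iN : 0 < (enorm n)^-1 by rewrite invr_gt0.
move=> /(_ (pnormal_scale iN pn) yu).
have -> : L * ((L ^+ 2 - edist y u ^+ 2) / L) = L ^+ 2 - edist y u ^+ 2.
  by field; rewrite gt_eqF.
move=> /(_ erefl z Sz); rewrite dotZr.
move: (dot (z - y) n) (dot (z - y) (z - y)) => X Z.
rewrite -(@ler_pM2l _ (L * enorm n)) ?mulr_gt0 //.
by congr (_ <= _); field; rewrite !gt_eqF.
Qed.

Lemma nearest_hull (a b c x y : 'rV[R]_d) (l m k s : R) : S a -> S b -> S c ->
  edist a u <= s -> edist b u <= s -> edist c u <= s ->
  0 < s -> 3 * s <= L -> 0 <= l -> 0 <= m -> 0 <= k -> l + m + k = 1 ->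
  x = l *: a + m *: b + k *: c -> closest S x y ->
  let Q := l * edist a y ^+ 2 + m * edist b y ^+ 2 + k * edist c y ^+ 2 in
  [/\ edist y u <= s, Q <= s ^+ 2 & 2 * (L ^+ 2 - s ^+ 2) * edist x y <= L * Q].
Proof.
move=> Sa Sb Sc au bu cu s0 sL l0 m0 k0 lmk xE xy; move=> spread.
have L0 : 0 < L by lra.
have kE : k = 1 - l - m by lra.
have baryx w : x - w = l *: (a - w) + m *: (b - w) + k *: (c - w).
  by rewrite xE kE; apply/rowP => i; rewrite !mxE; ring.
have xs : edist x u <= s.
  rewrite edistE baryx; apply: (le_trans (normD _ _)).
  apply: (@le_trans _ _ (l * s + m * s + k * s)); last by rewrite -!mulrDl lmk mul1r.
  apply: lerD; last by rewrite normZ ger0_norm // ler_wpM2l // -edistE.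
  apply: (le_trans (normD _ _)).
  by apply: lerD; rewrite normZ ger0_norm // ler_wpM2l // -edistE.
have [Sy hy] := xy.
have hs : edist x y <= s := le_trans (hy u Su) xs.
have D2 : edist y u <= 2 * s.
  have := dist_triangle x y u; rewrite (distC y x).
  by move: hs xs; move: (edist _ _) (edist _ _) (edist _ _) => *; lra.
have yL : edist y u < L by move: D2; move: (edist y u) => *; lra.
have tb := tangent_ball Sy (closest_pnormal xy) yL.
have Q0 : 0 <= spread.
  by rewrite /spread; apply: addr_ge0; [apply: addr_ge0|]; apply: mulr_ge0 => //; exact: sqr_ge0.
have hu := tb u Su.
have E1 : l * edist a u ^+ 2 + m * edist b u ^+ 2 + k * edist c u ^+ 2
    = spread - 2 * dot (u - y) (x - y) + edist y u ^+ 2.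
  rewrite /spread !sqr_dist (baryx y).
  have e w : w - u = (w - y) - (u - y) by rewrite opprB addrA subrK.
  rewrite (e a) (e b) (e c) -(opprB u y).
  move: (a - y) (b - y) (c - y) (u - y) => A B C U.
  rewrite !dotE !(dotC _ U) kE; ring.
have E2 : l * edist a u ^+ 2 + m * edist b u ^+ 2 + k * edist c u ^+ 2 <= s ^+ 2.
  have -> : s ^+ 2 = l * s ^+ 2 + m * s ^+ 2 + k * s ^+ 2 by rewrite kE; ring.
  by rewrite !lerD // ler_wpM2l // lerXn2r ?nnegrE ?dist_ge0 // ltW.
have E3 : 2 * (L ^+ 2 - edist y u ^+ 2) * edist x y ^+ 2 <= L * edist x y * spread.
  have := ler_wpM2l l0 (tb a Sa); have := ler_wpM2l m0 (tb b Sb).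
  have := ler_wpM2l k0 (tb c Sc); rewrite -!sqr_dist -!edistE /spread.
  have -> : edist x y ^+ 2 = l * dot (a - y) (x - y) + m * dot (b - y) (x - y)
     + k * dot (c - y) (x - y).
    rewrite sqr_dist {1}(baryx y); move: (x - y) (a - y) (b - y) (c - y) => *.
    by rewrite !dotE.
  move: (edist x y) (edist y u) (dot (a - y) _) (dot (b - y) _) (dot (c - y) _).
  move=> *; lra.
move: E1 {tb} E2 E3 hu; rewrite -!sqr_dist -edistE (distC u y) => -> E2 E3 hu.
have := dist_ge0 x y; have := dist_ge0 y u; clearbody spread.
move: spread (edist y u) (edist x y) (dot (u - y) (x - y)) D2 hs Q0 E2 E3 hu.
move=> Q D h X D2 hs Q0 E2 E3 hu D0 h0.
have G0 : 5 * L ^+ 2 <= 9 * (L ^+ 2 - D ^+ 2) by nra.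
have L2 : 0 < L ^+ 2 by rewrite exprn_gt0.
set G := L ^+ 2 - D ^+ 2 in G0 E3 hu *.
have Gp : 0 < G by lra.
have E4 : 2 * G * h <= L * Q.
  have [->|hn] := eqVneq h 0; first by rewrite mulr0 mulr_ge0 // ltW.
  have hp : 0 < h by rewrite lt_def hn.
  by rewrite -(ler_pM2l hp) ; move: E3; rewrite expr2; lra.
have E5 : G * (Q + D ^+ 2 - s ^+ 2) <= L * h * D ^+ 2.
  have : G * (Q + D ^+ 2 - s ^+ 2) <= G * (2 * X) by rewrite ler_pM2l //; lra.
  lra.
have Ds : D ^+ 2 <= s ^+ 2.
  rewrite leNgt; apply/negP => lt.
  have h1 : L * (G * (Q + D ^+ 2 - s ^+ 2)) <= L * (L * h * D ^+ 2) by rewrite ler_pM2l.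
  have h2 : G * (2 * G * h) <= G * (L * Q) by rewrite ler_pM2l.
  have h3 : 0 < L * (G * (D ^+ 2 - s ^+ 2)) by rewrite !mulr_gt0 // subr_gt0.
  have h4 : L ^+ 2 * D ^+ 2 <= 2 * G ^+ 2.
    have : D ^+ 2 * 9 <= 4 * L ^+ 2 by rewrite /G in G0; lra.
    have : 0 <= (9 * G - 5 * L ^+ 2) * (9 * G + 5 * L ^+ 2).
      by rewrite mulr_ge0 //; lra.
    have : 0 <= L ^+ 2 * (L ^+ 2 * 4 - 9 * D ^+ 2).
      by rewrite mulr_ge0 ?sqr_ge0 // subr_ge0; rewrite /G in G0; lra.
    have : 0 < L ^+ 2 * L ^+ 2 by rewrite mulr_gt0.
    lra.
  have h5 := ler_wpM2l h0 h4.
  lra.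
have E6 : Q <= s ^+ 2.
  rewrite -subr_le0 -(pmulr_rle0 _ Gp).
  have : D ^+ 2 * (L * h - G) <= 0.
    rewrite mulr_ge0_le0 ?sqr_ge0 // subr_le0.
    have : L * (3 * h) <= L * L by rewrite ler_pM2l //; lra.
    rewrite -expr2; lra.
  lra.
split=> //.
  by rewrite -(@ler_pXn2r _ 2) ?nnegrE // ltW.
apply: le_trans E4; rewrite ler_wpM2r // ler_pM2l //.
by rewrite /G lerD2l lerN2.
Qed.

End TangentBall.

Section Calculus.
Variable R : realType.

Lemma diff_quotient_line (V W : normedModType R) (f : V -> W) (p e : V) (t v : R) :
  (fun h : R => h^-1 *: ((fun s : R => f (p + s *: e)) (h *: v + t) - f (p + t *: e)))
  = (fun h : R => h^-1 *: (f (h *: (v *: e) + (p + t *: e)) - f (p + t *: e))).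
Proof.
apply/funext => h /=; congr (_ *: (f _ - _)).
by rewrite scalerDl -scalerA addrCA.
Qed.

Lemma derivable_line (V W : normedModType R) (f : V -> W) (p e : V) (t v : R) :
  derivable (fun s : R => f (p + s *: e)) t v = derivable f (p + t *: e) (v *: e).
Proof. by rewrite /derivable diff_quotient_line. Qed.

Lemma derive_line (V W : normedModType R) (f : V -> W) (p e : V) (t v : R) :
  'D_v (fun s : R => f (p + s *: e)) t = 'D_(v *: e) f (p + t *: e).
Proof. by rewrite /derive diff_quotient_line. Qed.

Lemma Ck_on_line (V W : normedModType R) n (U : set V) (f : V -> W) p e (r : R) :
  Ck_on n U f -> (forall t, ball (0 : R) r t -> U (p + t *: e)) ->
  Ck_on n (ball (0 : R) r) (fun t : R => f (p + t *: e)).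
Proof.
have cont g : (forall x, U x -> {for x, continuous g}) ->
    (forall t, ball (0 : R) r t -> U (p + t *: e)) ->
    forall t, ball (0 : R) r t -> {for t, continuous (fun s : R => (g : V -> W) (p + s *: e))}.
  move=> cg hU t rt; apply: (@continuous_comp _ _ _ (fun s : R => p + s *: e) g).
    apply: cvgD; first exact: cvg_cst.
    exact: scalel_continuous.
  exact/cg/hU.
elim: n f => [|n IH] f [cf hf] hU; split; try exact: cont.
  by [].
move=> v; have [df Cf] := hf (v *: e); split.
  by move=> t rt; rewrite derivable_line; exact/df/hU.
have -> : (fun x => 'D_v (fun s : R => f (p + s *: e)) x) =
   (fun t => 'D_(v *: e) f (p + t *: e)) by apply/funext => t; exact: derive_line.
exact: (IH (fun x => 'D_(v *: e) f x) Cf hU).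
Qed.

Lemma line_mvt (V : normedModType R) (F : V -> R) (p e : V) (l M T : R) :
  (forall t, `|t| <= `|T| ->
     derivable F (p + t *: e) e /\ `|'D_e F (p + t *: e) - l| <= M) ->
  `|F (p + T *: e) - F p - T * l| <= M * `|T|.
Proof.
move=> h; pose g t := F (p + t *: e).
have dg (t : R) : `|t| <= `|T| -> is_derive t (1 : R) g ('D_e F (p + t *: e)).
  move=> /h[dF _]; split.
    by rewrite /g derivable_line scale1r.
  by rewrite /g derive_line scale1r.
have -> : F (p + T *: e) - F p = g T - g 0 by rewrite /g scale0r addr0.
have cg (a b : R) : (forall t, t \in `[a, b] -> `|t| <= `|T|) -> {within `[a, b], continuous g}.
  move=> ab; apply: derivable_within_continuous => t /ab/dg[].
  by [].
have [T0|T0|->] := ltgtP T 0; last first.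
- by rewrite subrr mul0r subr0 normr0 mulr0.
- have ab t : t \in `[0, T] -> `|t| <= `|T|.
    by rewrite in_itv /= => /andP[? ?]; rewrite (ger0_norm (ltW T0)) ger0_norm.
  have [t tI|t tI E] := @MVT R g (fun t => 'D_e F (p + t *: e)) 0 T T0 _ (cg _ _ ab).
    by apply: dg; apply: ab; apply: subset_itv_oo_cc.
  have tT : `|t| <= `|T| by apply: ab; apply: subset_itv_oo_cc.
  have -> : g T - g 0 - T * l = T * ('D_e F (p + t *: e) - l) by lra.
  by rewrite normrM mulrC ler_wpM2r //; case: (h t tT).
- have ab t : t \in `[T, 0] -> `|t| <= `|T|.
    by rewrite in_itv /= => /andP[? ?]; rewrite (ler0_norm (ltW T0)) ler0_norm // lerN2.
  have [t tI|t tI E] := @MVT R g (fun t => 'D_e F (p + t *: e)) T 0 T0 _ (cg _ _ ab).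
    by apply: dg; apply: ab; apply: subset_itv_oo_cc.
  have tT : `|t| <= `|T| by apply: ab; apply: subset_itv_oo_cc.
  have -> : g T - g 0 - T * l = T * ('D_e F (p + t *: e) - l) by lra.
  by rewrite normrM mulrC ler_wpM2r //; case: (h t tT).
Qed.

End Calculus.

Section Box.
Variables (R : realType) (k : nat).
Implicit Types (h x a : 'rV[R]_k) (F : 'rV[R]_k -> R).

Notation e_ j := (delta_mx 0 j : 'rV[R]_k).

Lemma coord_le_norm x j : `|x 0 j| <= `|x|.
Proof.
by rewrite [leRHS]/Num.norm /= mx_normrE; exact: (le_bigmax _ _ (0, j)).
Qed.

Lemma norm_le_coord (m : nat) (x : 'rV[R]_m) (r : R) : 0 <= r ->
  (forall j, `|x 0 j| <= r) -> `|x| <= r.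
Proof.
move=> r0 hx; rewrite [leLHS]/Num.norm /= mx_normrE; apply: bigmax_le => //.
by move=> [i j] _ /=; rewrite (ord1 i).
Qed.

Lemma box_mvt F a (l : 'I_k -> R) (r M : R) : 0 <= r -> 0 <= M ->
  (forall x, `|x - a| <= r -> forall j,
     derivable F x (e_ j) /\ `|'D_(e_ j) F x - l j| <= M) ->
  forall h, `|h| <= r ->
  `|F (a + h) - F a - \sum_j h 0 j * l j| <= k%:R * (M * r).
Proof.
move=> r0 M0 hF h hr.
pose hh (i : nat) : 'rV[R]_k := \row_j (if (j < i)%N then h 0 j else 0).
suff key i : (i <= k)%N ->
    `|F (a + hh i) - F a - \sum_(j < k | (j < i)%N) h 0 j * l j| <= i%:R * (M * r).
  have := key k (leqnn k).
  have -> : hh k = h by apply/rowP => j; rewrite mxE ltn_ord.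
  by under eq_bigl do rewrite ltn_ord.
elim: i => [|i IH] ik.
  have -> : hh 0%N = 0 by apply/rowP => j; rewrite !mxE.
  by rewrite addr0 subrr big_pred0 // subrr normr0 mul0r.
pose o := Ordinal ik.
have hS : hh i.+1 = hh i + h 0 o *: e_ o.
  apply/rowP => j; rewrite !mxE eqxx /= ltnS leq_eqVlt.
  have [->|jo] := eqVneq j o; first by rewrite eqxx ltnn mulr1 add0r.
  by rewrite mulr0 addr0 (negPf (jo : (j : nat) != i)).
have sumS : \sum_(j < k | (j < i.+1)%N) h 0 j * l j =
    h 0 o * l o + \sum_(j < k | (j < i)%N) h 0 j * l j.
  rewrite (bigD1 o) ?ltnSn //=; congr (_ + _); apply: eq_bigl => j.
  rewrite ltnS leq_eqVlt; have [->|jo] := eqVneq j o; first by rewrite ltnn eqxx.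
  by rewrite andbT (negPf (jo : (j : nat) != i)).
have := IH (ltnW ik).
have : `|F (a + hh i + h 0 o *: e_ o) - F (a + hh i) - h 0 o * l o| <= M * `|h 0 o|.
  apply: line_mvt => t ht; apply: hF.
  rewrite -(addrA a (hh i)) (addrC a) addrK.
  apply: norm_le_coord => // j; rewrite !mxE eqxx /=.
  have [->|jo] := eqVneq j o.
    rewrite ltnn mulr1 add0r (le_trans ht) // (le_trans (coord_le_norm h o)) //.
  rewrite mulr0 addr0; case: ifP => _; last by rewrite normr0.
  exact: le_trans (coord_le_norm h j) hr.
have : M * `|h 0 o| <= M * r by rewrite ler_wpM2l // (le_trans (coord_le_norm h o)).
rewrite hS sumS addrA -natr1.
move: (F (a + hh i + h 0 o *: e_ o)) (F (a + hh i)) (F a) => A B C.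
move: (\sum_(_ < _ | _) _) (h 0 o * l o) (M * `|_|) (M * r) => D E X Y.
move=> h1 h2 h3.
have -> : A - C - (E + D) = (A - B - E) + (B - C - D) by ring.
by apply: (le_trans (ler_normD _ _)); lra.
Qed.

End Box.

Section LocalExpansion.
Variables (R : realType) (k m : nat).
Implicit Types (U : set 'rV[R]_k) (a x h : 'rV[R]_k).

Notation e_ j := (delta_mx 0 j : 'rV[R]_k).

Lemma near_box a (P : 'rV[R]_k -> Prop) : (\forall x \near a, P x) ->
  exists2 r : R, 0 < r & forall x, `|x - a| <= r -> P x.
Proof.
move=> /nbhs_normP[e /= e0 h]; exists (e / 2); first by rewrite divr_gt0.
move=> x xa; apply: h => /=; rewrite distrC (le_lt_trans xa) //.
by rewrite ltr_pdivrMr // ltr_pMr // ltr1n.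
Qed.

Lemma box_near a (r : R) : 0 < r -> \forall x \near a, `|x - a| <= r.
Proof.
move=> r0; apply/nbhs_normP; exists r => [//|x].
by rewrite /ball_ /= distrC; exact: ltW.
Qed.

Lemma near_bounded (g : 'rV[R]_k -> 'rV[R]_m) a : {for a, continuous g} ->
  \forall x \near a, `|g x| <= `|g a| + 1.
Proof.
move=> /cvgrPdist_lt /(_ 1 ltr01); apply: filterS => x h.
rewrite -[g x](subKr (g a)) (le_trans (ler_normB _ _)) // lerD2l.
by rewrite ltW // -opprB subKr.
Qed.

Lemma derivable_coord (g : 'rV[R]_k -> 'rV[R]_m) x v i :
  derivable g x v -> derivable (fun y => g y 0 i) x v.
Proof. by move=> /derivable_mxP/(_ 0 i). Qed.

Lemma derive_coord (g : 'rV[R]_k -> 'rV[R]_m) x v i :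
  derivable g x v -> 'D_v (fun y => g y 0 i) x = ('D_v g x) 0 i.
Proof. by move=> dg; rewrite (derive_mx dg) mxE. Qed.

Lemma C1_lipschitz U (f : 'rV[R]_k -> 'rV[R]_m) a : open U -> U a -> Ck_on 1 U f ->
  exists r C : R, [/\ 0 < r, 0 <= C &
    forall x, `|x - a| <= r -> U x /\ `|f x - f a| <= C * `|x - a|].
Proof.
move=> oU Ua [_ hf]; pose M := \sum_j (`|'D_(e_ j) f a| + 1).
have MD j : `|'D_(e_ j) f a| + 1 <= M.
  by rewrite /M (bigD1 j) //= lerDl sumr_ge0 // => i _; rewrite addr_ge0.
have M0 : 0 <= M by rewrite sumr_ge0 // => j _; rewrite addr_ge0.
have [r r0 hr] : exists2 r : R, 0 < r & forall x, `|x - a| <= r ->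
    U x /\ forall j, `|'D_(e_ j) f x| <= M.
  apply: near_box; apply: filterI; first exact: open_nbhs_nbhs.
  have h j : \forall x \near a, `|'D_(e_ j) f x| <= M.
    have := near_bounded ((hf (e_ j)).2.1 a Ua).
    by apply: filterS => x h; apply: le_trans h (MD j).
  exact: filter_forall h.
exists r, (k%:R * M); split=> //; first by rewrite mulr_ge0.
move=> x xr; split; first by case: (hr x xr).
apply: norm_le_coord => [|i]; first by rewrite !mulr_ge0.
have := @box_mvt R k (fun x => f x 0 i) a (fun=> 0) `|x - a| M (normr_ge0 _) M0.
move=> /(_ _ (x - a) (lexx _)); rewrite (addrC a) subrK big1 => [|j _]; last by rewrite mulr0.
rewrite subr0 !mxE mulrA; apply => y yx j.
have [Uy hy] := hr y (le_trans yx xr); have dy := (hf (e_ j)).1 y Uy.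
split; first exact: derivable_coord.
by rewrite subr0 derive_coord // (le_trans (coord_le_norm _ i)).
Qed.

Definition jacob (f : 'rV[R]_k -> 'rV[R]_m) a : 'M[R]_(k, m) :=
  \matrix_(j, i) ('D_(e_ j) f a) 0 i.

End LocalExpansion.

Section Taylor.
Variables (R : realType) (k m : nat).
Implicit Types (U : set 'rV[R]_k) (a x h : 'rV[R]_k).

Notation e_ j := (delta_mx 0 j : 'rV[R]_k).

Lemma C2_taylor U (f : 'rV[R]_k -> 'rV[R]_m) a : open U -> U a -> Ck_on 2 U f ->
  exists r C : R, [/\ 0 < r, 0 <= C & forall x, `|x - a| <= r ->
    `|f x - f a - (x - a) *m jacob f a| <= C * `|x - a| ^+ 2].
Proof.
move=> oU Ua [_ hf].
have hj (j : 'I_k) : exists rC : R * R, [/\ 0 < rC.1, 0 <= rC.2 &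
    forall x, `|x - a| <= rC.1 ->
      U x /\ `|'D_(e_ j) f x - 'D_(e_ j) f a| <= rC.2 * `|x - a|].
  by have [r [C h]] := C1_lipschitz oU Ua (hf (e_ j)).2; exists (r, C).
have {hj}[rC hrC] := choice hj.
pose M := \sum_j (rC j).2.
have M0 : 0 <= M by rewrite sumr_ge0 // => j _; case: (hrC j).
have MC j : (rC j).2 <= M.
  by rewrite /M (bigD1 j) //= lerDl sumr_ge0 // => i _; case: (hrC i).
have [r r0 hr] : exists2 r : R, 0 < r & forall x, `|x - a| <= r -> U x /\ forall j,
    `|'D_(e_ j) f x - 'D_(e_ j) f a| <= M * `|x - a|.
  apply: near_box; apply: filterI; first exact: open_nbhs_nbhs.
  have h j : \forall x \near a, `|'D_(e_ j) f x - 'D_(e_ j) f a| <= M * `|x - a|.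
    have [r0 C0 h] := hrC j.
    have := box_near a r0; apply: filterS => x /h[_ h'].
    by apply: le_trans h' _; rewrite ler_wpM2r.
  exact: filter_forall h.
exists r, (k%:R * M); split=> //; first by rewrite mulr_ge0.
move=> x xr; apply: norm_le_coord => [|i]; first by rewrite !mulr_ge0 ?sqr_ge0.
have M'0 : 0 <= M * `|x - a| by rewrite mulr_ge0.
have := @box_mvt R k (fun x => f x 0 i) a (fun j => 'D_(e_ j) f a 0 i) `|x - a|
  (M * `|x - a|) (normr_ge0 _) M'0.
move=> /(_ _ (x - a) (lexx _)); rewrite (addrC a) subrK.
have -> : (f x - f a - (x - a) *m jacob f a) 0 i =
    f x 0 i - f a 0 i - \sum_j (x - a) 0 j * 'D_(e_ j) f a 0 i.
  by rewrite !mxE; congr (_ - _); apply: eq_bigr => j _; rewrite !mxE.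
have -> : k%:R * M * `|x - a| ^+ 2 = k%:R * (M * `|x - a| * `|x - a|).
  by rewrite expr2 !mulrA.
apply => y yx j.
have [Uy hy] := hr y (le_trans yx xr); have dy := (hf (e_ j)).1 y Uy.
split; first exact: derivable_coord.
rewrite derive_coord //.
have := coord_le_norm ('D_(e_ j) f y - 'D_(e_ j) f a) i; rewrite !mxE => h.
by apply: le_trans h (le_trans (hy j) _); rewrite ler_wpM2l.
Qed.

End Taylor.

Section LocalChart.
Variables (R : realType) (d k : nat) (S : set 'rV[R]_d).

(* A has the partial derivatives of a chart at p as rows: its row space is the
   tangent space, and S coincides with it near p up to second order. *)
Definition tangent_matrix (p : 'rV[R]_d) (A : 'M[R]_(k, d)) :=
  [/\ row_free A,
      exists C dl : R, [/\ 0 < C, 0 < dl,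
        forall c : 'rV_k, enorm (c *m A) <= dl ->
          exists2 z, S z & enorm (z - p - c *m A) <= C * enorm (c *m A) ^+ 2
      & forall z, S z -> edist z p <= dl ->
          exists c : 'rV_k, enorm (z - p - c *m A) <= C * edist z p ^+ 2]
    & forall c : 'rV_k, tangent_vector S p (c *m A)].

Lemma derive_taylor (f : 'rV[R]_k -> 'rV[R]_d) a (A : 'M[R]_(k, d)) (r C : R) c :
  0 < r -> 0 <= C ->
  (forall x, `|x - a| <= r -> `|f x - f a - (x - a) *m A| <= C * `|x - a| ^+ 2) ->
  'D_c f a = c *m A.
Proof.
move=> r0 C0 hf; apply: cvg_lim => //.
apply/cvgrPdist_lt => e e0.
pose t0 := Num.min (r / (`|c| + 1)) (e / (C * `|c| ^+ 2 + 1)).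
have c1 : 0 < `|c| + 1 by rewrite ltr_wpDl.
have c2 : 0 < C * `|c| ^+ 2 + 1 by rewrite ltr_wpDl // mulr_ge0 // exprn_ge0.
have t00 : 0 < t0 by rewrite lt_min !divr_gt0.
apply/nbhs_normP; exists t0 => [//|t] /=; rewrite sub0r normrN => ht tn0.
have [h1 h2] : `|t| * `|c| <= r /\ `|t| * (C * `|c| ^+ 2) < e.
  move: ht; rewrite lt_min !ltr_pdivlMr // => /andP[h1 h2]; split.
    by apply/ltW/(le_lt_trans _ h1); rewrite ler_wpM2l // lerDl.
  by apply: le_lt_trans h2; rewrite ler_wpM2l // lerDl.
have -> : c *m A - t^-1 *: (f (t *: c + a) - f a) =
    - (t^-1 *: (f (t *: c + a) - f a - (t *: c + a - a) *m A)).
  by rewrite addrK -scalemxAl [in RHS]scalerBr opprB scalerA mulVf // scale1r.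
rewrite normrN normrZ; have := hf (t *: c + a).
rewrite addrK normrZ => /(_ h1) h3.
have t_gt0 : 0 < `|t| by rewrite normr_gt0.
rewrite normrV ?unitfE // -ltr_pdivlMl ?invr_gt0 // invrK.
apply: le_lt_trans h3 _; rewrite exprMn expr2.
have -> : C * (`|t| * `|t| * `|c| ^+ 2) = `|t| * (`|t| * (C * `|c| ^+ 2)) by ring.
by rewrite ltr_pM2l.
Qed.

Lemma local_chart p : smooth_submanifold k S -> S p ->
  exists A, tangent_matrix p A.
Proof.
move=> mfd Sp; have [U [W [phi [psi [[oU oW] Wp [sphi spsi] img inv]]]]] := mfd p Sp.
pose a := psi p.
have [Ua pa] : U a /\ phi a = p.
  have : (S `&` W) p by [].
  by rewrite -img => -[y Uy yp]; rewrite /a -yp inv.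
have [r1 [K1 [r1_gt0 K1_ge0 hpsi]]] := C1_lipschitz oW Wp (spsi 1%N).
have [r2 [K2 [r2_gt0 K2_ge0 hphi]]] := C1_lipschitz oU Ua (sphi 1%N).
have [r3 [K3 [r3_gt0 K3_ge0 htay]]] := C2_taylor oU Ua (sphi 2%N).
move: (jacob phi a) htay => A; rewrite !pa in hphi * => htay.
pose rho := Num.min (Num.min r2 r3) (r1 / (K2 + 1)).
have K21 : 0 < K2 + 1 by rewrite ltr_wpDl.
have rho0 : 0 < rho by rewrite !lt_min r2_gt0 r3_gt0 divr_gt0.
have rho2 : rho <= r2 by rewrite !ge_min lexx.
have rho3 : rho <= r3 by rewrite !ge_min lexx orbT.
have rho1 : K2 * rho <= r1.
  have : rho <= r1 / (K2 + 1) by rewrite ge_min lexx orbT.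
  rewrite ler_pdivlMr // => h; apply: le_trans h.
  by rewrite mulrC ler_wpM2l ?lerDl // ltW.
clearbody rho.
have aK c : a + c - a = c by rewrite addrC addKr.
have key0 c : `|c| <= rho -> `|phi (a + c) - p - c *m A| <= K3 * `|c| ^+ 2.
  by move=> h; have := htay (a + c); rewrite aK; apply; apply: le_trans h _.
have key1 c : `|c| <= rho -> U (a + c) /\
    `|c| <= K1 * (`|c *m A| + K3 * `|c| ^+ 2).
  move=> h; have [|Uc hc] := hphi (a + c).
    by rewrite aK (le_trans h).
  split=> //; have [|_] := hpsi (phi (a + c)).
    apply: le_trans hc _; rewrite aK.
    by apply: le_trans rho1; rewrite ler_wpM2l.
  rewrite inv // -/a aK => /le_trans; apply.
  rewrite ler_wpM2l //.
  have -> : phi (a + c) - p = (phi (a + c) - p - c *m A) + c *m A by rewrite subrK.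
  apply: le_trans (ler_normD _ _) _; rewrite [leLHS]addrC.
  by apply: lerD => //; exact: key0.
have key2 (c : 'rV_k) : `|c| <= 2 * K1 * `|c *m A|.
  have [->|cn0] := eqVneq c 0; first by rewrite normr0 !mulr_ge0.
  have c0 : 0 < `|c| by rewrite normr_gt0.
  pose t := Num.min (rho / `|c|) (1 / (2 * (K1 * K3 + 1) * `|c|)).
  have K13 : 0 < K1 * K3 + 1 by rewrite ltr_wpDl // mulr_ge0.
  have t0 : 0 < t by rewrite lt_min !divr_gt0 // !mulr_gt0.
  have t1 : t * `|c| <= rho by rewrite -ler_pdivlMr // ge_min lexx.
  have t2 : 2 * (K1 * K3) * (t * `|c|) <= 1.
    have : t <= 1 / (2 * (K1 * K3 + 1) * `|c|) by rewrite ge_min lexx orbT.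
    rewrite ler_pdivlMr ?mulr_gt0 // => h; apply: le_trans h.
    have : 0 <= t * `|c| by rewrite mulr_ge0 // ltW.
    by move: `|c| => x x0; lra.
  have [|_] := key1 (t *: c); first by rewrite normrZ gtr0_norm.
  rewrite -scalemxAl !normrZ gtr0_norm // => h.
  rewrite -(ler_pM2l t0).
  have : K1 * K3 * (t * `|c|) * (t * `|c|) <= t * `|c| / 2.
    rewrite [leRHS]mulrC ler_wpM2r //; last lra.
    by rewrite mulr_ge0 // ltW.
  move: h; rewrite expr2; move: `|c| `|c *m A| => X Y; lra.
have dn0 : 0 <= d%:R :> R by [].
exists A; split.
- rewrite -kermx_eq0; apply/eqP/row_matrixP => i; rewrite row0.
  apply/eqP; rewrite -normr_le0.
  by apply: le_trans (key2 _) _; rewrite -row_mul mulmx_ker row0 normr0 mulr0.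
- pose dl := Num.min r1 (rho / (2 * K1 + 1)).
  have K11 : 0 < 2 * K1 + 1 by rewrite ltr_wpDl // mulr_ge0.
  have dl1 : dl <= r1 by rewrite ge_min lexx.
  have dl2 : 2 * K1 * dl <= rho.
    have : dl <= rho / (2 * K1 + 1) by rewrite ge_min lexx orbT.
    rewrite ler_pdivlMr // => h; apply: le_trans h.
    have : 0 <= dl by rewrite le_min (ltW r1_gt0) divr_ge0 // ltW.
    by move=> dl0; rewrite mulrDr mulr1 (mulrC dl) lerDl.
  have dl0 : 0 < dl by rewrite lt_min r1_gt0 divr_gt0.
  clearbody dl.
  pose C := d%:R * (K3 * (2 * K1) ^+ 2) + 1.
  have est c z x : `|c| <= rho -> `|c| <= 2 * K1 * x -> phi (a + c) = z ->
      enorm (z - p - c *m A) <= C * x ^+ 2.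
    move=> h1 h2 <-; apply: (le_trans (norm_mx_norm _)).
    apply: (@le_trans _ _ (d%:R * (K3 * (2 * K1 * x) ^+ 2))).
      rewrite ler_wpM2l // (le_trans (key0 _ h1)) // ler_wpM2l //.
      by rewrite lerXn2r ?nnegrE // (le_trans _ h2).
    have -> : d%:R * (K3 * (2 * K1 * x) ^+ 2) = d%:R * (K3 * (2 * K1) ^+ 2) * x ^+ 2.
      by ring.
    by rewrite /C [leRHS](mulrDl _ 1) mul1r lerDl sqr_ge0.
  exists C, dl; split=> //.
  + by rewrite ltr_wpDl // !mulr_ge0 // exprn_ge0 // mulr_ge0.
  + move=> c hc.
    have h1 : `|c| <= 2 * K1 * enorm (c *m A).
      by apply: le_trans (key2 _) _; rewrite ler_wpM2l ?mulr_ge0 ?mx_norm_norm.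
    have h2 : `|c| <= rho.
      by apply: le_trans h1 (le_trans _ dl2); rewrite ler_wpM2l // mulr_ge0.
    exists (phi (a + c)); last exact: est.
    have : (phi @` U) (phi (a + c)) by exists (a + c) => //; case: (key1 c h2).
    by rewrite img => -[].
  + move=> z Sz hz.
    have zp : `|z - p| <= edist z p by rewrite edistE mx_norm_norm.
    have [|Wz hc] := hpsi z; first exact: le_trans zp (le_trans hz dl1).
    have [y Uy yz] : (phi @` U) z by rewrite img.
    have h1 : `|psi z - a| <= 2 * K1 * edist z p.
      apply: le_trans hc _; apply: ler_pM => //.
      by rewrite ler_peMl // ler1n.
    exists (psi z - a); apply: (est _ _ _ _ h1).
      by apply: le_trans h1 (le_trans _ dl2); rewrite ler_wpM2l // mulr_ge0.
    by rewrite addrC subrK -yz inv.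
- move=> c.
  have c1 : 0 < `|c| + 1 by rewrite ltr_wpDl.
  pose e := rho / (`|c| + 1).
  have inU t : ball (0 : R) e t -> U (a + t *: c).
    rewrite -ball_normE /= sub0r normrN /e ltr_pdivlMr // => h.
    have [] := key1 (t *: c) => //.
    by rewrite normrZ (le_trans _ (ltW h)) // ler_wpM2l // lerDl.
  exists e, (fun t => phi (a + t *: c)); split.
  + by rewrite divr_gt0.
  + by move=> n; apply: Ck_on_line (sphi n) inU.
  + move=> t /inU Ut; have : (phi @` U) (phi (a + t *: c)) by exists (a + t *: c).
    by rewrite img => -[].
  + by rewrite scale0r addr0.
  + rewrite derive_line scale1r scale0r addr0; apply: (@derive_taylor phi a A r3 K3 c r3_gt0 K3_ge0).
    by rewrite pa.
Qed.

End LocalChart.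

Section Normals.
Variables (R : realType) (d k : nat) (S : set 'rV[R]_d).
Implicit Types (p n w z : 'rV[R]_d) (A : 'M[R]_(k, d)).

Lemma dot_row n (A : 'M[R]_(k, d)) j : (n *m A^T) 0 j = dot n (row j A).
Proof. by rewrite dot.unlock mxE; apply: eq_bigr => i _; rewrite !mxE. Qed.

Lemma dot_mulmx n (A : 'M[R]_(k, d)) (c : 'rV_k) : n *m A^T = 0 -> dot n (c *m A) = 0.
Proof.
move=> h; rewrite mulmx_sum_row.
have : forall j, dot n (row j A) = 0 by move=> j; rewrite -dot_row h mxE.
move=> {}h; elim/big_rec: _ => [|j x _ IH]; first by rewrite dot0r.
by rewrite dotDr dotZr h mulr0 add0r.
Qed.

Lemma tangent_matrix_pnormal p A n : tangent_matrix S p A -> n *m A^T = 0 ->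
  pnormal S p n.
Proof.
move=> [_ [C [dl [C0 dl0 _ near]]] _] nA.
pose M := (C + dl^-1) * enorm n + 1.
have M0 : 0 < M by rewrite ltr_wpDl // mulr_ge0 ?norm_ge0 // addr_ge0 // ?invr_ge0 ltW.
exists (2 * M)^-1; first by rewrite invr_gt0 mulr_gt0.
move=> z Sz; rewrite -sqr_norm.
have -> : 2 * (2 * M)^-1 * dot (z - p) n = M^-1 * dot (z - p) n.
  by field; rewrite gt_eqF.
rewrite ler_pdivrMl // /M mulrDl mul1r mulrDl mulrDl.
have N0 := norm_ge0 n; have X0 := sqr_ge0 (enorm (z - p)).
have a0 : 0 <= C * enorm n * enorm (z - p) ^+ 2.
  by apply: mulr_ge0 => //; rewrite mulr_ge0 // ltW.
have b0 : 0 <= dl^-1 * enorm n * enorm (z - p) ^+ 2.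
  by apply: mulr_ge0 => //; rewrite mulr_ge0 // invr_ge0 ltW.
have [zp|zp] := leP (edist z p) dl.
  have [c hc] := near z Sz zp.
  have -> : dot (z - p) n = dot (z - p - c *m A) n.
    by rewrite [in RHS]dotDl dotNl (dotC (c *m A)) dot_mulmx // subr0.
  apply: le_trans (cauchy_schwarz _ _) _.
  have := ler_wpM2r N0 hc; rewrite edistE.
  move: a0 b0 X0; move: (enorm (z - p)) (enorm n) (enorm _) => X N Y *; lra.
have h : dot (z - p) n <= enorm (z - p) * enorm n := cauchy_schwarz _ _.
have : enorm (z - p) * enorm n <= dl^-1 * enorm n * enorm (z - p) ^+ 2.
  rewrite edistE in zp; rewrite -mulrA ler_pdivlMl // mulrA mulrAC.
  rewrite [leRHS]mulrC expr2 mulrAC ler_wpM2r // ler_wpM2r ?norm_ge0 //; exact: ltW.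
move: b0 a0 X0 h; move: (enorm (z - p)) (enorm n) (dot (z - p) n) (dl^-1).
by move=> *; lra.
Qed.

Lemma pnormal_tangent_vector p n w : pnormal S p n -> tangent_vector S p w ->
  dot n w = 0.
Proof.
move=> [t0 t00 hn] [e [g [e0 sg gS g0 gw]]].
have dg : derivable g 0 1 by apply: ((sg 1%N).2 1).1; exact: ballxx.
have cv : (fun h : R => h^-1 *: (g (h *: 1 + 0) - g 0)) @ 0^' --> w.
  by rewrite -gw; exact: dg.
apply/eqP; rewrite -normr_eq0; apply/eqP; set b := dot n w.
apply/le_anti; rewrite normr_ge0 andbT leNgt; apply/negP => b0.
have D0 : 0 <= d%:R :> R by [].
have N0 := norm_ge0 n; have W0 := norm_ge0 w.
pose e1 := Num.min 1 (`|b| / (2 * (d%:R * enorm n + 1))).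
have den : 0 < d%:R * enorm n + 1 by rewrite ltr_wpDl // mulr_ge0.
have e10 : 0 < e1 by rewrite lt_min ltr01 divr_gt0 // mulr_gt0.
have e11 : e1 <= 1 by rewrite ge_min lexx.
have e12 : d%:R * e1 * enorm n <= `|b| / 2.
  have : e1 <= `|b| / (2 * (d%:R * enorm n + 1)) by rewrite ge_min lexx orbT.
  rewrite ler_pdivlMr ?mulr_gt0 // => h.
  rewrite ler_pdivlMr //; apply: le_trans h; clear -e10.
  by move: e1 (enorm n) e10 => *; lra.
clearbody e1.
move/cvgrPdist_lt : cv => /(_ e1 e10) /nbhs_normP[dl /= dl0 hdl].
pose K := (enorm w + d%:R) ^+ 2 + 1.
have K0 : 0 < K by rewrite ltr_wpDl // sqr_ge0.
pose h1 := Num.min (Num.min (dl / 2) (e / 2)) (t0 * `|b| / (2 * K)).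
have h10 : 0 < h1 by rewrite !lt_min !divr_gt0 // mulr_gt0.
have h1dl : h1 < dl by rewrite !gt_min; apply/orP; left; apply/orP; left; lra.
have h1e : h1 < e by rewrite !gt_min; apply/orP; left; apply/orP; right; lra.
have h1K : h1 * K <= t0 * `|b| / 2.
  have : h1 <= t0 * `|b| / (2 * K) by rewrite ge_min lexx orbT.
  rewrite ler_pdivlMr ?mulr_gt0 // => h; clear -h; lra.
clearbody h1.
pose h := Num.sg b * h1.
have bn0 : b != 0 by rewrite -normr_gt0.
have hn0 : h != 0 by rewrite mulf_neq0 ?sgr_eq0 // gt_eqF.
have nh : `|h| = h1 by rewrite normrM normr_sg bn0 mul1r gtr0_norm.
have Sgh : S (g h) by apply: gS; rewrite -ball_normE /= sub0r normrN nh.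
have := hdl h; rewrite /ball_ /= sub0r normrN nh addr0 g0 => /(_ h1dl hn0).
have -> : h *: (1 : R) = h by rewrite /GRing.scale /= mulr1.
set q := _ *: (g h - p) => hq.
have gh : g h - p = h *: q by rewrite /q scalerA divff // scale1r.
clearbody q; have hq2 : enorm (w - q) <= d%:R * e1.
  by apply: le_trans (norm_mx_norm _) _; rewrite ler_wpM2l // ltW.
have q1 : enorm q <= enorm w + d%:R.
  have -> : q = w - (w - q) by rewrite subKr.
  apply: le_trans (normD _ _) _; rewrite normN lerD2l (le_trans hq2) //.
  by rewrite ler_piMr.
have := hn _ Sgh; rewrite gh !dotE.
have -> : h * (h * dot q q) = h1 ^+ 2 * enorm q ^+ 2.
  by rewrite mulrA -expr2 -nh real_normK ?num_real // sqr_norm.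
have -> : 2 * t0 * (h * dot q n) = h1 * (2 * t0 * (Num.sg b * dot q n)).
  by rewrite /h; ring.
rewrite [h1 ^+ 2]expr2 -[h1 * h1 * _]mulrA ler_pM2l //.
have q2 : enorm q ^+ 2 <= (enorm w + d%:R) ^+ 2.
  by rewrite lerXn2r ?nnegrE ?norm_ge0 // addr_ge0.
have : h1 * enorm q ^+ 2 <= h1 * K.
  by rewrite ler_pM2l // (le_trans q2) // /K lerDl.
have : `|b| / 2 <= Num.sg b * dot q n.
  have -> : dot q n = b - dot n (w - q) by rewrite dotDr dotNr opprB addrC (dotC q) subrK.
  rewrite mulrBr -normrEsg.
  have : `|Num.sg b * dot n (w - q)| <= `|b| / 2.
    rewrite normrM normr_sg bn0 mul1r; apply: le_trans e12.
    have : enorm n * enorm (w - q) <= enorm n * (d%:R * e1) by rewrite ler_wpM2l.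
    have := cauchy_schwarz n (w - q); have := cauchy_schwarzN n (w - q).
    rewrite ler_norml; clear; move: (d%:R * e1) (dot n (w - q)) (enorm n) (enorm (w - q)).
    by move=> *; apply/andP; split; lra.
  by move=> /ler_normlP[]; clear; move: (Num.sg b * _) => *; lra.
move=> u1 u2 u3; have : t0 * (`|b| / 2) <= t0 * (Num.sg b * dot q n) by rewrite ler_pM2l.
have : 0 < t0 * `|b| by rewrite mulr_gt0.
by move: u2 u3 h1K; clear; move: (Num.sg b * _) (enorm q) => *; lra.
Qed.

Definition normal p n := normal_flat S p (p + n).

Lemma normalP p n : normal p n <-> forall w, tangent_vector S p w -> dot n w = 0.
Proof.
have nE : p + n - p = n by rewrite addrC addKr.
rewrite /normal /normal_flat /tangent_flat /=; split=> h w hw.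
  have := h (p + w); rewrite nE (_ : p + w - p = w) => [|]; first by rewrite dotp_dot; apply.
  by rewrite addrC addKr.
by rewrite nE dotp_dot; exact: h.
Qed.

Lemma normal_matrix p A n : tangent_matrix S p A -> normal p n <-> n *m A^T = 0.
Proof.
move=> hA; rewrite normalP; split=> [h|h w hw].
  apply/rowP => j; rewrite dot_row mxE; apply: h; rewrite rowE.
  by case: hA.
exact: pnormal_tangent_vector (tangent_matrix_pnormal hA h) hw.
Qed.

Lemma pnormal_matrix p A n : tangent_matrix S p A -> pnormal S p n <-> n *m A^T = 0.
Proof.
move=> hA; split=> [h|]; last exact: tangent_matrix_pnormal.
by apply/(normal_matrix n hA)/normalP => w; exact: pnormal_tangent_vector.
Qed.

End Normals.

Section Trigonometry.
Variable R : realType.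
Implicit Types x y : R.

Lemma cos_le x y : 0 <= x -> x <= y -> y <= pi -> cos y <= cos x.
Proof.
move=> x0; rewrite le_eqVlt => /predU1P[->//|xy] ypi; apply: ltW.
by rewrite ltr_cos // in_itv /= ?x0 ?ypi ?(le_trans x0 (ltW xy)) ?(le_trans (ltW xy)).
Qed.

Lemma sin_mvt x : 0 <= x -> exists2 c, 0 <= c <= x & sin x = cos c * x.
Proof.
move=> x0; have [|c cI] := @MVT_segment R sin cos 0 x x0.
  by apply: continuous_subspaceT => y; exact: continuous_sin.
by rewrite sin0 !subr0 => E; exists c => //; move: cI; rewrite in_itv.
Qed.

Lemma sin_le_id x : 0 <= x -> sin x <= x.
Proof.
move=> x0; have [c _ ->] := sin_mvt x0.
by rewrite ler_piMl // cos_le1.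
Qed.

Lemma cos_ge_quad x : 0 <= x -> 1 - x ^+ 2 / 2 <= cos x.
Proof.
move=> x0; have h : 0 <= x / 2 by rewrite divr_ge0.
have -> : cos x = 1 - 2 * sin (x / 2) ^+ 2.
  rewrite {1}(_ : x = (x / 2) *+ 2); last by rewrite mulr2n; lra.
  by rewrite cos_mulr2n cos2sin2 mulr2n; ring.
have : sin (x / 2) ^+ 2 <= (x / 2) ^+ 2.
  by have [z _ ->] := sin_mvt h; rewrite exprMn ler_piMl ?sqr_ge0 // sqr_le1 cos_max.
rewrite exprMn; move: (sin _ ^+ 2) => s; lra.
Qed.

Lemma sin_ge_scale l : l < 1 ->
  exists2 dl : R, 0 < dl & forall x, 0 <= x <= dl -> l * x <= sin x.
Proof.
move=> l1; exists (Num.min 1 (1 - l)); first by rewrite lt_min ltr01 subr_gt0.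
move=> x /andP[x0]; rewrite le_min => /andP[x1 xl].
have [c /andP[c0 cx] ->] := sin_mvt x0; rewrite ler_wpM2r //.
apply: le_trans (cos_ge_quad c0).
have : c ^+ 2 <= x by rewrite expr2 (le_trans (ler_piMl _ _)) // (le_trans cx).
have : 0 <= c ^+ 2 := sqr_ge0 c.
lra.
Qed.

End Trigonometry.

Section Angles.
Variables (R : realType) (d : nat).
Implicit Types (n w : 'rV[R]_d) (t a b : R).

(* A and B stand for the orthogonal complements of their row spaces. *)
Definition angle_le k l (A : 'M[R]_(k, d)) (B : 'M[R]_(l, d)) t :=
  forall n, n *m A^T = 0 -> enorm n = 1 ->
  exists m : 'rV_d, [/\ m *m B^T = 0, enorm m = 1 & cos t <= dot n m].

Lemma angle_le_mono k l (A : 'M[R]_(k, d)) (B : 'M[R]_(l, d)) a b :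
  0 <= a -> a <= b -> b <= pi -> angle_le A B a -> angle_le A B b.
Proof.
move=> a0 ab bpi h n nA n1; have [m [mB m1 c]] := h n nA n1.
by exists m; split=> //; apply: le_trans c; exact: cos_le.
Qed.

Lemma cos_sum_le n w u a b : enorm n = 1 -> enorm w = 1 -> enorm u = 1 ->
  0 <= a -> 0 <= b -> a + b <= pi -> cos a <= dot n w -> cos b <= dot w u ->
  cos (a + b) <= dot n u.
Proof.
move=> n1 w1 u1 a0 b0 abpi ca cb.
have unit_itv (x y : 'rV[R]_d) : enorm x = 1 -> enorm y = 1 -> -1 <= dot x y <= 1.
  move=> x1 y1; have := cauchy_schwarz x y; have := cauchy_schwarzN x y.
  by rewrite x1 y1 mulr1 => -> ->.
have acos_le (x c : R) : 0 <= c <= pi -> -1 <= x <= 1 -> cos c <= x -> acos x <= c.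
  move=> /andP[c0 cpi] hx h; rewrite leNgt; apply/negP => lt.
  have : cos (acos x) < cos c.
    by rewrite ltr_cos // in_itv /= ?c0 ?cpi // acos_ge0 // acos_lepi.
  by rewrite acosK ?in_itv //= ltNge h.
have hx := unit_itv _ _ n1 w1; have hy := unit_itv _ _ w1 u1.
set x := dot n w in ca hx; set y := dot w u in cb hy.
have a1 : acos x <= a by apply: acos_le => //; rewrite a0 (le_trans _ abpi) // lerDl.
have b1 : acos y <= b by apply: acos_le => //; rewrite b0 (le_trans _ abpi) // lerDr.
have : cos (a + b) <= cos (acos x + acos y).
  by apply: cos_le => //; [apply: addr_ge0; exact: acos_ge0|exact: lerD].
rewrite (cosD (acos x)) !acosK ?in_itv //= !sin_acos // => h; apply: (le_trans h).
have e1 : enorm (n - x *: w) = Num.sqrt (1 - x ^+ 2).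
  rewrite enormE !dotE -!sqr_norm n1 w1 (dotC w n) -/x; congr Num.sqrt; ring.
have e2 : enorm (u - y *: w) = Num.sqrt (1 - y ^+ 2).
  rewrite enormE !dotE -!sqr_norm u1 w1 (dotC u w) -/y; congr Num.sqrt; ring.
have := cauchy_schwarzN (n - x *: w) (u - y *: w).
rewrite e1 e2 !dotE -sqr_norm w1 -/x -/y; move: (_ * _) (dot n u) => s D; lra.
Qed.

Lemma angle_le_trans k l m (A : 'M[R]_(k, d)) (B : 'M[R]_(l, d)) (C : 'M[R]_(m, d))
    a b : 0 <= a -> 0 <= b -> a + b <= pi ->
  angle_le A B a -> angle_le B C b -> angle_le A C (a + b).
Proof.
move=> a0 b0 ab hAB hBC n nA n1.
have [w [wB w1 c1]] := hAB n nA n1; have [u [uC u1 c2]] := hBC w wB w1.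
by exists u; split=> //; apply: cos_sum_le c1 c2.
Qed.

Lemma orth_decomp k (A : 'M[R]_(k, d)) n : row_free A ->
  exists c : 'rV_k, (n - c *m A) *m A^T = 0.
Proof.
move=> fA; have uA : A *m A^T \in unitmx.
  rewrite -row_free_unit; apply: inj_row_free => x xA.
  have : x *m A = 0.
    apply: dot_eq0; rewrite dot_mulmx // -mulmxA.
    by [].
  by move/eqP; rewrite mulmx_free_eq0 // => /eqP.
exists (n *m A^T *m invmx (A *m A^T)).
by rewrite mulmxBl -!mulmxA mulVmx // mulmx1 subrr.
Qed.

Lemma orth_decomp_norm k (A : 'M[R]_(k, d)) n (c : 'rV_k) : (n - c *m A) *m A^T = 0 ->
  enorm n ^+ 2 = enorm (c *m A) ^+ 2 + enorm (n - c *m A) ^+ 2.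
Proof.
move=> h; have o := dot_mulmx c h; rewrite !sqr_norm.
move: {h} o (subrK (c *m A) n); move: (n - c *m A) => m.
move: (c *m A) => w o <-.
rewrite !dotE (dotC w) o; ring.
Qed.

Lemma angle_le_sin k l (A : 'M[R]_(k, d)) (B : 'M[R]_(l, d)) t :
  row_free B -> 0 <= t -> t < pi / 2 ->
  (forall n c, n *m A^T = 0 -> enorm n = 1 -> (n - c *m B) *m B^T = 0 ->
     enorm (c *m B) <= sin t) ->
  angle_le A B t.
Proof.
move=> fB t0 tpi h n nA n1; have [c hc] := orth_decomp n fB.
have hw := h n c nA n1 hc; have := orth_decomp_norm hc; rewrite n1 expr1n.
have o := dot_mulmx c hc.
have ct : 0 < cos t by rewrite cos_gt0_pihalf // tpi andbT; lra.
have nE : n = (n - c *m B) + c *m B by rewrite subrK.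
set m := n - c *m B in hc o nE *; set w := c *m B in hw o nE *.
have w2 : enorm w ^+ 2 <= sin t ^+ 2.
  by rewrite lerXn2r ?nnegrE ?norm_ge0 // (le_trans _ hw) // norm_ge0.
rewrite sin2cos2 in w2 => E.
have cm : cos t <= enorm m.
  rewrite -(@ler_pXn2r _ 2) ?nnegrE ?norm_ge0 ?(ltW ct) //.
  by move: E w2; clear; move: (_ ^+ 2) (_ ^+ 2) (_ ^+ 2) => *; lra.
have m0 : 0 < enorm m := lt_le_trans ct cm.
exists ((enorm m)^-1 *: m); split.
- by rewrite -scalemxAl hc scaler0.
- by rewrite normZ ger0_norm ?invr_ge0 ?norm_ge0 // mulVf // gt_eqF.
- apply: le_trans cm _; rewrite nE dotZr dotDl (dotC w) o addr0 -sqr_norm expr2.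
  by rewrite mulrA mulVf ?mul1r // gt_eqF.
Qed.

Lemma angle_le_sym k (A B : 'M[R]_(k, d)) t : row_free A -> row_free B ->
  0 <= t -> t < pi / 2 -> angle_le A B t -> angle_le B A t.
Proof.
move=> fA fB t0 tpi h.
have ct : 0 < cos t by rewrite cos_gt0_pihalf // tpi andbT; lra.
pose KA := row_base (kermx A^T); pose KB := row_base (kermx B^T).
have inA n : (n *m A^T == 0) = (n <= KA)%MS by rewrite eq_row_base sub_kermx.
have inB n : (n *m B^T == 0) = (n <= KB)%MS by rewrite eq_row_base sub_kermx.
have unit n : n *m A^T = 0 -> n != 0 -> exists m,
    [/\ m *m B^T = 0, enorm m = 1 & enorm n * cos t <= dot n m].
  move=> nA n0; have N0 := norm_gt0 n0.
  have [||m [mB m1 hm]] := h ((enorm n)^-1 *: n).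
  - by rewrite -scalemxAl nA scaler0.
  - by rewrite normZ ger0_norm ?invr_ge0 ?norm_ge0 // mulVf // gt_eqF.
  exists m; split=> //; move: hm; rewrite dotZl -(ler_pM2l N0) mulrA mulfV ?gt_eqF //.
  by rewrite mul1r.
have orthB w m : w *m KB^T = 0 -> m *m B^T = 0 -> dot w m = 0.
  by move=> hw /eqP; rewrite inB => /submxP[y ->]; rewrite dot_mulmx.
pose M := KA *m KB^T.
have fM : row_free M.
  apply: inj_row_free => x xM; have nA : x *m KA *m A^T = 0.
    by apply/eqP; rewrite inA submxMl.
  have [n0|n0] := eqVneq (x *m KA) 0.
    by apply/eqP; rewrite -(mulmx_free_eq0 _ (row_base_free _)); apply/eqP; exact: n0.
  have [m [mB m1 hm]] := unit _ nA n0; exfalso.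
  have : 0 < enorm (x *m KA) * cos t by rewrite mulr_gt0 // norm_gt0.
  rewrite ltNge (le_trans hm) // orthB //.
  by rewrite -mulmxA.
have uM : row_full M.
  have rk : \rank (kermx A^T) = \rank (kermx B^T).
    by rewrite !mxrank_ker !mxrank_tr (eqP fA) (eqP fB).
  by rewrite /row_full (eqP fM) rk.
move=> m mB m1; have /submxP[x hx] : (m *m KB^T <= M)%MS by exact: submx_full.
pose n := x *m KA.
have nA : n *m A^T = 0 by apply/eqP; rewrite inA submxMl.
have nm w : w *m B^T = 0 -> dot n w = dot m w.
  move=> wB; apply/eqP; rewrite -subr_eq0 -dotNl -dotDl; apply/eqP/orthB => //.
  by rewrite mulmxBl hx /n -mulmxA subrr.
have nm1 : dot n m = 1 by rewrite nm // -sqr_norm m1 expr1n.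
have n0 : n != 0 by apply/eqP => E; move: nm1; rewrite E dot0l => /eqP; rewrite eq_sym oner_eq0.
have N0 := norm_gt0 n0.
have [m' [mB' m1' hm]] := unit _ nA n0.
exists ((enorm n)^-1 *: n); split.
- by rewrite -scalemxAl nA scaler0.
- by rewrite normZ ger0_norm ?invr_ge0 ?norm_ge0 // mulVf // gt_eqF.
- rewrite dotZr (dotC m) nm1 mulr1 -[leRHS]mul1r ler_pdivlMr // mulrC.
  apply: le_trans hm _; rewrite nm //; have := cauchy_schwarz m m'.
  by rewrite m1 m1' mulr1.
Qed.

End Angles.

Section LocalTurn.
Variables (R : realType) (d k : nat) (S : set 'rV[R]_d).
Implicit Types (p q z n w : 'rV[R]_d) (A : 'M[R]_(k, d)).

Definition ball_bound (r : R) p n :=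
  forall z, S z -> 2 * r * dot (z - p) n <= enorm n * dot (z - p) (z - p).

Lemma sqr_normD_le a b (M e : R) : enorm (a : 'rV[R]_d) <= M -> enorm b <= e ->
  dot (a + b) (a + b) <= dot a a + 2 * M * e + e ^+ 2.
Proof.
move=> ha hb; have := cauchy_schwarz a b; have a0 := norm_ge0 a; have b0 := norm_ge0 b.
have : enorm a * enorm b <= M * e by rewrite ler_pM.
have : enorm b ^+ 2 <= e ^+ 2 by rewrite lerXn2r ?nnegrE ?(le_trans b0).
rewrite !dotE -!sqr_norm (dotC b a).
move: (enorm a ^+ 2) (enorm b ^+ 2) (dot a b) (enorm a * enorm b) (e ^+ 2) => *; lra.
Qed.

(* The tangential part w of n is tested against the chord z1 - z2, which is
   nearly parallel to w and has length D: adding the ball bounds at p and q for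
   both ends of the chord gives 2 r D |w| <= 2 D^2 up to higher order. *)
Lemma turn_estimate p q n w z1 z2 tq (r C D : R) :
  0 < r -> 0 < C -> D = edist q p -> 0 < D -> C * D <= 1 / 16 -> enorm n = 1 ->
  dot (n - w) w = 0 -> 0 < enorm w ->
  let a := (D / (2 * enorm w)) *: w in
  enorm (q - p - tq) <= C * D ^+ 2 ->
  enorm (z1 - p - (2^-1 *: tq + a)) <= 4 * C * D ^+ 2 ->
  enorm (z2 - p - (2^-1 *: tq - a)) <= 4 * C * D ^+ 2 ->
  2 * r * dot (z1 - q) n <= dot (z1 - q) (z1 - q) ->
  - (2 * r * dot (z2 - q) n) <= dot (z2 - q) (z2 - q) ->
  2 * r * dot (z2 - p) (n - w) <= dot (z2 - p) (z2 - p) ->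
  - (2 * r * dot (z1 - p) (n - w)) <= dot (z1 - p) (z1 - p) ->
  r * enorm w * (1 - 8 * (C * D)) <= D * (1 + 92 * (C * D)).
Proof.
move=> r0 C0 DE D0 CD n1 ow w0 a hq h1 h2 i1 i2 i3 i4.
have an : enorm a = D / 2.
  rewrite normZ gtr0_norm ?divr_gt0 ?mulr_gt0 //.
  by field; rewrite gt_eqF.
have aw : dot a w = D * enorm w / 2.
  by rewrite dotZl -sqr_norm; field; rewrite gt_eqF.
clearbody a.
set eq := q - p - tq in hq; set e1 := z1 - p - _ in h1; set e2 := z2 - p - _ in h2.
have z1p : z1 - p = (2^-1 *: tq + a) + e1 by rewrite /e1 [RHS]addrC subrK.
have z2p : z2 - p = (2^-1 *: tq - a) + e2 by rewrite /e2 [RHS]addrC subrK.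
have qp : q - p = tq + eq by rewrite /eq [RHS]addrC subrK.
clearbody e1 e2 eq.
have z1q : z1 - q = (a - 2^-1 *: tq) + (e1 - eq).
  have -> : z1 - q = (z1 - p) - (q - p) by rewrite opprB addrA subrK.
  by rewrite z1p qp; apply/rowP => i; rewrite !mxE; lra.
have z2q : z2 - q = - (2^-1 *: tq + a) + (e2 - eq).
  have -> : z2 - q = (z2 - p) - (q - p) by rewrite opprB addrA subrK.
  by rewrite z2p qp; apply/rowP => i; rewrite !mxE; lra.
have CD2 : C * D ^+ 2 <= D / 16.
  by have := ler_wpM2r (ltW D0) CD; rewrite expr2; clear; lra.
have tqn : enorm tq <= D + C * D ^+ 2.
  have -> : tq = (q - p) - eq by rewrite qp addrK.
  by apply: le_trans (normD _ _) _; rewrite normN -edistE -DE lerD2l.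
have b1 : enorm (2^-1 *: tq + a) <= 2 * D.
  apply: le_trans (normD _ _) _; rewrite an normZ gtr0_norm ?invr_gt0 //.
  by move: tqn CD2 D0; clear; move: (enorm tq) (C * _) => *; lra.
have b2 : enorm (2^-1 *: tq - a) <= 2 * D.
  apply: le_trans (normD _ _) _; rewrite normN an normZ gtr0_norm ?invr_gt0 //.
  by move: tqn CD2 D0; clear; move: (enorm tq) (C * _) => *; lra.
have f1 : enorm (e1 - eq) <= 5 * C * D ^+ 2.
  apply: le_trans (normD _ _) _; rewrite normN; move: h1 hq; clear.
  by move: (enorm _) (enorm _) => *; lra.
have f2 : enorm (e2 - eq) <= 5 * C * D ^+ 2.
  apply: le_trans (normD _ _) _; rewrite normN; move: h2 hq; clear.
  by move: (enorm _) (enorm _) => *; lra.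
have g1 : enorm e1 <= 5 * C * D ^+ 2.
  by apply: (le_trans h1); have := mulr_ge0 (ltW C0) (sqr_ge0 D); lra.
have g2 : enorm e2 <= 5 * C * D ^+ 2.
  by apply: (le_trans h2); have := mulr_ge0 (ltW C0) (sqr_ge0 D); lra.
have b1' : enorm (- (2^-1 *: tq + a)) <= 2 * D by rewrite normN.
have b2' : enorm (a - 2^-1 *: tq) <= 2 * D by rewrite -opprB normN.
have s1 := sqr_normD_le b2' f1; have s2 := sqr_normD_le b1' f2.
have s3 := sqr_normD_le b2 g2; have s4 := sqr_normD_le b1 g1.
rewrite -z1q in s1; rewrite -z2q in s2; rewrite -z2p in s3; rewrite -z1p in s4.
have sum_main : dot (a - 2^-1 *: tq) (a - 2^-1 *: tq)
    + dot (- (2^-1 *: tq + a)) (- (2^-1 *: tq + a))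
    + dot (2^-1 *: tq - a) (2^-1 *: tq - a) + dot (2^-1 *: tq + a) (2^-1 *: tq + a)
    = D ^+ 2 + enorm tq ^+ 2.
  have -> : D ^+ 2 = 4 * dot a a by rewrite -sqr_norm an; field.
  by rewrite !sqr_norm !dotE (dotC tq a); field.
have tq2 : enorm tq ^+ 2 <= (D + C * D ^+ 2) ^+ 2.
  by rewrite lerXn2r ?nnegrE ?norm_ge0 // (le_trans _ tqn) // norm_ge0.
have lhs : D * enorm w - 8 * C * D ^+ 2 * enorm w <= dot (z1 - p) w - dot (z2 - p) w.
  rewrite z1p z2p !(dotDl _ _ w) dotNl aw.
  have := cauchy_schwarzN e1 w; have := cauchy_schwarz e2 w.
  have := ler_wpM2r (ltW w0) h1; have := ler_wpM2r (ltW w0) h2; clear.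
  move: (dot e1 w) (dot e2 w) (dot _ w) (enorm e1) (enorm e2) (enorm w) => *; lra.
have E1 : dot (z1 - q) n - dot (z2 - q) n - (dot (z1 - p) (n - w) - dot (z2 - p) (n - w))
    = dot (z1 - p) w - dot (z2 - p) w.
  by rewrite !dotE; ring.
have x0 : 0 <= C * D by rewrite mulr_ge0 // ltW.
have x2 : (C * D) ^+ 2 <= C * D * (1 / 16) by rewrite expr2 ler_wpM2l.
have key : 2 * r * (dot (z1 - p) w - dot (z2 - p) w) <=
   2 * D ^+ 2 + D ^+ 2 * (184 * (C * D)).
  have : D ^+ 2 * (C * D) ^+ 2 <= D ^+ 2 * (C * D * (1 / 16)).
    by rewrite ler_wpM2l // sqr_ge0.
  have := mulr_ge0 (sqr_ge0 D) x0; move: sum_main s1 s2 s3 s4 i1 i2 i3 i4 tq2; rewrite -E1; clear.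
  move: (dot (z1 - q) n) (dot (z2 - q) n) (dot (z1 - p) (n - w)) (dot (z2 - p) (n - w)).
  move: (dot (z1 - q) (z1 - q)) (dot (z2 - q) (z2 - q)) (dot (z1 - p) (z1 - p)).
  move: (dot (z2 - p) (z2 - p)) (dot (a - 2^-1 *: tq) (a - 2^-1 *: tq)).
  move: (dot (- (2^-1 *: tq + a)) (- (2^-1 *: tq + a))) (enorm tq ^+ 2).
  move: (dot (2^-1 *: tq - a) (2^-1 *: tq - a)) (dot (2^-1 *: tq + a) (2^-1 *: tq + a)).
  move=> *; lra.
have h3 : 2 * r * (D * enorm w - 8 * C * D ^+ 2 * enorm w) <=
   2 * D ^+ 2 + D ^+ 2 * (184 * (C * D)).
  by apply: le_trans key; rewrite ler_pM2l // mulr_gt0.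
rewrite -(@ler_pM2l _ (2 * D)) ?mulr_gt0 //.
by move: h3; clear; move: (enorm w) => *; lra.
Qed.

End LocalTurn.

Section TurningOfNormals.
Variables (R : realType) (d k : nat) (S : set 'rV[R]_d).
Implicit Types (p q z n w : 'rV[R]_d) (A B : 'M[R]_(k, d)).

Definition ball_bounded (r : R) p := forall n, pnormal S p n -> ball_bound S r p n.

Lemma local_turn p A (r ka : R) : tangent_matrix S p A -> 0 < r ->
  ball_bounded r p -> 1 < ka * r ->
  exists2 dl : R, 0 < dl & forall q B, S q -> 0 < edist q p -> edist q p <= dl ->
    tangent_matrix S q B -> ball_bounded r q ->
    angle_le B A (ka * edist q p) /\ angle_le A B (ka * edist q p).
Proof.
move=> tA r0 bp kr; have [fA [C [dl [C0 dl0 chart1 chart2]]] _] := tA.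
have ka0 : 0 < ka by rewrite -(pmulr_lgt0 _ r0) (lt_trans _ kr).
pose mu := (ka * r - 1) / 2.
have mu0 : 0 < mu by rewrite divr_gt0 // subr_gt0.
pose k1 := (1 + mu) / r.
have k10 : 0 < k1 by rewrite divr_gt0 // addr_gt0.
have k1r : r * k1 = 1 + mu by rewrite /k1; field; rewrite gt_eqF.
have k1k : k1 / ka < 1.
  by rewrite ltr_pdivrMr // mul1r /k1 ltr_pdivrMr // /mu; clear -kr; lra.
have [dl2 dl20 hsin] := sin_ge_scale k1k.
have den : 0 < C * (100 + 8 * mu) by rewrite mulr_gt0 // addr_gt0 // mulr_gt0.
clearbody mu k1.
pose dl' := Num.min (Num.min (Num.min (dl / 2) (1 / 16 / C)) (mu / (C * (100 + 8 * mu))))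
  (Num.min (dl2 / ka) (1 / 2 / ka)).
have d0 : 0 < dl' by rewrite !lt_min !divr_gt0.
exists dl' => // q B Sq D0 Ddl tB bq.
move DE : (edist q p) D0 Ddl => D D0.
rewrite !le_min -!andbA => /and5P[Ddl D1 D2 D3 D4].
have CD1 : C * D <= 1 / 16 by rewrite mulrC -ler_pdivlMr.
have CD2 : C * D * (100 + 8 * mu) <= mu by rewrite mulrAC mulrC -ler_pdivlMr.
have kD : ka * D <= 1 / 2 by rewrite mulrC -ler_pdivlMr.
have kDpi : ka * D < pi / 2 by have := @pihalf_ge1 R; clear -kD; lra.
have kD0 : 0 <= ka * D by rewrite mulr_ge0 // ltW.
have kD2 : 0 <= ka * D <= dl2 by rewrite kD0 /= mulrC -ler_pdivlMr.
have fB : row_free B by case: tB.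
have Dsin : k1 * D <= sin (ka * D).
  by have := hsin _ kD2; rewrite mulrA divfK // gt_eqF.
suff hBA : angle_le B A (ka * D) by split=> //; exact: angle_le_sym.
apply: angle_le_sin => // n c nB n1 hc; apply: le_trans Dsin.
set w := c *m A in hc *.
have [->|w0] := eqVneq w 0; first by rewrite norm0 mulr_ge0 // ltW.
have {}w0 := norm_gt0 w0.
have Dq : edist q p <= dl by rewrite DE; clear -Ddl dl0; lra.
have [c1 hq] := chart2 q Sq Dq; rewrite DE in hq.
set tq := c1 *m A in hq.
pose a := (D / (2 * enorm w)) *: w.
have an : enorm a = D / 2.
  rewrite normZ gtr0_norm ?divr_gt0 ?mulr_gt0 //.
  by field; rewrite gt_eqF.
have tqn : enorm tq <= D + C * D ^+ 2.
  have -> : tq = (q - p) - (q - p - tq) by rewrite subKr.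
  by apply: le_trans (normD _ _) _; rewrite normN -edistE DE lerD2l.
have CDD : C * D ^+ 2 <= D / 16.
  by have := ler_wpM2r (ltW D0) CD1; rewrite expr2; clear; lra.
have half : enorm (2^-1 *: tq) <= D.
  rewrite normZ gtr0_norm ?invr_gt0 //; move: tqn CDD D0; clear.
  by move: (enorm tq) (C * _) => *; lra.
have t1n : enorm (2^-1 *: tq + a) <= 2 * D.
  apply: le_trans (normD _ _) _; rewrite an; move: half D0; clear.
  by move: (enorm _) => *; lra.
have t2n : enorm (2^-1 *: tq - a) <= 2 * D.
  apply: le_trans (normD _ _) _; rewrite normN an; move: half D0; clear.
  by move: (enorm _) => *; lra.
have chart t (c' : 'rV_k) : t = c' *m A -> enorm t <= 2 * D ->
    exists2 z, S z & enorm (z - p - t) <= 4 * C * D ^+ 2.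
  move=> -> tn; have [|z Sz hz] := chart1 c'.
    by apply: le_trans tn _; clear -Ddl; lra.
  exists z => //; apply: le_trans hz _.
  have -> : 4 * C * D ^+ 2 = C * (2 * D) ^+ 2 by ring.
  by rewrite ler_wpM2l ?(ltW C0) // lerXn2r ?nnegrE ?norm_ge0 // mulr_ge0 // ltW.
have [|z1 Sz1 h1] := chart _ (2^-1 *: c1 + (D / (2 * enorm w)) *: c) _ t1n.
  by rewrite mulmxDl -!scalemxAl.
have [|z2 Sz2 h2] := chart _ (2^-1 *: c1 - (D / (2 * enorm w)) *: c) _ t2n.
  by rewrite mulmxBl -!scalemxAl.
have n0n : enorm (n - w) <= 1.
  rewrite -(@ler_pXn2r _ 2) ?nnegrE ?norm_ge0 // expr1n.
  have := orth_decomp_norm hc; rewrite -/w n1 expr1n => ->.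
  by rewrite lerDr sqr_ge0.
have pn m : m *m B^T = 0 -> pnormal S q m by move=> /(pnormal_matrix m tB).
have pp m : m *m A^T = 0 -> pnormal S p m by move=> /(pnormal_matrix m tA).
have i1 := bq n (pn n nB) z1 Sz1.
have i2 : ball_bound S r q (- n) by apply/bq/pn; rewrite mulNmx nB oppr0.
have {}i2 := i2 z2 Sz2.
have i3 := bp (n - w) (pp _ hc) z2 Sz2.
have i4 : ball_bound S r p (- (n - w)) by apply/bp/pp; rewrite mulNmx hc oppr0.
have {}i4 := i4 z1 Sz1.
rewrite n1 mul1r in i1; rewrite normN n1 mul1r dotNr mulrN in i2.
rewrite normN dotNr mulrN in i4.
have ow : dot (n - w) w = 0 by exact: dot_mulmx.
have le1 x : 0 <= x -> enorm (n - w) * x <= x by move=> x0; rewrite ler_piMl.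
have := turn_estimate r0 C0 (esym DE) D0 CD1 n1 ow w0 hq h1 h2 i1 i2
  (le_trans i3 (le1 _ (dot_ge0 _))) (le_trans i4 (le1 _ (dot_ge0 _))).
move=> h; rewrite -(ler_pM2l r0) mulrA k1r.
have x1 : 0 < 1 - 8 * (C * D) by clear -CD1; lra.
rewrite -(ler_pM2r x1); apply: le_trans h _.
rewrite mulrAC [leRHS]mulrC ler_wpM2l // ?(ltW D0) //.
by move: CD2; clear; move: (C * D) => x; lra.
Qed.

Lemma real_induction (P : R -> Prop) : P 0 ->
  (forall t, 0 <= t <= 1 -> exists2 dl : R, 0 < dl &
    (forall s, 0 <= s -> s < t -> t - s < dl -> P s -> P t) /\
    (forall s, s <= 1 -> t < s -> s - t < dl -> P t -> P s)) -> P 1.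
Proof.
move=> P0 step; pose E := [set t : R | 0 <= t <= 1 /\ P t].
have E0 : E 0 by split=> //; rewrite lexx ler01.
have supE : has_sup E.
  by split; [exists 0|exists 1 => t [/andP[_ ? ] _]].
have T01 : 0 <= sup E <= 1.
  rewrite sup_upper_bound //=; apply: ge_sup; first by exists 0.
  by move=> t [/andP[]].
have [dl dl0 [hl hr]] := step _ T01.
have PT : P (sup E).
  have [s [/andP[s0 s1] Ps] ls] := sup_adherent dl0 supE.
  have sT : s <= sup E by apply: sup_upper_bound => //; split=> //; rewrite s0 s1.
  move: sT; rewrite le_eqVlt => /predU1P[<-//|sT].
  by apply: (hl s) => //; rewrite ltrBlDr addrC -ltrBlDr.
case/andP: T01 => T0; rewrite le_eqVlt => /predU1P[<-//|T1].
pose s := Num.min (sup E + dl / 2) 1.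
have s1 : s <= 1 by rewrite ge_min lexx orbT.
have sT : sup E < s by rewrite lt_min T1 ltrDl divr_gt0.
have sd : s - sup E < dl.
  have : s <= sup E + dl / 2 by rewrite ge_min lexx.
  by clear -dl0; lra.
have : s <= sup E.
  apply: sup_upper_bound => //; split; last exact: hr.
  by rewrite s1 (le_trans T0 (ltW sT)).
by rewrite leNgt sT.
Qed.

End TurningOfNormals.

Section NormalVariation.
Variables (R : realType) (d k : nat) (S : set 'rV[R]_d) (u : 'rV[R]_d) (L s : R).
Hypotheses (cS : compact S) (Su : S u) (mfd : smooth_submanifold k S).
Hypothesis uniq_nearest : forall z q q',
  edist z u < L -> closest S z q -> closest S z q' -> q = q'.
Hypotheses (s0 : 0 < s) (sL : 3 * s <= L).
Implicit Types (p q z n w : 'rV[R]_d) (A B : 'M[R]_(k, d)).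

Let S0 : S !=set0. Proof. by exists u. Qed.

Let L0 : 0 < L.
Proof. by apply: lt_le_trans sL; rewrite mulr_gt0. Qed.

Lemma pnormalN p n : S p -> pnormal S p n -> pnormal S p (- n).
Proof.
move=> Sp; have [A tA] := local_chart mfd Sp.
by move=> /(pnormal_matrix n tA) h; apply/(pnormal_matrix _ tA); rewrite mulNmx h oppr0.
Qed.

Definition reach : R := (L ^+ 2 - s ^+ 2) / L.

Lemma reach_ge : 8 / 3 * s <= reach.
Proof.
rewrite /reach ler_pdivlMr //; move: s L s0 sL => x y x0 xy.
have y0 : 0 < y by lra.
have : 3 * x * y <= y * y by rewrite ler_pM2r.
have : 3 * x * x <= x * y by rewrite mulrAC [leRHS]mulrC ler_pM2r.
by rewrite !expr2; lra.
Qed.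

Lemma reach_gt0 : 0 < reach.
Proof. by apply: lt_le_trans reach_ge; rewrite mulr_gt0 // divr_gt0. Qed.

Lemma reachM : L * reach = L ^+ 2 - s ^+ 2.
Proof. by rewrite /reach mulrCA divff ?mulr1 // gt_eqF. Qed.

Lemma ball_bounded_reach p : S p -> edist p u <= s -> ball_bounded S reach p.
Proof.
move=> Sp pu n pn z Sz.
have pL : edist p u < L.
  by apply: le_lt_trans pu _; move: s L s0 sL => x y; lra.
have := tangent_ball cS Su uniq_nearest pnormalN Sp pn pL Sz.
have N0 := norm_ge0 n; have Z0 := dot_ge0 (z - p).
have [d0|d0] := leP (dot (z - p) n) 0.
  move=> _; apply: (@le_trans _ _ 0); last by rewrite mulr_ge0.
  by rewrite mulr_ge0_le0 // mulr_ge0 // ltW // reach_gt0.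
move=> h; rewrite -(ler_pM2l L0).
have -> : L * (2 * reach * dot (z - p) n) = 2 * (L ^+ 2 - s ^+ 2) * dot (z - p) n.
  by rewrite -reachM; ring.
apply: le_trans (_ : _ <= L * enorm n * dot (z - p) (z - p)) _; last by rewrite mulrA.
apply: le_trans h; rewrite ler_pM2r // ler_pM2l // lerD2l lerN2.
by rewrite lerXn2r ?nnegrE ?dist_ge0 // ltW.
Qed.

Lemma closest_lipschitz z1 z2 y1 y2 (h : R) : closest S z1 y1 -> closest S z2 y2 ->
  edist y1 u <= s -> edist y2 u <= s -> edist z1 y1 <= h -> edist z2 y2 <= h ->
  (reach - h) * edist y1 y2 <= reach * edist z1 z2.
Proof.
move=> c1 c2 y1u y2u h1 h2.
have := ball_bounded_reach c1.1 y1u (closest_pnormal c1) c2.1.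
have := ball_bounded_reach c2.1 y2u (closest_pnormal c2) c1.1.
rewrite -!edistE -!sqr_dist (distC y2 y1).
have D0 := dist_ge0 y1 y2.
have b1 := ler_wpM2r (sqr_ge0 (edist y1 y2)) h1.
have b2 := ler_wpM2r (sqr_ge0 (edist y1 y2)) h2.
move=> /le_trans /(_ b2) i2 /le_trans /(_ b1) i1.
have r0 := reach_gt0.
have cs : dot (y2 - y1) (z2 - z1) <= edist y1 y2 * edist z1 z2.
  by rewrite (distC y1) (distC z1) !edistE; exact: cauchy_schwarz.
have E : edist y1 y2 ^+ 2 = dot (y2 - y1) (z1 - y1) + dot (y1 - y2) (z2 - y2)
     + dot (y2 - y1) (z2 - z1).
  by rewrite (distC y1) sqr_dist !dotE; ring.
have [->|Dn] := eqVneq (edist y1 y2) 0.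
  by rewrite mulr0 mulr_ge0 ?dist_ge0 // ltW.
have Dp : 0 < edist y1 y2 by rewrite lt_def Dn.
rewrite -(ler_pM2r Dp).
have := ler_wpM2l (ltW r0) cs; have : reach * edist y1 y2 ^+ 2 = reach * edist y1 y2 ^+ 2 by [].
rewrite {2}E; move: i1 i2.
move: (dot (y2 - y1) (z1 - y1)) (dot (y1 - y2) (z2 - y2)) (dot (y2 - y1) (z2 - z1)).
move: (edist y1 y2) (edist z1 z2) reach => *; lra.
Qed.

Lemma closest_self q : S q -> proj S q = q.
Proof.
move=> Sq; apply/esym/dist_eq0/le_anti; rewrite dist_ge0 andbT.
by have := setdist_le cS S0 q Sq; rewrite distxx.
Qed.

Section Path.
Variables p q : 'rV[R]_d.
Hypotheses (Sp : S p) (Sq : S q) (pu : edist p u <= s) (qu : edist q u <= s).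
Hypothesis pqs : edist p q <= s.

Let z t := p + t *: (q - p).
Let g t := proj S (z t).

Lemma path_closest t : closest S (z t) (g t).
Proof. exact: proj_nearest cS S0 (z t). Qed.

Lemma path_bounds t : 0 <= t <= 1 ->
  edist (g t) u <= s /\ edist (z t) (g t) <= s ^+ 2 / (4 * reach).
Proof.
move=> /andP[t0 t1].
have ct : z t = (1 - t) *: p + t *: q + 0 *: q.
  by rewrite /z scalerBr scalerBl scale1r scale0r addr0 addrA addrAC.
have w0 : 0 <= 1 - t by rewrite subr_ge0.
have w1 : 1 - t + t + 0 = 1 by rewrite addr0 subrK.
have [gu hQ hh] := nearest_hull cS Su uniq_nearest pnormalN Sp Sq Sq pu qu qu s0 sL
  w0 t0 (lexx 0) w1 ct (path_closest t).
split=> //; move: hQ hh; rewrite mul0r addr0; set Q := _ + _ => hQ hh.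
have r0 := reach_gt0.
have rs := reach_ge.
have EQ : Q = t * (1 - t) * edist p q ^+ 2 + edist (z t) (g t) ^+ 2.
  rewrite /Q !sqr_dist.
  have -> : p - g t = (z t - g t) - t *: (q - p) by rewrite /z; apply/rowP => i; rewrite !mxE; ring.
  have -> : q - g t = (z t - g t) + (1 - t) *: (q - p).
    by rewrite /z; apply/rowP => i; rewrite !mxE; ring.
  have -> : p - q = - (q - p) by rewrite opprB.
  move: (z t - g t) (q - p) => a b; rewrite !dotE (dotC b a); ring.
clearbody Q; have h1 : 2 * reach * edist (z t) (g t) <= Q.
  rewrite -(ler_pM2l L0); apply: le_trans hh.
  by rewrite -reachM; have := dist_ge0 (z t) (g t); move: (edist _ _) reach L => *; lra.
have pq2 : t * (1 - t) * edist p q ^+ 2 <= s ^+ 2 / 4.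
  have h : edist p q ^+ 2 <= s ^+ 2 by rewrite lerXn2r ?nnegrE ?dist_ge0 // ltW.
  have h2 : t * (1 - t) <= 1 / 4.
    by have := sqr_ge0 (t - 1 / 2); rewrite expr2; move: t {ct w1 t0 t1 w0 gu EQ h1 hh hQ Q} => x; lra.
  apply: le_trans (ler_wpM2l _ h) _; first by rewrite mulr_ge0.
  by apply: le_trans (ler_wpM2r (sqr_ge0 s) h2) _; rewrite mul1r mulrC.
have H0 := dist_ge0 (z t) (g t).
have r4 : 0 < 4 * reach by apply: mulr_gt0.
rewrite ler_pdivlMr //.
have hr : edist (z t) (g t) <= reach.
  rewrite -(ler_pM2l r0).
  have : s ^+ 2 <= reach * reach.
    have sr : s <= reach by apply: le_trans rs; rewrite ler_peMl ?(ltW s0) //; lra.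
    by rewrite expr2; apply: ler_pM; rewrite ?(ltW s0).
  have := mulr_ge0 (ltW r0) H0; move: h1 hQ.
  by move: (edist (z t) (g t)) reach (s ^+ 2) => *; lra.
have : edist (z t) (g t) ^+ 2 <= reach * edist (z t) (g t) by rewrite expr2 ler_wpM2r.
move: h1; rewrite EQ; move: pq2.
by move: (s ^+ 2) (t * _ * _) (edist (z t) (g t)) reach => *; lra.
Qed.

Definition path_speed : R := reach / (reach - s ^+ 2 / (4 * reach)).

Lemma path_speed_den : 0 < reach - s ^+ 2 / (4 * reach).
Proof.
have r0 := reach_gt0; have rs := reach_ge.
have r4 : 0 < 4 * reach by apply: mulr_gt0.
rewrite subr_gt0 ltr_pdivrMr //.
have sr : s <= reach by apply: le_trans rs; rewrite ler_peMl ?(ltW s0) //; lra.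
have : s ^+ 2 <= reach ^+ 2 by rewrite lerXn2r ?nnegrE ?(ltW s0) ?(ltW r0).
have : 0 < reach ^+ 2 by rewrite exprn_gt0.
by rewrite !expr2; move: reach => *; lra.
Qed.

Lemma path_speed_gt0 : 0 < path_speed.
Proof. by rewrite divr_gt0 ?reach_gt0 // path_speed_den. Qed.

Lemma path_lipschitz t1 t2 : 0 <= t1 <= 1 -> 0 <= t2 <= 1 ->
  edist (g t1) (g t2) <= path_speed * (`|t1 - t2| * edist p q).
Proof.
move=> h1 h2; have [gu1 b1] := path_bounds h1; have [gu2 b2] := path_bounds h2.
have := closest_lipschitz (path_closest t1) (path_closest t2) gu1 gu2 b1 b2.
rewrite (_ : edist (z t1) (z t2) = `|t1 - t2| * edist p q); last first.
  rewrite (distC p) !edistE -normZ; congr enorm.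
  by rewrite /z; apply/rowP => i; rewrite !mxE; ring.
have D0 := path_speed_den.
by move=> h; rewrite /path_speed [leRHS]mulrAC ler_pdivlMr // mulrC.
Qed.

Lemma normal_variation A B (ka : R) : tangent_matrix S p A -> tangent_matrix S q B ->
  1 < ka * reach -> ka * path_speed * edist p q <= pi ->
  angle_le A B (ka * path_speed * edist p q).
Proof.
move=> tA tB kr kpi.
have r0 := reach_gt0; have K0 := path_speed_gt0.
have ka0 : 0 < ka by rewrite -(pmulr_lgt0 _ r0) (lt_trans _ kr).
set M := ka * path_speed * edist p q in kpi *.
have M0 : 0 <= M by rewrite mulr_ge0 ?dist_ge0 // ltW // mulr_gt0.
have g0 : g 0 = p by rewrite /g /z scale0r addr0 closest_self.
have g1 : g 1 = q by rewrite /g /z scale1r addrC subrK closest_self.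
suff key : forall B', tangent_matrix S (g 1) B' -> angle_le A B' (1 * M).
  by rewrite -[M]mul1r; apply: key; rewrite g1.
apply: (@real_induction _ (fun t => forall B', tangent_matrix S (g t) B' ->
   angle_le A B' (t * M))).
  move=> B' tB' n nA n1; rewrite mul0r cos0; exists n; split=> //.
    by apply/(pnormal_matrix n tB'); rewrite g0; apply/(pnormal_matrix n tA).
  by rewrite -sqr_norm n1 expr1n.
move=> t ht; have [C tC] := local_chart mfd (path_closest t).1.
have [gu _] := path_bounds ht.
have bt := ball_bounded_reach (path_closest t).1 gu.
have [dl dl0 turn] := local_turn tC r0 bt kr.
have c0 : 0 < path_speed * edist p q + 1.
  by rewrite ltr_wpDl // mulr_ge0 ?dist_ge0 // ltW.
exists (dl / (path_speed * edist p q + 1)); first by rewrite divr_gt0.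
have step s' B' : 0 <= s' <= 1 -> `|s' - t| < dl / (path_speed * edist p q + 1) ->
    tangent_matrix S (g s') B' ->
    exists2 a, 0 <= a <= `|s' - t| * M & angle_le B' C a /\ angle_le C B' a.
  move=> hs; rewrite ltr_pdivlMr // => lt tB'.
  have lip := path_lipschitz hs ht.
  have [E|ne] := eqVneq (edist (g s') (g t)) 0.
    have {}E := dist_eq0 E.
    exists 0; first by rewrite lexx mulr_ge0.
    have same A1 A2 : tangent_matrix S (g t) A1 -> tangent_matrix S (g t) A2 ->
        angle_le A1 A2 0.
      move=> t1 t2 n n1 nn; exists n; split=> //; last by rewrite cos0 -sqr_norm nn expr1n.
      by apply/(pnormal_matrix n t2)/(pnormal_matrix n t1).
    by rewrite E in tB'; split; exact: same.
  have D0 : 0 < edist (g s') (g t) by rewrite lt_def ne dist_ge0.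
  have Ddl : edist (g s') (g t) <= dl.
    apply: le_trans lip _; apply: le_trans (ltW lt); rewrite mulrCA ler_wpM2l //.
    by rewrite lerDl.
  have [gsu _] := path_bounds hs.
  exists (ka * edist (g s') (g t)).
    rewrite mulr_ge0 ?dist_ge0 ?(ltW ka0) //=.
    have -> : `|s' - t| * M = ka * (path_speed * (`|s' - t| * edist p q)).
      by rewrite /M; ring.
    by rewrite ler_pM2l.
  exact: turn (path_closest s').1 D0 Ddl tB' (ball_bounded_reach (path_closest s').1 gsu).
have add a b : 0 <= a <= 1 -> 0 <= b -> a + b <= 1 -> (a + b) * M <= pi.
  move=> /andP[a0 _] b0 ab; apply: le_trans kpi.
  by rewrite ler_piMl // addr_ge0.
case/andP: (ht) => t0 t1.
split=> s' hs' st sd IH B' tB'.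
- have hs : 0 <= s' <= 1 by rewrite hs' (le_trans (ltW st)).
  have [C' tC'] := local_chart mfd (path_closest s').1.
  have [|a /andP[a0 ha] [hB hC]] := step s' C' hs _ tC'.
    by rewrite distrC gtr0_norm // subr_gt0.
  have -> : t * M = s' * M + (t - s') * M by rewrite -mulrDl addrC subrK.
  rewrite distrC gtr0_norm ?subr_gt0 // in ha.
  have tM : s' * M + (t - s') * M <= pi.
    by rewrite -mulrDl; apply: add; rewrite ?subr_ge0 ?(ltW st) // addrC subrK.
  have hCB : angle_le C' B' a.
    move=> n nC n1; have [m [mC m1 c]] := hB n nC n1.
    exists m; split=> //; apply/(pnormal_matrix m tB').
    by apply/(pnormal_matrix m tC).
  have M1 : 0 <= s' * M := mulr_ge0 hs' M0.
  apply: (angle_le_mono (a := s' * M + a) _ _ tM); [exact: addr_ge0|by rewrite lerD2l|].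
  apply: (angle_le_trans M1 a0 _ (IH C' tC') hCB).
  by apply: le_trans tM; rewrite lerD2l.
- have hs : 0 <= s' <= 1 by rewrite hs' andbT (le_trans t0 (ltW st)).
  have [|a /andP[a0 ha] [hB hC]] := step s' B' hs _ tB'.
    by rewrite gtr0_norm // subr_gt0.
  have -> : s' * M = t * M + (s' - t) * M by rewrite -mulrDl addrC subrK.
  rewrite gtr0_norm ?subr_gt0 // in ha.
  have tM : t * M + (s' - t) * M <= pi.
    by rewrite -mulrDl; apply: add; rewrite ?subr_ge0 ?(ltW st) // addrC subrK.
  have M1 : 0 <= t * M := mulr_ge0 t0 M0.
  apply: (angle_le_mono (a := t * M + a) _ _ tM); [exact: addr_ge0|by rewrite lerD2l|].
  apply: (angle_le_trans M1 a0 _ (IH C tC) hC).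
  by apply: le_trans tM; rewrite lerD2l.
Qed.

End Path.
End NormalVariation.

Section TriangleNormal.
Variables (R : realType) (d : nat).
Implicit Types (a b c n u w : 'rV[R]_d).

Definition triangle_mx a b c : 'M[R]_(1 + 1, d) := col_mx (b - a) (c - a).

Lemma triangle_mxP a b c n : n *m (triangle_mx a b c)^T = 0 <->
  dot n (b - a) = 0 /\ dot n (c - a) = 0.
Proof.
have E w : n *m w^T = 0 <-> dot n w = 0.
  split=> [h|h].
    by have := dot_mulmx 1%:M h; rewrite mul1mx.
  by apply/rowP => j; rewrite dot_row mxE (ord1 j) -h; congr dot; apply/rowP => i; rewrite mxE.
rewrite /triangle_mx tr_col_mx mul_mx_row; split.
  by rewrite -row_mx0 => /eq_row_mx[/E ? /E ?].
by move=> [/E -> /E ->]; rewrite row_mx0.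
Qed.

Lemma triangle_free a b c (x y : R) : is_triangle a b c ->
  x *: (b - a) + y *: (c - a) = 0 -> x = 0 /\ y = 0.
Proof.
move=> /freeP h E; pose k (i : 'I_2) := if i == ord0 then x else y.
have hk := h k; split.
  apply: (hk _ ord0); by rewrite big_ord_recl big_ord1 /= /k /=.
apply: (hk _ ord_max); by rewrite big_ord_recl big_ord1 /= /k /=.
Qed.

Lemma triangle_mx_free a b c : is_triangle a b c -> row_free (triangle_mx a b c).
Proof.
move=> h; apply: inj_row_free => x.
rewrite -[x]hsubmxK /triangle_mx mul_row_col.
rewrite (mx11_scalar (lsubmx x)) (mx11_scalar (rsubmx x)) !mul_scalar_mx.
by move=> /(triangle_free h)[-> ->]; rewrite !raddf0 row_mx0.
Qed.

Lemma triangle_perm a b c : is_triangle a b c ->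
  is_triangle b a c /\ is_triangle a c b.
Proof.
move=> h; split; apply/freeP => k; rewrite big_ord_recl big_ord1 /= => E.
- have [|h1 h2] := @triangle_free a b c (- k ord0 - k (lift ord0 ord0)) (k (lift ord0 ord0)) h.
    by rewrite -[RHS]E; apply/rowP => i; rewrite !mxE; ring.
  have h3 : k ord0 = 0 by move: h1; rewrite h2 subr0 => /eqP; rewrite oppr_eq0 => /eqP.
  by move=> i; case: (unliftP ord0 i) => [j|] ->; rewrite ?(ord1 j).
- have [|h1 h2] := @triangle_free a b c (k (lift ord0 ord0)) (k ord0) h.
    by rewrite addrC.
  by move=> i; case: (unliftP ord0 i) => [j|] ->; rewrite ?(ord1 j).
Qed.

Definition vertex_cos a b c := dot (b - a) (c - a) / (edist b a * edist c a).

Lemma triangle_dist_gt0 a b c : is_triangle a b c -> 0 < edist b a /\ 0 < edist c a.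
Proof.
move=> h; rewrite !edistE; split; apply: norm_gt0; apply/eqP => E.
  have [|/eqP] := @triangle_free a b c 1 0 h; last by rewrite oner_eq0.
  by rewrite E scaler0 scale0r addr0.
have [|_ /eqP] := @triangle_free a b c 0 1 h; last by rewrite oner_eq0.
by rewrite E scaler0 scale0r addr0.
Qed.

(* The Gram determinant of e, f and U is nonnegative. *)
Lemma gram_le (e f U : 'rV[R]_d) (t : R) : dot e e = 1 -> dot f f = 1 -> dot e f = t ->
  t ^+ 2 < 1 ->
  dot U e ^+ 2 + dot U f ^+ 2 - 2 * t * (dot U e * dot U f) <= dot U U * (1 - t ^+ 2).
Proof.
move=> ee ff ef t1.
have := dot_ge0 ((1 - t ^+ 2) *: U - (dot U e - t * dot U f) *: e - (dot U f - t * dot U e) *: f).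
rewrite !dotE ee ff (dotC f e) ef (dotC e U) (dotC f U).
have T : 0 < 1 - t ^+ 2 by rewrite subr_gt0.
move=> h; rewrite -(ler_pM2l T); move: h.
by move: (dot U e) (dot U f) (dot U U) => x y z; clear; lra.
Qed.

Lemma gram_eq (e f w : 'rV[R]_d) (t x y : R) : dot e e = 1 -> dot f f = 1 ->
  dot e f = t -> w = x *: e + y *: f ->
  dot w w * (1 - t ^+ 2) = dot w e ^+ 2 + dot w f ^+ 2 - 2 * t * (dot w e * dot w f).
Proof.
by move=> ee ff ef ->; rewrite !dotE (dotC f e) ee ff ef; ring.
Qed.

Lemma triangle_cos2 a b c : is_triangle a b c -> vertex_cos a b c ^+ 2 < 1.
Proof.
move=> h; have [l1 l2] := triangle_dist_gt0 h.
rewrite /vertex_cos expr_div_n ltr_pdivrMr ?exprn_gt0 ?mulr_gt0 // mul1r exprMn !sqr_dist.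
have D0 : 0 < dot (b - a) (b - a) by rewrite -sqr_dist exprn_gt0.
have : 0 < dot (dot (b - a) (b - a) *: (c - a) - dot (b - a) (c - a) *: (b - a))
   (dot (b - a) (b - a) *: (c - a) - dot (b - a) (c - a) *: (b - a)).
  rewrite lt_def dot_ge0 andbT; apply/eqP => /dot_eq0 E.
  have [|_ E2] := @triangle_free a b c (- dot (b - a) (c - a)) (dot (b - a) (b - a)) h.
    by rewrite -[RHS]E scaleNr addrC.
  by rewrite E2 ltxx in D0.
move: (b - a) (c - a) D0 => e f; rewrite !dotE (dotC f e).
move: (dot e e) (dot e f) (dot f f) => x y z x0 hh.
by rewrite -(ltr_pM2l x0); move: hh; rewrite !expr2; clear; lra.
Qed.

Lemma parallelogram_bound (l1 l2 t s r ka x y W : R) : 0 < l1 -> 0 < l2 ->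
  0 < s -> 0 < r -> 1 <= ka -> t ^+ 2 < 1 ->
  (l1 / 2) ^+ 2 + (l2 / 2) ^+ 2 - 2 * t * (l1 / 2 * (l2 / 2)) <= s ^+ 2 * (1 - t ^+ 2) ->
  `|2 * r * x| <= l1 -> `|2 * r * y| <= l2 ->
  W * (1 - t ^+ 2) = x ^+ 2 + y ^+ 2 - 2 * t * (x * y) ->
  1 + t <= ka ^+ 2 * (1 - t) -> r ^+ 2 * W <= s ^+ 2 * ka ^+ 2.
Proof.
move=> l10 l20 s0 r0 ka1 t2 H hx hy HW hka.
have [t1 t1'] : -1 < t /\ t < 1.
  by move: t2; rewrite -(real_normK (num_real t)) expr_lt1 // ltr_norml => /andP[].
have X2 : (2 * r * x) ^+ 2 <= l1 ^+ 2.
  by rewrite -[leLHS]real_normK ?num_real // lerXn2r ?nnegrE ?(ltW l10).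
have Y2 : (2 * r * y) ^+ 2 <= l2 ^+ 2.
  by rewrite -[leLHS]real_normK ?num_real // lerXn2r ?nnegrE ?(ltW l20).
have XY : `|(2 * r * x) * (2 * r * y)| <= l1 * l2 by rewrite normrM ler_pM.
have E : 4 * (r ^+ 2 * W * (1 - t ^+ 2)) =
    (2 * r * x) ^+ 2 + (2 * r * y) ^+ 2 - 2 * (t * ((2 * r * x) * (2 * r * y))).
  have -> : r ^+ 2 * W * (1 - t ^+ 2) = r ^+ 2 * (W * (1 - t ^+ 2)) by ring.
  rewrite HW; ring.
have T : - (`|t| * (l1 * l2)) <= t * ((2 * r * x) * (2 * r * y)).
  rewrite lerNl (le_trans (ler_norm _)) // normrN normrM ler_wpM2l //.
have B : 4 * (r ^+ 2 * W * (1 - t ^+ 2)) <= l1 ^+ 2 + l2 ^+ 2 + 2 * (`|t| * (l1 * l2)).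
  by rewrite E; move: X2 Y2 T; clear; move: (_ ^+ 2) (_ ^+ 2) (t * _) => *; lra.
have ka2 : 1 <= ka ^+ 2 by rewrite expr_ge1 // (le_trans ler01).
have s2 : 0 < s ^+ 2 by rewrite exprn_gt0.
have L : 0 < l1 * l2 by rewrite mulr_gt0.
have p1 : 0 < 1 + t by clear -t1; lra.
have p2 : 0 < 1 - t by rewrite subr_gt0.
have p : 0 < 1 - t ^+ 2 by rewrite subr_gt0.
have H' : l1 ^+ 2 + l2 ^+ 2 - 2 * (t * (l1 * l2)) <= 4 * (s ^+ 2 * (1 - t ^+ 2)).
  by move: H; clear; move: (s ^+ 2 * _) => A H; lra.
have [tn|tp] := ltP t 0.
  apply: (@le_trans _ _ (s ^+ 2)); last by rewrite ler_peMr // ltW.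
  rewrite -(ler_pM2r p); rewrite ltr0_norm // in B; move: B H'; clear.
  by move: (r ^+ 2 * W * _) (s ^+ 2 * _) => *; lra.
rewrite ger0_norm // in B.
have A1 : l1 * l2 <= 2 * (s ^+ 2 * (1 + t)).
  rewrite -(ler_pM2r p2).
  have := sqr_ge0 (l1 - l2); move: H'; clear; lra.
have A2 : t * (l1 * l2) <= t * (2 * (s ^+ 2 * (1 + t))) by rewrite ler_wpM2l.
have A3 : r ^+ 2 * W * (1 - t) <= s ^+ 2 * (1 + t).
  rewrite -(ler_pM2r p1); move: A2 B H'; clear; lra.
rewrite -(ler_pM2r p2); apply: (le_trans A3).
by rewrite -[leRHS]mulrA ler_pM2l.
Qed.

(* As u need not lie in the plane of the triangle, s is only an upper bound for
   the circumradius. *)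
Lemma triangle_normal_bound a b c u n w (s r ka : R) :
  is_triangle a b c -> 0 < s -> 0 < r -> 1 <= ka ->
  edist a u = s -> edist b u = s -> edist c u = s ->
  1 + vertex_cos a b c <= ka ^+ 2 * (1 - vertex_cos a b c) ->
  `|2 * r * dot (b - a) n| <= edist b a ^+ 2 ->
  `|2 * r * dot (c - a) n| <= edist c a ^+ 2 ->
  dot (n - w) (b - a) = 0 -> dot (n - w) (c - a) = 0 ->
  (exists x y : R, w = x *: (b - a) + y *: (c - a)) ->
  enorm w <= s / r * ka.
Proof.
move=> tri s0 r0 ka1 au bu cu hka hb hc nb nc [x [y wE]].
have [l1_0 l2_0] := triangle_dist_gt0 tri; have t2 := triangle_cos2 tri.
set t := vertex_cos a b c in hka t2 *.
set l1 := edist b a in hb l1_0 *; set l2 := edist c a in hc l2_0 *.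
pose e := l1^-1 *: (b - a); pose f := l2^-1 *: (c - a).
have ee : dot e e = 1.
  by rewrite !dotZl !dotZr -sqr_dist -/l1; field; rewrite gt_eqF.
have ff : dot f f = 1.
  by rewrite !dotZl !dotZr -sqr_dist -/l2; field; rewrite gt_eqF.
have ef : dot e f = t.
  rewrite !dotZl !dotZr /t /vertex_cos -/l1 -/l2; field.
  by rewrite !gt_eqF.
have circ (z : 'rV[R]_d) (l : R) : l = edist z a -> edist z u = s -> 0 < l ->
    dot (u - a) (l^-1 *: (z - a)) = l / 2.
  move=> lE zu l0; rewrite dotZr.
  have : dot (u - a) (z - a) = l ^+ 2 / 2.
    have : edist z u ^+ 2 = l ^+ 2 - 2 * dot (u - a) (z - a) + edist a u ^+ 2.
      rewrite lE (distC a u) !sqr_dist.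
      have -> : z - u = (z - a) - (u - a) by rewrite opprB addrA subrK.
      by move: (z - a) (u - a) => p q; rewrite !dotE (dotC p q); ring.
    by rewrite zu au; clear; lra.
  by move=> ->; field; rewrite gt_eqF.
have G := gram_le (u - a) ee ff ef t2.
rewrite (circ b l1) // (circ c l2) // -sqr_dist distC au in G.
have ne : dot n e = dot w e.
  by rewrite !dotZr; congr (_ * _); apply/eqP; rewrite -subr_eq0 -dotNl -dotDl nb.
have nf : dot n f = dot w f.
  by rewrite !dotZr; congr (_ * _); apply/eqP; rewrite -subr_eq0 -dotNl -dotDl nc.
have W : dot w w * (1 - t ^+ 2) = dot n e ^+ 2 + dot n f ^+ 2 - 2 * t * (dot n e * dot n f).
  rewrite ne nf; apply: (gram_eq (x := x * l1) (y := y * l2)) => //.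
  by rewrite !scalerA -!mulrA !mulfV ?mulr1 ?gt_eqF.
have bound (z : 'rV[R]_d) (l : R) : l = edist z a -> 0 < l -> `|2 * r * dot (z - a) n| <= l ^+ 2 ->
    `|2 * r * dot n (l^-1 *: (z - a))| <= l.
  move=> lE l0; rewrite dotZr (dotC n).
  have -> : 2 * r * (l^-1 * dot (z - a) n) = l^-1 * (2 * r * dot (z - a) n) by ring.
  rewrite [in X in _ -> X]normrM [in X in _ -> X]ger0_norm ?invr_ge0 ?(ltW l0) //.
  by rewrite ler_pdivrMl // expr2.
have ge := bound b l1 erefl l1_0 hb; have gf := bound c l2 erefl l2_0 hc.
have := parallelogram_bound l1_0 l2_0 s0 r0 ka1 t2 G ge gf W hka.
rewrite -sqr_norm -!exprMn => h.
rewrite mulrAC ler_pdivlMr // mulrC.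
rewrite -(@ler_pXn2r _ 2) ?nnegrE // mulr_ge0 ?norm_ge0 ?(ltW r0) ?(ltW s0) //.
by rewrite (le_trans ler01).
Qed.

End TriangleNormal.

Section Flats.
Variables (R : realType) (d : nat).
Implicit Types (p q n : 'rV[R]_d).

Lemma flat_dimE (F : set 'rV[R]_d) m : is_flat F m -> flat_dim F = m.
Proof.
move=> hF; have [p [V [<- FV]]] := hF.
have [p' [V' [<- FV']]] : is_flat F (flat_dim F).
  exact: (@xgetPex _ 0%N [set n | is_flat F n] (ex_intro _ m hF)).
suff : V =i V' by move=> /vspaceP ->.
move=> w; have pF : F p by rewrite FV /= subrr mem0v.
have pp : p - p' \in V' by move: pF; rewrite FV'.
have E : [set q | q - p \in V] (p + w) = [set q | q - p' \in V'] (p + w).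
  by rewrite -FV -FV'.
rewrite /= addrAC subrr add0r addrAC in E.
by rewrite -(rpredDl w pp) /=; apply/idP/idP; rewrite E.
Qed.

Definition orth_flat k (A : 'M[R]_(k, d)) p : set 'rV[R]_d :=
  [set q | (q - p) *m A^T = 0].

Lemma orth_flat_dim k (A : 'M[R]_(k, d)) p : row_free A ->
  flat_dim (orth_flat A p) = (d - k)%N.
Proof.
move=> fA; apply: flat_dimE; exists p, (lker (linfun (mulmxr A^T : 'rV_d -> 'rV_k))).
split; last first.
  apply/seteqP; split=> q /=; first by move=> h; rewrite memv_ker lfunE /= h.
  by rewrite memv_ker lfunE => /eqP.
have := limg_ker_dim (linfun (mulmxr A^T : 'rV_d -> 'rV_k)) fullv.
rewrite capfv (_ : limg _ = fullv); last first.
  apply/vspaceP => y; rewrite memvf; apply/memv_imgP.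
  have /submxP[x ->] : (y <= A^T)%MS.
    by apply: submx_full; rewrite /row_full mxrank_tr.
  by exists x; rewrite ?memvf // lfunE.
rewrite !dimvf !dim_matrix !mul1r => E.
by rewrite -[X in (X - _)%N]E addnK.
Qed.

Lemma eucl_norm_enorm (a : 'rV[R]_d) : eucl_norm a = enorm a.
Proof. by rewrite enorm.unlock. Qed.

Lemma line_angle_arg (l m : 'rV[R]_d * 'rV[R]_d) :
  0 <= `|dotp l.2 m.2| / (eucl_norm l.2 * eucl_norm m.2) <= 1.
Proof.
rewrite dotp_dot !eucl_norm_enorm divr_ge0 ?mulr_ge0 ?norm_ge0 //=.
have [E|E] := eqVneq (enorm l.2 * enorm m.2) 0.
  by rewrite E invr0 mulr0 ler01.
have E0 : 0 < enorm l.2 * enorm m.2 by rewrite lt_def E mulr_ge0 ?norm_ge0.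
rewrite ler_pdivrMr // mul1r ler_norml cauchy_schwarz andbT.
exact: cauchy_schwarzN.
Qed.

Lemma line_angle_ge0 (l m : 'rV[R]_d * 'rV[R]_d) : 0 <= line_angle l m.
Proof.
have /andP[h0 h1] := line_angle_arg l m.
by apply: acos_ge0; rewrite h1 andbT (le_trans _ h0) // lerN10.
Qed.

Lemma line_angle_le_cos (l m : 'rV[R]_d * 'rV[R]_d) (t : R) : 0 <= t <= pi ->
  cos t <= `|dotp l.2 m.2| / (eucl_norm l.2 * eucl_norm m.2) -> line_angle l m <= t.
Proof.
move=> /andP[t0 tpi] h; have /andP[h0 h1] := line_angle_arg l m.
have hx : -1 <= `|dotp l.2 m.2| / (eucl_norm l.2 * eucl_norm m.2) <= 1.
  by rewrite h1 andbT (le_trans _ h0) // lerN10.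
rewrite leNgt; apply/negP => lt.
have : cos (line_angle l m) < cos t.
  by rewrite ltr_cos // in_itv /= ?t0 ?tpi // acos_ge0 // acos_lepi.
by rewrite /line_angle acosK ?in_itv //= ltNge h.
Qed.

Lemma line_angle_le_pihalf (l m : 'rV[R]_d * 'rV[R]_d) : line_angle l m <= pi / 2.
Proof.
apply: line_angle_le_cos.
  by have := @pi_ge0 R => ?; apply/andP; split; lra.
by rewrite cos_pihalf; case/andP: (line_angle_arg l m).
Qed.

Lemma maxmin_angle_le (F G : set 'rV[R]_d) (t : R) : 0 <= t ->
  (forall l, lines_in F l -> lines_in G = set0 \/
     exists2 m, lines_in G m & line_angle l m <= t) ->
  maxmin_angle F G <= t.
Proof.
move=> t0 h; rewrite /maxmin_angle; set E := (X in sup X).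
have [E0|/set0P/negP/negPn/eqP ->] := pselect (E !=set0); last by rewrite sup0.
apply: ge_sup => // _ [l Fl <-].
have [->|[m Gm hm]] := h l Fl; first by rewrite image_set0 inf0.
apply: le_trans hm; apply: ge_inf; last by exists m.
by exists 0 => _ [m' _ <-]; exact: line_angle_ge0.
Qed.

Lemma maxmin_angle_pihalf (F G : set 'rV[R]_d) : maxmin_angle F G <= pi / 2.
Proof.
apply: maxmin_angle_le => [|l _]; first by rewrite divr_ge0 // pi_ge0.
have [[m Gm]|/set0P/negP/negPn/eqP ->] := pselect (lines_in G !=set0); last by left.
by right; exists m => //; exact: line_angle_le_pihalf.
Qed.

Lemma maxmin_angle_orth k l (A : 'M[R]_(k, d)) (B : 'M[R]_(l, d)) p q (t : R) :
  0 <= t <= pi -> angle_le A B t ->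
  maxmin_angle (orth_flat A p) (orth_flat B q) <= t.
Proof.
move=> ht h; apply: maxmin_angle_le => [|[b a] [/= a0 la]]; first by case/andP: ht.
right; have aA : a *m A^T = 0.
  have := la 1; have := la 0; rewrite /orth_flat /= scale0r scale1r addr0 => h0.
  by rewrite addrAC mulmxDl h0 add0r.
have N0 := norm_gt0 a0.
have [||m [mB m1 c]] := h ((enorm a)^-1 *: a).
- by rewrite -scalemxAl aA scaler0.
- by rewrite normZ ger0_norm ?invr_ge0 ?norm_ge0 // mulVf // gt_eqF.
exists (q, m).
  split=> /=; first by apply/eqP => E; move: m1; rewrite E norm0 => /eqP; rewrite eq_sym oner_eq0.
  by move=> s; rewrite /orth_flat /= addrAC subrr add0r -scalemxAl mB scaler0.
apply: line_angle_le_cos => //; rewrite dotp_dot !eucl_norm_enorm /= m1 mulr1.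
apply: le_trans c _; rewrite dotZl mulrC ler_wpM2r ?invr_ge0 ?norm_ge0 //.
exact: ler_norm.
Qed.

Lemma flat_angle_le k l (A : 'M[R]_(k, d)) (B : 'M[R]_(l, d)) p q (t : R) :
  row_free A -> row_free B -> (k <= l <= d)%N -> 0 <= t <= pi -> angle_le B A t ->
  flat_angle (orth_flat A p) (orth_flat B q) <= t.
Proof.
move=> fA fB /andP[kl ld] ht h; rewrite /flat_angle !orth_flat_dim //.
case: ifP => [le|_]; last exact: maxmin_angle_orth.
have [tp|tp] := ltP t (pi / 2); last exact: le_trans (maxmin_angle_pihalf _ _) tp.
have kE : k = l.
  apply/eqP; rewrite eqn_leq kl /=.
  by move: le; rewrite leq_subLR -{1}(subnKC ld) leq_add2r.
case: l / kE B fB kl ld h le => B fB _ _ h _.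
apply: maxmin_angle_orth => //; apply: angle_le_sym => //.
by case/andP: ht.
Qed.

End Flats.

Section AngleFunctions.
Variable R : realType.
Implicit Types x y t : R.

Lemma acos_ge x t : -1 <= x <= 1 -> 0 <= t <= pi -> x <= cos t -> t <= acos x.
Proof.
move=> hx /andP[t0 tpi] h; rewrite leNgt; apply/negP => lt.
have : cos t < cos (acos x).
  by rewrite ltr_cos // in_itv /= ?t0 ?tpi // acos_ge0 // acos_lepi.
by rewrite acosK ?in_itv //= ltNge h.
Qed.

Lemma asin_diff x y : -1 <= x -> x <= y -> y <= 1 -> y - x <= asin y - asin x.
Proof.
move=> x1 xy y1.
have hx : -1 <= x <= 1 by rewrite x1 (le_trans xy).
have hy : -1 <= y <= 1 by rewrite y1 (le_trans x1).
have mono : asin x <= asin y.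
  rewrite leNgt; apply/negP => lt.
  have : sin (asin y) < sin (asin x).
    by rewrite ltr_sin // in_itv /= asin_geNpi2 // asin_lepi2.
  by rewrite !asinK ?in_itv //= ltNge xy.
have [|c _] := @MVT_segment R sin cos (asin x) (asin y) mono.
  by apply: continuous_subspaceT => z; exact: continuous_sin.
rewrite !asinK ?in_itv //= => ->.
by rewrite ler_piMl ?subr_ge0 // cos_le1.
Qed.

Lemma asin_ge0 x : 0 <= x -> x <= 1 -> 0 <= asin x.
Proof.
move=> x0 x1; have h : -1 <= (0 : R) by rewrite lerN10.
have := asin_diff h x0 x1.
have -> : asin (0 : R) = 0.
  rewrite -[X in asin X]sin0 sinK // in_itv /=.
  by have := @pi_ge0 R => ?; apply/andP; split; lra.
by rewrite !subr0; apply: le_trans.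
Qed.

Lemma eta_ge c (x : R) : 0 <= x -> x <= 1 / 2 -> x <= eta c x.
Proof.
move=> x0 x12.
have x2 : x ^+ 2 <= 1 / 4 by have := ler_pM x0 x0 x12 x12; rewrite expr2; lra.
have x20 := sqr_ge0 x.
pose w := Num.sqrt (1 - x ^+ 2).
have w2 : w ^+ 2 = 1 - x ^+ 2 by rewrite sqr_sqrtr; lra.
have w0 : 0 <= w := sqrtr_ge0 _.
have w1 : w <= 1.
  by rewrite -(@ler_pXn2r _ 2) ?nnegrE // expr1n w2; lra.
have wh : 1 / 2 <= w.
  rewrite -(@ler_pXn2r _ 2) ?nnegrE // w2.
  by rewrite expr2; lra.
have w00 : 0 < w by lra.
have q1 : x ^+ 2 <= x ^+ 2 / w by rewrite ler_pdivlMr // ler_piMr.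
have q2 : x ^+ 2 / w <= 1 / 2.
  by rewrite ler_pdivrMr //; lra.
have xpi : 0 <= x <= pi.
  by have := @pi_ge2 R => ?; apply/andP; split; lra.
rewrite /eta; case: ifP => _.
  rewrite /eta1 -/w; have -> : x ^+ 2 / (2 * w) = x ^+ 2 / w / 2 by field; rewrite gt_eqF.
  apply: acos_ge => //; first by apply/andP; split; lra.
  by apply: le_trans (cos_ge_quad x0); lra.
rewrite /eta2 -/w; apply: acos_ge => //.
  apply/andP; split; first by have := sqrtr_ge0 (1 - x ^+ 2 / w); lra.
  by rewrite -[leRHS]sqrtr1 ler_wsqrtr //; lra.
have c0 : 0 <= cos x.
  by apply: le_trans (cos_ge_quad x0); lra.
rewrite -(ger0_norm c0) -sqrtr_sqr ler_wsqrtr // cos2sin2.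
have := sin_le_id x0; have : 0 <= sin x by apply: sin_ge0_pi.
move=> s0 s1; have : sin x ^+ 2 <= x ^+ 2 by rewrite lerXn2r ?nnegrE.
lra.
Qed.

Lemma cot_half t : 0 < t <= pi / 2 ->
  1 <= cot (t / 2) /\ 1 + cos t = cot (t / 2) ^+ 2 * (1 - cos t).
Proof.
move=> /andP[t0 tpi]; have p0 := @pi_gt0 R; set h := t / 2.
have tE : t = h *+ 2 by rewrite mulr2n /h; lra.
have s0 : 0 < sin h by apply: sin_gt0_pihalf; rewrite /h; apply/andP; split; lra.
have c0 : 0 <= cos h by apply: cos_ge0_pihalf; rewrite /h; apply/andP; split; lra.
have ct : 0 <= cos t by apply: cos_ge0_pihalf; apply/andP; split; lra.
have E : cos t = cos h ^+ 2 *+ 2 - 1 by rewrite tE cos_mulr2n.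
have cs := cos2Dsin2 h; split.
  rewrite /cot ler_pdivlMr // mul1r -(@ler_pXn2r _ 2) ?nnegrE ?(ltW s0) //.
  by move: ct; rewrite E mulr2n; move: cs; move: (_ ^+ 2) (_ ^+ 2) => *; lra.
rewrite /cot E mulr2n; have -> : 1 - (cos h ^+ 2 + cos h ^+ 2 - 1) = 2 * sin h ^+ 2.
  by move: cs; move: (_ ^+ 2) (_ ^+ 2) => *; lra.
by field; rewrite gt_eqF.
Qed.

Lemma cos_pihalfB t : cos (pi / 2 - t) = sin t.
Proof. by rewrite cosB cos_pihalf sin_pihalf mul0r mul1r add0r. Qed.

End AngleFunctions.

Section VertexChoice.
Variables (R : realType) (d : nat).
Implicit Types a b c : 'rV[R]_d.

Lemma apex_ineq (l1 l2 t : R) : 0 <= l1 -> l1 <= l2 -> t <= 1 -> -1 <= t ->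
  l2 * t <= l1 ->
  2 * (l1 - l2 * t) ^+ 2 <= (1 - t) * (l1 ^+ 2 + l2 ^+ 2 - 2 * (l1 * l2 * t)).
Proof.
move=> l10 l12 t1 tN h.
have : 0 <= (1 + t) * ((l2 - l1) * (l1 + l2 - 2 * (l2 * t))).
  apply: mulr_ge0; first by lra.
  apply: mulr_ge0; first by lra.
  have : l2 * t <= l2 by rewrite ler_piMr // (le_trans l10).
  lra.
rewrite !expr2; lra.
Qed.

(* The angle opposite to the longer of the two sides at a is at least
   90 - phi/2 degrees, and sin (phi / 2) is the cosine of that. *)
Lemma vertex_cos_other a b c (phi : R) : is_triangle a b c ->
  edist b a <= edist c a -> cos phi <= vertex_cos a b c -> 0 <= sin (phi / 2) ->
  vertex_cos b a c <= sin (phi / 2).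
Proof.
move=> tri l12 hc sg0.
have [l10 l20] := triangle_dist_gt0 tri; have t2 := triangle_cos2 tri.
have [l10' m0] := triangle_dist_gt0 (triangle_perm tri).1.
have cE : cos phi = 1 - 2 * sin (phi / 2) ^+ 2.
  rewrite {1}(_ : phi = (phi / 2) *+ 2); last by rewrite mulr2n; lra.
  by rewrite cos_mulr2n cos2sin2 mulr2n; ring.
have dE : dot (b - a) (c - a) = vertex_cos a b c * (edist b a * edist c a).
  by rewrite /vertex_cos divfK // mulf_neq0 ?gt_eqF.
move: (vertex_cos a b c) t2 hc dE => t t2 hc dE.
have [tN t1] : -1 < t /\ t < 1.
  by move: t2; rewrite -(real_normK (num_real t)) expr_lt1 // ltr_norml => /andP[].
have num : dot (a - b) (c - b) = edist b a * (edist b a - edist c a * t).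
  have -> : dot (a - b) (c - b) = edist b a ^+ 2 - dot (b - a) (c - a).
    rewrite sqr_dist -(opprB b a).
    have -> : c - b = (c - a) - (b - a) by rewrite opprB addrA subrK.
    by move: (b - a) (c - a) => e f; rewrite !dotE; ring.
  by rewrite dE; ring.
have mE : edist c b ^+ 2 = edist b a ^+ 2 + edist c a ^+ 2 - 2 * (edist b a * edist c a * t).
  rewrite !sqr_dist; have -> : c - b = (c - a) - (b - a) by rewrite opprB addrA subrK.
  move: dE; move: (b - a) (c - a) => e f dE; rewrite !dotE (dotC f e) dE; ring.
rewrite /vertex_cos num (distC a b) ler_pdivrMr ?mulr_gt0 //.
rewrite mulrCA ler_pM2l //.
have [le|lt] := leP (edist b a - edist c a * t) 0.
  by apply: le_trans le _; rewrite mulr_ge0 // ltW.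
rewrite -(@ler_pXn2r _ 2) ?nnegrE ?(ltW lt) ?mulr_ge0 ?(ltW m0) //.
rewrite exprMn mE.
have h : edist c a * t <= edist b a by rewrite -subr_ge0 ltW.
have := apex_ineq (ltW l10) l12 (ltW t1) (ltW tN) h; rewrite -mE.
have : (1 - t) * edist c b ^+ 2 <= 2 * sin (phi / 2) ^+ 2 * edist c b ^+ 2.
  by rewrite ler_wpM2r ?sqr_ge0 //; rewrite cE in hc; lra.
by move: (_ ^+ 2) (edist c b ^+ 2) (sin (phi / 2) ^+ 2) => *; lra.
Qed.

End VertexChoice.

Section Constants.
Variable R : realType.

Lemma speed_bound (e q : R) : 0 < e -> e <= 1 / 3 -> q = e / (1 - e ^+ 2) ->
  1 < (1 + e / 2 - e ^+ 2) * (1 - q ^+ 2 / 4).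
Proof.
move=> e0 e1 qE.
have e2 : e ^+ 2 <= 1 / 9 by have := ler_pM (ltW e0) (ltW e0) e1 e1; rewrite expr2; lra.
have e20 : 0 < e ^+ 2 by rewrite exprn_gt0.
have q0 : 0 < q by rewrite qE divr_gt0 //; lra.
have q1 : q <= 9 / 8 * e.
  rewrite qE ler_pdivrMr; last by lra.
  have : e * e ^+ 2 <= e * (1 / 9) by rewrite ler_pM2l.
  lra.
have q2 : q ^+ 2 <= 81 / 64 * e ^+ 2.
  have := ler_pM (ltW q0) (ltW q0) q1 q1; rewrite !expr2; lra.
have ee : e ^+ 2 <= e / 3 by rewrite expr2; have := ler_pM (ltW e0) (ltW e0) (lexx e) e1; lra.
have T : 0 <= 1 + e / 2 - e ^+ 2 <= 17 / 16.
  by have := sqr_ge0 (e - 1 / 4); rewrite !expr2 => ?; apply/andP; split; rewrite expr2 in e2; lra.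
case/andP: T => T0 T1.
have := ler_pM T0 (sqr_ge0 q) T1 q2.
lra.
Qed.

End Constants.

Section Comparison.
Variables (R : realType) (d k : nat) (S : set 'rV[R]_d) (u : 'rV[R]_d) (s eps : R).
Hypotheses (cS : compact S) (Su : S u) (mfd : smooth_submanifold k S).
Hypotheses (s0 : 0 < s) (e0 : 0 < eps) (e1 : eps <= 1 / 3).
Hypothesis uniq_nearest : forall z q q',
  edist z u < s / eps -> closest S z q -> closest S z q' -> q = q'.
Implicit Types (p q z n w a b c : 'rV[R]_d) (A B : 'M[R]_(k, d)).

(* The quotient of s by the radius reach (s / eps) s of the tangent balls. *)
Definition ratio : R := eps / (1 - eps ^+ 2).

(* The largest factor for which bound_far holds; it exceeds path_speed. *)
Definition speed : R := 1 + eps / 2 - eps ^+ 2.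

Let r := reach (s / eps) s.

Let sL : 3 * s <= s / eps.
Proof. by rewrite ler_pdivlMr // mulrAC ler_piMl ?(ltW s0) //; move: eps e1 => e h; lra. Qed.

Let e2 : 0 < 1 - eps ^+ 2.
Proof.
have : eps * eps <= 1 / 3 * eps by rewrite ler_pM2r.
by rewrite expr2; move: eps e0 e1 => e h1 h2 h3; lra.
Qed.

Let r0 : 0 < r. Proof. exact: reach_gt0 s0 sL. Qed.

Lemma ratio_reach : s / r = ratio.
Proof.
rewrite /r /reach /ratio; field.
have e20 := lt0r_neq0 e2; have s20 : s ^+ 2 + - s ^+ 2 * eps ^+ 2 != 0.
  by rewrite mulNr -{1}[s ^+ 2]mulr1 -mulrBr mulf_neq0 // expf_neq0 // gt_eqF.
by rewrite e20 (gt_eqF s0) (gt_eqF e0) s20.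
Qed.

Lemma ratio_gt0 : 0 < ratio.
Proof. by rewrite divr_gt0. Qed.

Lemma speed_ratio : speed * ratio <= 2 / 5.
Proof.
have q1 : ratio <= 3 / 8.
  rewrite ler_pdivrMr //; move: eps e0 e1 => e h0 h1.
  by have := ler_pM (ltW h0) (ltW h0) h1 h1; rewrite expr2; lra.
have T1 : speed <= 17 / 16.
  by have := sqr_ge0 (eps - 1 / 4); rewrite /speed !expr2; move: eps => e; lra.
have T0 : 0 <= speed.
  by move: e0 e2; rewrite /speed; move: eps (eps ^+ 2) => x y h1 h2; lra.
by have := ler_pM T0 (ltW ratio_gt0) T1 q1; move: (speed * ratio) => x; lra.
Qed.

Lemma speed_ratio_ge0 : 0 <= speed * ratio.
Proof.
rewrite mulr_ge0 ?(ltW ratio_gt0) //.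
by move: e0 e2; rewrite /speed; move: eps (eps ^+ 2) => x y h1 h2; lra.
Qed.

Lemma leg p q A B : S p -> S q -> edist p u <= s -> edist q u <= s -> edist p q <= s ->
  tangent_matrix S p A -> tangent_matrix S q B -> angle_le A B (speed * ratio).
Proof.
move=> Sp Sq pu qu pq tA tB.
have K0 := path_speed_gt0 s0 sL.
set K := path_speed (s / eps) s in K0.
have T0 : 0 < speed.
  by move: e0 e2; rewrite /speed; move: eps (eps ^+ 2) => x y h1 h2; lra.
have TK : K < speed.
  have := speed_bound e0 e1 (erefl ratio); rewrite -/speed.
  have -> : 1 - ratio ^+ 2 / 4 = K^-1.
    rewrite -ratio_reach /K /path_speed -/r; field.
    have := path_speed_den s0 sL; rewrite -/r => den.
    have r4 : 4 * r * r - s ^+ 2 != 0.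
      apply: lt0r_neq0.
      have -> : 4 * r * r - s ^+ 2 = 4 * r * (r - s ^+ 2 / (4 * r)).
        by field; rewrite gt_eqF.
      by apply: mulr_gt0 => //; apply: mulr_gt0.
    by rewrite gt_eqF //= mulrC.
  by rewrite ltr_pdivlMr // mul1r.
pose ka := speed / (K * r).
have ka0 : 0 <= ka by rewrite divr_ge0 ?(ltW T0) ?(ltW (mulr_gt0 K0 r0)).
have kr : 1 < ka * r.
  have -> : ka * r = speed / K by rewrite /ka; field; rewrite !gt_eqF.
  by rewrite ltr_pdivlMr // mul1r.
have ks : ka * K * edist p q <= speed * ratio.
  have -> : speed * ratio = ka * K * s.
    by rewrite -ratio_reach /ka; field; rewrite !gt_eqF.
  by rewrite ler_wpM2l // mulr_ge0 ?(ltW K0).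
have p2 := @pi_ge2 R; have sr := speed_ratio.
have kpi : ka * K * edist p q <= pi by apply: le_trans ks _; apply: le_trans sr _; move: p2 => ?; lra.
have h := normal_variation cS Su mfd uniq_nearest s0 sL Sp Sq pu qu pq tA tB kr kpi.
apply: angle_le_mono ks _ h; last by apply: le_trans sr _; move: p2 => ?; lra.
by rewrite mulr_ge0 ?dist_ge0 // mulr_ge0 ?(ltW K0).
Qed.

Lemma vertex_angle a b c A (ka : R) : is_triangle a b c -> S a -> S b -> S c ->
  edist a u = s -> edist b u = s -> edist c u = s -> tangent_matrix S a A ->
  1 <= ka -> 1 + vertex_cos a b c <= ka ^+ 2 * (1 - vertex_cos a b c) ->
  ratio * ka < 1 -> angle_le A (triangle_mx a b c) (asin (ratio * ka)).
Proof.
move=> tri Sa Sb Sc au bu cu tA ka1 hka lt1.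
have q0 := ratio_gt0.
have x0 : 0 <= ratio * ka by rewrite mulr_ge0 ?(ltW q0) // (le_trans ler01).
have N1 : -1 <= ratio * ka by rewrite (le_trans _ x0) // lerN10.
apply: angle_le_sin.
- exact: triangle_mx_free.
- by rewrite asin_ge0 // ltW.
- by apply: asin_ltpi2; rewrite N1 lt1.
move=> n y nA n1 nw; rewrite asinK; last by rewrite in_itv /= N1 ltW.
have au' : edist a u <= s by rewrite au.
have bb := ball_bounded_reach cS Su mfd uniq_nearest s0 sL Sa au'.
have pn : pnormal S a n by apply/(pnormal_matrix n tA).
have pn' : pnormal S a (- n) by apply/(pnormal_matrix (- n) tA); rewrite mulNmx nA oppr0.
have bnd z : S z -> `|2 * r * dot (z - a) n| <= edist z a ^+ 2.
  move=> Sz; have := bb _ pn z Sz; have := bb _ pn' z Sz.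
  rewrite normN n1 !mul1r dotNr mulrN sqr_dist ler_norml -/r => h1 h2.
  by rewrite h2 andbT lerNl.
have /triangle_mxP[nb nc] := nw.
rewrite -ratio_reach; apply: (triangle_normal_bound tri s0 r0 ka1 au bu cu hka (bnd _ Sb) (bnd _ Sc) nb nc).
rewrite -[y]hsubmxK /triangle_mx mul_row_col.
rewrite (mx11_scalar (lsubmx y)) (mx11_scalar (rsubmx y)) !mul_scalar_mx.
by do 2 eexists.
Qed.

Lemma triangle_mxP_eq a b c n : n *m (triangle_mx a b c)^T = 0 <->
  dot n a = dot n b /\ dot n a = dot n c.
Proof.
have E w : dot n (w - a) = 0 <-> dot n a = dot n w.
  rewrite dotDr dotNr; split; first by move/eqP; rewrite subr_eq0 => /eqP.
  by move=> ->; rewrite subrr.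
rewrite triangle_mxP; split=> -[h1 h2]; split; exact/E.
Qed.

Lemma angle_le_triangle l (A : 'M[R]_(l, d)) a b c a' b' c' (t : R) :
  (forall n, dot n a = dot n b /\ dot n a = dot n c ->
     dot n a' = dot n b' /\ dot n a' = dot n c') ->
  angle_le A (triangle_mx a b c) t -> angle_le A (triangle_mx a' b' c') t.
Proof.
move=> h hA n nA n1; have [m [/triangle_mxP_eq mB m1 c1]] := hA n nA n1.
by exists m; split=> //; apply/triangle_mxP_eq/h.
Qed.

Section Cases.
Variables (xt : 'rV[R]_d) (X : 'M[R]_(k, d)) (phi : R).
Hypotheses (Sx : S xt) (tX : tangent_matrix S xt X) (xu : edist xt u <= s).
Hypothesis phiP : 0 < phi <= pi / 3.

Let k1 := cot (phi / 2).
Let k2 := cot (pi / 4 - phi / 4).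

Hypotheses (k1_lt : ratio * k1 < 1) (k2_lt : ratio * k2 < 1).

Let p0 : 0 < pi :> R. Proof. exact: pi_gt0. Qed.

Let k1P : 1 <= k1 /\ 1 + cos phi = k1 ^+ 2 * (1 - cos phi).
Proof.
apply: cot_half; case/andP: phiP => h1 h2; rewrite h1 /=.
by move: phi pi p0 h2 => x y *; lra.
Qed.

Let k2P : 1 <= k2 /\ 1 + sin (phi / 2) = k2 ^+ 2 * (1 - sin (phi / 2)).
Proof.
have h : 0 < pi / 2 - phi / 2 <= pi / 2.
  by case/andP: phiP; move: phi pi p0 => x y ? ? ?; apply/andP; split; lra.
have := cot_half h; rewrite cos_pihalfB.
by have -> : (pi / 2 - phi / 2) / 2 = pi / 4 - phi / 4 by field.
Qed.

Let legs_pi : speed * ratio + speed * ratio + asin (ratio * k2) <= pi /\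
  speed * ratio + asin (ratio * k1) <= pi.
Proof.
have h1 := speed_ratio; have h2 := @pihalf_ge1 R; have q0 := speed_ratio_ge0.
have b (x : R) : 1 <= x -> ratio * x < 1 -> asin (ratio * x) <= pi / 2.
  move=> x1 x2; apply: asin_lepi2; rewrite (ltW x2) andbT.
  by rewrite (le_trans (lerN10 _)) // mulr_ge0 ?(ltW ratio_gt0) // (le_trans ler01).
have := b _ k1P.1 k1_lt; have := b _ k2P.1 k2_lt.
move: (asin _) (asin _) (speed * ratio) h1 h2 q0 => x y z *; split; lra.
Qed.

Definition theta1 := speed * ratio + asin (ratio * k1).
Definition theta2 := speed * ratio + speed * ratio + asin (ratio * k2).

Let asin_k (x : R) : 1 <= x -> ratio * x < 1 -> 0 <= asin (ratio * x).
Proof.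
move=> x1 x2; apply: asin_ge0; last exact: ltW.
by rewrite mulr_ge0 ?(ltW ratio_gt0) // (le_trans ler01).
Qed.

Lemma theta_bounds : 0 <= theta1 <= pi /\ 0 <= theta2 <= pi.
Proof.
have [h2 h1] := legs_pi; have q0 := speed_ratio_ge0.
split; rewrite ?h1 ?h2 andbT !addr_ge0 //; apply: asin_k => //.
  by case: k1P.
by case: k2P.
Qed.

Lemma near_vertex a b c : is_triangle a b c -> S a -> S b -> S c ->
  edist a u = s -> edist b u = s -> edist c u = s -> edist a xt <= s ->
  angle_le X (triangle_mx a b c) theta1 \/ angle_le X (triangle_mx a b c) theta2.
Proof.
move=> tri Sa Sb Sc au bu cu ax.
have us : edist u u <= s by rewrite distxx ltW.
have le x : edist x u = s -> edist x u <= s by move=> ->.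
have q0 := speed_ratio_ge0.
have [hs hl] := legs_pi.
have chain b' c' : is_triangle b' a c' -> S b' -> S c' -> edist b' u = s -> edist c' u = s ->
    vertex_cos b' a c' <= sin (phi / 2) -> angle_le X (triangle_mx b' a c') theta2.
  move=> tri' Sb' Sc' bu' cu' hc.
  have [U tU] := local_chart mfd Su; have [B tB] := local_chart mfd Sb'.
  have h1 : angle_le X U (speed * ratio) by apply: leg tX tU.
  have h2 : angle_le U B (speed * ratio).
    by apply: leg tU tB => //; rewrite ?le // distC le.
  have [ka1 E] := k2P.
  have h3 : angle_le B (triangle_mx b' a c') (asin (ratio * k2)).
    apply: vertex_angle tB _ _ k2_lt => //.
    apply: (@le_trans _ _ (1 + sin (phi / 2))); first by rewrite lerD2l.
    by rewrite E ler_wpM2l ?sqr_ge0 // lerD2l lerN2.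
  have a0 := asin_k ka1 k2_lt.
  apply: (angle_le_trans _ a0 hs _ h3); first exact: addr_ge0.
  apply: (angle_le_trans q0 q0 _ h1 h2).
  by apply: le_trans hs; rewrite lerDl.
have [hc|hc] := leP (vertex_cos a b c) (cos phi).
  left; have [A tA] := local_chart mfd Sa.
  have h1 : angle_le X A (speed * ratio).
    by apply: leg tX tA => //; rewrite ?le // distC.
  have [ka1 E] := k1P; have a0 := asin_k ka1 k1_lt.
  apply: (angle_le_trans q0 a0 hl h1).
  apply: vertex_angle tA _ _ k1_lt => //.
  apply: (@le_trans _ _ (1 + cos phi)); first by rewrite lerD2l.
  by rewrite E ler_wpM2l ?sqr_ge0 // lerD2l lerN2.
right; have sg : 0 <= sin (phi / 2).
  apply: sin_ge0_pi; case/andP: phiP; move: phi pi p0 => x y *.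
  by apply/andP; split; lra.
have [tb tc] := triangle_perm tri.
have [le1|le2] := leP (edist b a) (edist c a).
  have := chain b c tb Sb Sc bu cu (vertex_cos_other tri le1 (ltW hc) sg).
  by apply: angle_le_triangle => n [-> ->].
have hc' : cos phi <= vertex_cos a c b.
  by rewrite /vertex_cos dotC mulrC (mulrC (edist c a)) mulrC ltW.
have [tb' _] := triangle_perm tc.
have := chain c b tb' Sc Sb cu bu (vertex_cos_other tc (ltW le2) hc' sg).
by apply: angle_le_triangle => n [-> ->].
Qed.

End Cases.
End Comparison.

Section FlatsOfTheStatement.
Variables (R : realType) (d : nat) (S : set 'rV[R]_d).
Implicit Types a b c u z p q : 'rV[R]_d.

Lemma eucl_dist_edist z q : eucl_dist z q = edist z q.
Proof. by rewrite edist.unlock. Qed.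

Lemma lfs_ge0 u : 0 <= lfs S u.
Proof.
rewrite /lfs; set E := (X in inf X).
have [E0|/set0P/negP/negPn/eqP ->] := pselect (E !=set0); last by rewrite inf0.
by apply: lb_le_inf => // _ [m _ <-]; rewrite eucl_dist_edist dist_ge0.
Qed.

Lemma lfs_uniq_nearest u z q q' : edist z u < lfs S u ->
  closest S z q -> closest S z q' -> q = q'.
Proof.
rewrite !closestE => lt hq hq'; apply/eqP; apply: contraT => ne.
move: lt; rewrite ltNge => /negP; case; rewrite distC -eucl_dist_edist.
apply: ge_inf.
  by exists 0 => _ [m _ <-]; rewrite eucl_dist_edist dist_ge0.
by exists z => //; apply: subset_closure; exists q, q'; split.
Qed.

Lemma normal_flat_orth k p (A : 'M[R]_(k, d)) : tangent_matrix S p A ->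
  normal_flat S p = orth_flat A p.
Proof.
move=> tA; apply/seteqP; split=> q; rewrite /orth_flat /=.
  by move=> h; apply/(normal_matrix (q - p) tA); rewrite /normal addrC subrK.
by move/(normal_matrix (q - p) tA); rewrite /normal addrC subrK.
Qed.

Lemma triangle_normal_orth a b c u : triangle_normal a b c u ->
  triangle_normal a b c = orth_flat (triangle_mx a b c) u.
Proof.
rewrite /triangle_normal /= !eucl_dist_edist => -[uab ubc].
have E q x y : edist u x = edist u y -> edist q x = edist q y <-> dot (q - u) x = dot (q - u) y.
  move=> uxy; have h z : edist q z ^+ 2
      = dot (q - u) (q - u) + 2 * dot (q - u) u - 2 * dot (q - u) z + edist u z ^+ 2.
    rewrite !sqr_dist; have -> : q - z = (q - u) + (u - z) by rewrite addrA subrK.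
    by move: (q - u) => w; rewrite !dotE (dotC z w) (dotC u w); ring.
  have hx := h x; have hy := h y; split=> e.
    rewrite uxy in hx; rewrite e hy in hx.
    by move: hx; move: (dot _ x) (dot _ y) => *; lra.
  have e2 : edist q x ^+ 2 = edist q y ^+ 2 by rewrite hx hy uxy e.
  by apply/eqP; rewrite -(@eqrXn2 _ 2) ?dist_ge0 // e2.
apply/seteqP; split=> q /=; rewrite /orth_flat /= !eucl_dist_edist.
  move=> [/(E q _ _ uab) h1 /(E q _ _ ubc) h2]; apply/triangle_mxP_eq.
  by rewrite h1 h2.
move=> /triangle_mxP_eq[h1 h2]; split; first exact/(E q _ _ uab).
by apply/(E q _ _ ubc); rewrite -h1 h2.
Qed.

End FlatsOfTheStatement.

Section FinalBounds.
Variable R : realType.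

Lemma convex_gt (l m n t x y z : R) : 0 <= l -> 0 <= m -> 0 <= n -> l + m + n = 1 ->
  t < x -> t < y -> t < z -> t < l * x + m * y + n * z.
Proof.
move=> l0 m0 n0 lmn tx ty tz.
pose e := Num.min (x - t) (Num.min (y - t) (z - t)).
have e0 : 0 < e by rewrite !lt_min !subr_gt0 tx ty tz.
have ex : e <= x - t by rewrite ge_min lexx.
have ey : e <= y - t by rewrite !ge_min lexx orbT.
have ez : e <= z - t by rewrite !ge_min lexx !orbT.
have := ler_wpM2l l0 ex; have := ler_wpM2l m0 ey; have := ler_wpM2l n0 ez.
have nE : n = 1 - l - m by lra.
clearbody e; rewrite nE; lra.
Qed.

Lemma ratio_lt (eps : R) : 0 < eps -> eps <= 1 / 3 -> ratio eps < eps / (1 - eps).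
Proof.
move=> e0 e1; have e2 : eps ^+ 2 < eps.
  by rewrite expr2 gtr_pMr //; lra.
have e3 : 0 < 1 - eps ^+ 2 by lra.
rewrite /ratio ltr_pM2l // ltf_pV2 ?posrE //; lra.
Qed.

Lemma bound_near (eps ka : R) c : 0 < eps -> eps <= 1 / 3 -> 1 <= ka ->
  eps / (1 - eps) * ka <= 1 ->
  speed eps * ratio eps + asin (ratio eps * ka)
    <= eta c (eps / (1 - eps)) + asin (eps / (1 - eps) * ka).
Proof.
move=> e0 e1 ka1 le1; have lt := ratio_lt e0 e1; have q0 := ratio_gt0 e0 e1.
have d1 : 0 < 1 - eps by lra.
apply: lerD.
  apply: (@le_trans _ _ (eps / (1 - eps))); last first.
    by apply: eta_ge; [rewrite divr_ge0 // ltW|rewrite ler_pdivrMr //; lra].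
  have -> : eps / (1 - eps) = (1 + eps) * ratio eps.
    by rewrite /ratio; field; rewrite !gt_eqF //; rewrite expr2; nra.
  rewrite ler_pM2r // /speed; have := sqr_ge0 eps; lra.
rewrite -subr_ge0; apply: (le_trans _ (asin_diff _ _ _)) => //.
- by rewrite subr_ge0 ler_wpM2r ?(ltW lt) // (le_trans ler01).
- by rewrite (le_trans (lerN10 _)) // mulr_ge0 ?(ltW q0) // (le_trans ler01).
- by rewrite ler_wpM2r ?(ltW lt) // (le_trans ler01).
Qed.

(* 2 (speed * ratio - eps) is equal to eps / (1 - eps) - ratio, which asin gains
   back since its slope is at least 1. *)
Lemma bound_far (eps ka : R) c : 0 < eps -> eps <= 1 / 3 -> 1 <= ka ->
  eps / (1 - eps) * ka <= 1 ->
  speed eps * ratio eps + speed eps * ratio eps + asin (ratio eps * ka)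
    <= 2 * eta c eps + asin (eps / (1 - eps) * ka).
Proof.
move=> e0 e1 ka1 le1; have lt := ratio_lt e0 e1; have q0 := ratio_gt0 e0 e1.
have d1 : 0 < 1 - eps by lra.
have d2 : 0 < 1 - eps ^+ 2 by rewrite expr2; nra.
have h1 : eps <= eta c eps by apply: eta_ge; lra.
have h2 : eps / (1 - eps) * ka - ratio eps * ka
    <= asin (eps / (1 - eps) * ka) - asin (ratio eps * ka).
  apply: asin_diff => //.
    by rewrite (le_trans (lerN10 _)) // mulr_ge0 ?(ltW q0) // (le_trans ler01).
  by rewrite ler_wpM2r ?(ltW lt) // (le_trans ler01).
have h3 : eps / (1 - eps) - ratio eps <= eps / (1 - eps) * ka - ratio eps * ka.
  by rewrite -mulrBl ler_peMr // subr_ge0 ltW.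
have h4 : eps / (1 - eps) = (1 + eps) * ratio eps.
  by rewrite /ratio; field; rewrite !gt_eqF.
have h5 : eps = (1 - eps ^+ 2) * ratio eps.
  by rewrite /ratio; field; rewrite gt_eqF.
have h6 : speed eps * ratio eps + speed eps * ratio eps
    = 2 * eps + (eps / (1 - eps) - ratio eps).
  have -> : 2 * eps = 2 * ((1 - eps ^+ 2) * ratio eps) by rewrite -h5.
  by rewrite h4 /speed; field.
rewrite h6; clear h4 h5 h6; move: h1 h2 h3.
move: (asin (eps / (1 - eps) * ka)) (asin (ratio eps * ka)) => x y.
by move: (eps / (1 - eps) * ka) (ratio eps * ka) (eta c eps) => *; lra.
Qed.

End FinalBounds.

Unset Implicit Arguments.
Theorem lemma12 (R : realType) (d k : nat) (hk : (2 <= k < d)%N)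
  (Sigma : set 'rV[R]_d)
  (Sigma_compact : compact Sigma) (Sigma_mfd : smooth_submanifold k Sigma)
  (v v' v'' : 'rV[R]_d) (htau : is_triangle v v' v'')
  (hv : Sigma v) (hv' : Sigma v') (hv'' : Sigma v'')
  (u : 'rV[R]_d) (hu : (Sigma `&` triangle_normal v v' v'') u)
  (s : R) (hs : s = eucl_dist v u) (hs' : s = eucl_dist v' u) (hs'' : s = eucl_dist v'' u)
  (eps : R) (heps : eps <= 1 / 3) (hlfs : s <= eps * lfs Sigma u)
  (x : 'rV[R]_d) (hx : triangle v v' v'' x)
  (xt : 'rV[R]_d) (hxt : nearest Sigma x xt)
  (* angles are in radians: 60 degrees is pi / 3 and 45 degrees is pi / 4 *)
  (phi : R) (hphi : 0 < phi <= pi / 3)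
  (hdef1 : -1 <= eps / (1 - eps) * cot (phi / 2) <= 1)
  (hdef2 : -1 <= eps / (1 - eps) * cot (pi / 4 - phi / 4) <= 1) :
  flat_angle (triangle_normal v v' v'') (normal_flat Sigma xt)
    <= Num.max
         (eta (d - k) (eps / (1 - eps))
          + asin (eps / (1 - eps) * cot (phi / 2)))
         (2 * eta (d - k) eps
          + asin (eps / (1 - eps) * cot (pi / 4 - phi / 4))).
Proof.
have [Su hu'] := hu; have tri := htau.
have {}hu : edist v u = s /\ edist v' u = s /\ edist v'' u = s.
  by rewrite -!eucl_dist_edist.
have [vu [v'u v''u]] := hu.
have s0 : 0 < s.
  rewrite -vu lt_def dist_ge0 andbT; apply/eqP => E.
  have := (triangle_dist_gt0 tri).1; rewrite (dist_eq0 E).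
  by rewrite v'u -vu E ltxx.
have l0 := lfs_ge0 Sigma u.
have e0 : 0 < eps.
  rewrite ltNge; apply/negP => en.
  by have := mulr_le0_ge0 en l0; rewrite leNgt (lt_le_trans s0 hlfs).
have uniq z q q' : edist z u < s / eps -> closest Sigma z q -> closest Sigma z q' -> q = q'.
  move=> zu; apply: (lfs_uniq_nearest (u := u)); apply: (lt_le_trans zu).
  by rewrite ler_pdivrMr // mulrC.
have sL : 3 * s <= s / eps.
  by rewrite ler_pdivlMr // mulrAC ler_piMl ?(ltW s0) //; lra.
have cx : closest Sigma x xt by rewrite closestE.
have Sx := cx.1.
have [X tX] := local_chart Sigma_mfd Sx.
have [l [m [n [l_0 m_0 n_0 lmn xE]]]] := hx.
have lev a : edist a u = s -> edist a u <= s by move=> ->.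
have pN := pnormalN Sigma_mfd.
have [xu hQ _] := nearest_hull Sigma_compact Su uniq (@pN) hv hv' hv'' (lev _ vu)
  (lev _ v'u) (lev _ v''u) s0 sL l_0 m_0 n_0 lmn xE cx.
case/andP: (hphi) => phi0 phipi.
have p0 := @pi_gt0 R.
have phi2 : 0 < phi <= pi / 2 by apply/andP; split; lra.
have [k1_1 _] := cot_half phi2.
have psi2 : 0 < pi / 2 - phi / 2 <= pi / 2 by apply/andP; split; lra.
have [k2_1 _] := cot_half psi2.
have psiE : (pi / 2 - phi / 2) / 2 = pi / 4 - phi / 4 by field.
rewrite psiE in k2_1.
have {hdef1} h1 : eps / (1 - eps) * cot (phi / 2) <= 1 by case/andP: hdef1.
have {hdef2} h2 : eps / (1 - eps) * cot (pi / 4 - phi / 4) <= 1 by case/andP: hdef2.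
have lt1 ka : 1 <= ka -> eps / (1 - eps) * ka <= 1 -> ratio eps * ka < 1.
  move=> ka1 le; apply: lt_le_trans le; rewrite ltr_pM2r ?(lt_le_trans ltr01) //.
  exact: ratio_lt.
have k1_lt := lt1 _ k1_1 h1; have k2_lt := lt1 _ k2_1 h2.
have key t : angle_le X (triangle_mx v v' v'') t -> 0 <= t <= pi ->
    flat_angle (triangle_normal v v' v'') (normal_flat Sigma xt) <= t.
  move=> hX ht.
  rewrite (triangle_normal_orth hu') (normal_flat_orth tX).
  apply: flat_angle_le => //; first exact: triangle_mx_free.
    by case: tX.
  by case/andP: hk => ? /ltnW ->; rewrite andbT.
have [th1 th2] := theta_bounds e0 heps hphi k1_lt k2_lt.
have near a b c : is_triangle a b c -> Sigma a -> Sigma b -> Sigma c ->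
    edist a u = s -> edist b u = s -> edist c u = s -> edist a xt <= s ->
  angle_le X (triangle_mx a b c) (theta1 eps phi) \/
  angle_le X (triangle_mx a b c) (theta2 eps phi).
  exact: (near_vertex Sigma_compact Su Sigma_mfd s0 e0 heps uniq).
have fin : angle_le X (triangle_mx v v' v'') (theta1 eps phi) \/
    angle_le X (triangle_mx v v' v'') (theta2 eps phi).
  have [t1 t2] := triangle_perm tri.
  have [t3 _] := triangle_perm t2.
  have [|vx] := leP (edist v xt) s; first exact: near.
  have [h|v'x] := leP (edist v' xt) s.
    case: (near _ _ _ t1) => // hh; [left|right]; move: hh;
      by apply: angle_le_triangle => w [-> ->].
  have [h|v''x] := leP (edist v'' xt) s.
    case: (near _ _ _ t3) => // hh; [left|right]; move: hh;
      by apply: angle_le_triangle => w [-> ->].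
  exfalso; move: hQ; rewrite leNgt => /negP; apply.
  have sq a : s < edist a xt -> s ^+ 2 < edist a xt ^+ 2.
    by move=> h; rewrite ltrXn2r ?nnegrE ?dist_ge0 // ltW.
  exact: convex_gt (sq _ vx) (sq _ v'x) (sq _ v''x).
rewrite le_max; case: fin => hX; apply/orP; [left|right].
  apply: le_trans (key _ hX th1) _; exact: bound_near.
apply: le_trans (key _ hX th2) _; exact: bound_far.
Qed.
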